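(* Let $g\in L^2(U)$, $U=[0,1]$, and let $F(q):L^2(U)\to\mathbb{R}\cup\{\infty\}$, $q\in\mathcal{Q}$, be the family of functionals defined in the context. Let $q_s=(\gamma_s,\mu_s,t_s)\in\mathcal{Q}$, $s\in\mathbb{N}$, be a sequence of parameters converging to $q=(\gamma,\mu,t)\in\mathcal{Q}$. Then $F(q_s)$ $\Gamma$-converges to $F(q)$ on $L^2(U)$ as $s\to\infty$.
   Context: $\Gamma$-convergence: for a metric space $X$ and functions $F_j,F_\infty:X\to\overline{\mathbb{R}}$, $F_j$ $\Gamma$-converges to $F_\infty$ if (i) for all $x\in X$ and all sequences $x_j\to x$ in $X$, $F_\infty(x)\le\liminf_{j\to\infty}F_j(x_j)$, and (ii) for all $x\in X$ there is a sequence $\hat x_j\to x$ in $X$ with $F_\infty(x)\ge\limsup_{j\to\infty}F_j(\hat x_j)$. Here $X=L^2(U)$ with the norm metric. $U=[0,1]$, $\|\cdot\|$ is the norm of $L^2(U)$ (real-valued functions, Lebesgue measure); elements of the function classes below are identified with their $L^2$-equivalence classes. $\mathcal{T}(U)$ is the set of right-continuous step functions on $U$ (finitely many jumps) that are continuous at $1$. For $n\in\mathbb{N}=\{1,2,\dots\}$, $\mathcal{T}_n(U)\subset\mathcal{T}(U)$ is the set of functions constant on each of the intervals $[\frac{\kappa}{n},\frac{\kappa+1}{n})$, $\kappa=0,\dots,n-2$, and $[\frac{n-1}{n},1]$; $\sigma_n$ is the $\sigma$-algebra generated by these intervals and $g_n=E(g\mid\sigma_n)\in\mathcal{T}_n(U)$,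 i.e. $g_n(\frac{\kappa}{n})=n\int_{\kappa/n}^{(\kappa+1)/n}g(s)\,ds$. $\mathrm{SBV}_2(U)$ is the set of $f\in L^2(U)$ that can be written $f=t+F$ with $t\in\mathcal{T}(U)$ and $F\in H^1((0,1))$; $t,F$ are unique up to an additive constant. For such $f$, $j(f)$ is the number of discontinuities of $t$ in $(0,1)$ and $f'$ denotes the Sobolev derivative of $F$. $\mathbb{T}=\{1/n: n\in\mathbb{N}\}\cup\{0\}\subset\mathbb{R}$ with the relative topology, and $\mathcal{Q}=[0,\infty)\times[0,\infty)\times\mathbb{T}$ with the product topology. For $(\gamma,\mu,t)\in\mathcal{Q}$, writing $t=1/n$ if $t>0$, define $F(\gamma,\mu,t)$ as follows. - $\gamma>0,\mu>0,t=1/n$ (Blake-Zisserman): $F(\gamma,\mu,t)(f)=\sum_{\kappa=0}^{n-2}\min\{\frac{n}{\mu^2}(f(\frac{\kappa+1}{n})-f(\frac{\kappa}{n}))^2,\gamma\}+\frac1n\sum_{\kappa=0}^{n-1}(f-g_n)^2(\frac{\kappa}{n})$ if $f\in\mathcal{T}_n(U)$, and $\infty$ otherwise. - $\gamma>0,\mu>0,t=0$ (Mumford-Shah): $F(\gamma,\mu,t)(f)=\gamma j(f)+\frac{1}{\mu^2}\int_U|f'|^2ds+\|f-g\|^2$ if $f\in\mathrm{SBV}_2(U)$, and $\infty$ otherwise. - $\gamma>0,\mu=0,t=1/n$ (discrete Potts): $F(\gamma,\mu,t)(f)=\gamma\,|\{\kappa\in\{0,\dots,n-2\}: f(\frac{\kappa+1}{n})\ne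 f(\frac{\kappa}{n})\}|+\frac1n\sum_{\kappa=0}^{n-1}(f-g_n)^2(\frac{\kappa}{n})$ if $f\in\mathcal{T}_n(U)$, and $\infty$ otherwise. - $\gamma>0,\mu=0,t=0$ (continuous Potts): $F(\gamma,\mu,t)(f)=\gamma j(f)+\|f-g\|^2$ if $f\in\mathcal{T}(U)$, and $\infty$ otherwise. - $\gamma=0,\mu\ge0,t=1/n$: $F(\gamma,\mu,t)(f)=\frac1n\sum_{\kappa=0}^{n-1}(f-g_n)^2(\frac{\kappa}{n})$ if $f\in\mathcal{T}_n(U)$, and $\infty$ otherwise. - $\gamma=0,\mu\ge0,t=0$: $F(\gamma,\mu,t)(f)=\int_U(f-g)^2ds$. *)

(* Defs.v *)
From HB Require Import structures.
From mathcomp Require Import all_boot all_order all_algebra.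
From mathcomp Require Import finmap.
From mathcomp Require Import all_classical all_reals all_analysis.
From mathcomp Require Import measurable_realfun.

Set Implicit Arguments.
Unset Strict Implicit.
Unset Printing Implicit Defensive.

Import Order.TTheory GRing.Theory Num.Theory.
Import numFieldNormedType.Exports.

Local Open Scope classical_set_scope.
Local Open Scope ring_scope.

Definition gamma_cvg (R : realType) (X : metricType R)
    (F_ : nat -> X -> \bar R) (F : X -> \bar R) : Prop :=
  (forall (x : X) (x_ : nat -> X), x_ @ \oo --> x ->
     (F x <= limn_einf (fun j => F_ j (x_ j)))%E) /\
  (forall x : X, exists2 x_ : nat -> X, x_ @ \oo --> x &
     (limn_esup (fun j => F_ j (x_ j)) <= F x)%E).

(* Functions on U = [0, 1] are total functions on R; only their values on
   [0, 1] matter.  The measure below is the Lebesgue measure restricted to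
   [0, 1], so that [LspaceType2 (muU R)] is L^2(U), whose elements are classes
   of functions modulo equality almost everywhere in [0, 1]. *)
Section L2U.
Variable R : realType.

Let mU : measurable (`[0%R, 1%R]%classic : set (measurableTypeR R)).
Proof. exact: measurable_itv. Qed.

Let muU_lty : (lebesgue_measure (`[0%R, 1%R]%classic : set (measurableTypeR R))
  < +oo)%E.
Proof. by rewrite lebesgue_measure_itv/= lte_fin ltr01 oppr0 adde0 ltry. Qed.

Definition muU : {finite_measure set (measurableTypeR R) -> \bar R} :=
  mfrestr mU muU_lty.

Definition L2U : Type := LspaceType2 muU.

Definition L2fun (f : L2U) : R -> R := f.

Definition normL2 (f : R -> R) : R := fine ('N[muU]_2%:E[EFin \o f])%E.

Definition distL2 (f g : L2U) : R := normL2 (L2fun f \- L2fun g).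

Lemma mL2 (f : L2U) :
  measurable_fun setT (L2fun f : measurableTypeR R -> measurableTypeR R).
Proof. exact: measurable_funPT (repr (LebesgueSpace.sort f)). Qed.

Lemma fL2 (f : L2U) : (f : measurableTypeR R -> R) \in Lfun muU 2%:E.
Proof.
apply/andP; split; first exact: valP (repr (LebesgueSpace.sort f)).
by rewrite inE/=; exact: Lebesgue_finite.
Qed.

Lemma distL2E (f g : L2U) :
  ((distL2 f g)%:E = 'N[muU]_2%:E[EFin \o (L2fun f \- L2fun g)%R])%E.
Proof.
have : (L2fun f \- L2fun g)%R \in Lfun muU 2%:E.
  by have := rpredB (fL2 f) (fL2 g); apply; rewrite lee1n.
move=> /andP[_]; rewrite inE/= /finite_norm => h.
by rewrite /distL2 /normL2 fineK// ge0_fin_numE// Lnorm_ge0.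
Qed.

Let distL2xx (f : L2U) : distL2 f f = 0.
Proof.
rewrite /distL2 /normL2 (_ : EFin \o _ = cst 0%E) ?Lnorm0//.
by apply/funext => x /=; rewrite subrr.
Qed.

Let distL2_positivity (f g : L2U) : distL2 f g = 0 -> f = g.
Proof.
move=> fg0; have := distL2E f g; rewrite fg0 => /esym/Lnorm_eq0_eq0.
have /measurable_EFinP mfg := measurable_funB (mL2 f) (mL2 g).
move=> /(_ mfg (ltr0n _ 2)) fg.
have {fg}: LebesgueSpace.sort f = LebesgueSpace.sort g.
  rewrite -[LHS]reprK -[RHS]reprK; apply/eqP/ae_eqP.
  apply: filterS fg => x /= /(_ I) [] /eqP; rewrite subr_eq0 => /eqP fgx _.
  exact: fgx.
case: f g {fg0 mfg} => [f [[Pf]]] [g [[Pg]]] /= fg.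
by rewrite fg in Pf *; rewrite (bool_irrelevance Pf Pg).
Qed.

Let distL2_sym (f g : L2U) : distL2 f g = distL2 g f.
Proof.
apply: EFin_inj; rewrite !distL2E -oppe_Lnorm; apply: eq_Lnorm => x /=.
by rewrite opprB.
Qed.

Let distL2_triangle (g f h : L2U) : distL2 f h <= distL2 f g + distL2 g h.
Proof.
rewrite -lee_fin EFinD !distL2E.
rewrite (_ : L2fun f \- L2fun h =
  (L2fun f \- L2fun g) \+ (L2fun g \- L2fun h)); last first.
  by apply/funext => x /=; rewrite addrA subrK.
apply: eminkowski; last by rewrite lee1n.
- exact: measurable_funB (mL2 f) (mL2 g).
- exact: measurable_funB (mL2 g) (mL2 h).
Qed.

HB.instance Definition _ := gen_eqMixin L2U.
HB.instance Definition _ := gen_choiceMixin L2U.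
HB.instance Definition _ := @isMetric.Build R L2U distL2
  distL2xx distL2_positivity distL2_sym distL2_triangle.

End L2U.

Coercion L2fun : L2U >-> Funclass.

Section function_classes.
Variable R : realType.
Implicit Types (f F v : L2U R) (t phi : R -> R) (n : nat).

(* T(U): constant on the subintervals of [0, 1] that avoid a finite set s,
   right-continuous on [0, 1), continuous at 1 (relatively to [0, 1]). *)
Definition stepU : set (R -> R) := [set t : R -> R |
  [/\ exists s : seq R, forall x y, 0 <= x -> x <= y -> y <= 1 ->
        (forall z, z \in s -> ~~ (x <= z <= y)) -> t x = t y,
      forall x, 0 <= x < 1 -> t @ x^'+ --> t x
    & t @ 1^'- --> t 1]].

Definition cell n (k : nat) : set R :=
  if k.+1 == n then `[k%:R / n%:R, 1]%classic
  else `[k%:R / n%:R, k.+1%:R / n%:R[%classic.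

Definition stepUn n : set (R -> R) := [set t : R -> R | stepU t /\
  forall k, (k < n)%N -> forall x y, cell n k x -> cell n k y -> t x = t y].

(* Membership of the L^2-class f in a class C of functions is witnessed by a
   representative; within stepU, it is unique on [0, 1]. *)
Definition reps (C : set (R -> R)) f : set (R -> R) :=
  [set t : R -> R | C t /\ (f : R -> R) = t %[ae muU R]].

Definition in_class (C : set (R -> R)) : set (L2U R) :=
  [set f | reps C f !=set0].

Definition rep (C : set (R -> R)) f : R -> R := xget (f : R -> R) (reps C f).

Definition njumps t : nat :=
  #|` fset_set [set x : R | 0 < x < 1 /\ ~ {for x, continuous t}]|.

Definition test_function phi : Prop :=
  let supp : set R := closure [set x | phi x != 0] in
  [/\ forall k x, derivable (derive1n k phi) x 1, compact supp
    & supp `<=` `]0, 1[].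

Definition weak_derivative F v : Prop := forall phi, test_function phi ->
  \int[muU R]_x (F x * derive1 phi x) = - \int[muU R]_x (v x * phi x).

Definition H1 : set (L2U R) := [set F | exists v, weak_derivative F v].

(* The default value F is irrelevant: it is only used when F is not in H1. *)
Definition sobolev_derivative F : L2U R := xget F [set v | weak_derivative F v].

Definition sbv2_decompositions f : set ((R -> R) * L2U R) :=
  [set tF | [/\ stepU tF.1, H1 tF.2
    & (f : R -> R) = (fun x => tF.1 x + tF.2 x) %[ae muU R]]].

Definition SBV2 : set (L2U R) := [set f | sbv2_decompositions f !=set0].

(* Decompositions are unique up to an additive constant, which affects neither
   the number of jumps nor the derivative. *)
Definition sbv2_decomposition f : (R -> R) * L2U R :=
  xget (cst 0, f) (sbv2_decompositions f).

Definition sbv2_jumps f : nat := njumps (sbv2_decomposition f).1.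

Definition sbv2_derivative f : L2U R :=
  sobolev_derivative (sbv2_decomposition f).2.

End function_classes.

Section functionals.
Variables (R : realType) (g : L2U R).
Implicit Types (gamma mu t : R) (n : nat) (f : L2U R) (u : R -> R).

(* g_n = E(g | sigma_n), as an element of T_n(U). *)
Definition cond_mean n : R -> R := fun x =>
  \sum_(k < n)
    n%:R * (\int[muU R]_(s in `[k%:R / n%:R, k.+1%:R / n%:R]) g s)
    * \1_(cell n k) x.

Definition extend_pinfty (C : set (L2U R)) (E : L2U R -> R) f : \bar R :=
  if `[< C f >] then (E f)%:E else +oo%E.

Definition discrete_fidelity n u : R :=
  n%:R^-1 * \sum_(k < n) (u (k%:R / n%:R) - cond_mean n (k%:R / n%:R)) ^+ 2.

Definition blake_zisserman gamma mu n : L2U R -> \bar R :=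
  extend_pinfty (in_class (stepUn n)) (fun f => let u := rep (stepUn n) f in
    \sum_(k < n.-1) Num.min
      (n%:R / mu ^+ 2 * (u (k.+1%:R / n%:R) - u (k%:R / n%:R)) ^+ 2) gamma
    + discrete_fidelity n u).

Definition mumford_shah gamma mu : L2U R -> \bar R :=
  extend_pinfty (@SBV2 R) (fun f =>
    gamma * (sbv2_jumps f)%:R
    + (mu ^+ 2)^-1 * (\int[muU R]_x (sbv2_derivative f x) ^+ 2)
    + normL2 (f \- g) ^+ 2).

Definition discrete_potts gamma n : L2U R -> \bar R :=
  extend_pinfty (in_class (stepUn n)) (fun f => let u := rep (stepUn n) f in
    gamma * #|[pred k : 'I_n.-1 | u (k.+1%:R / n%:R) != u (k%:R / n%:R)]|%:R
    + discrete_fidelity n u).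

Definition continuous_potts gamma : L2U R -> \bar R :=
  extend_pinfty (in_class (@stepU R)) (fun f =>
    gamma * (sbv2_jumps f)%:R + normL2 (f \- g) ^+ 2).

Definition discrete_L2 n : L2U R -> \bar R :=
  extend_pinfty (in_class (stepUn n)) (fun f =>
    discrete_fidelity n (rep (stepUn n) f)).

Definition continuous_L2 f : \bar R :=
  (\int[muU R]_x (f x - g x) ^+ 2)%:E.

(* When t = 1/n, [Num.truncn t^-1] is n. *)
Definition functional (q : R * R * R) : L2U R -> \bar R :=
  let: (gamma, mu, t) := q in
  let n := Num.truncn t^-1 in
  if 0 < gamma then
    if 0 < mu then
      if 0 < t then blake_zisserman gamma mu n else mumford_shah gamma mu
    else
      if 0 < t then discrete_potts gamma n else continuous_potts gamma
  else
    if 0 < t then discrete_L2 n else continuous_L2.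

End functionals.

Definition scales (R : realType) : set R :=
  [set t | t = 0 \/ exists2 n : nat, (0 < n)%N & t = n%:R^-1].

Definition parameters (R : realType) : set (R * R * R) :=
  [set q | [/\ 0 <= q.1.1, 0 <= q.1.2 & scales q.2]].

(* Main.v *)
Require Import Defs.
From mathcomp Require Import all_boot all_order all_algebra.
From mathcomp Require Import finmap.
From mathcomp Require Import all_classical all_reals all_analysis.
From mathcomp Require Import measurable_realfun.
From mathcomp Require Import ring lra.

(** Every functional of the family has the form
    [[
      energy (f) + |f - g|^2 - (defect of the mesh),
    ]]
    the defect being the squared distance from g to the functions constant on
    the cells: g - E(g | sigma_n) is orthogonal to these functions
    ([pythagoras], [discrete_fidelityE]).  The defect vanishes with the mesh
    ([defect_cvg]) and |f - g|^2 is continuous on L^2, so that only the energies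
    matter.  The energy without mesh is
    gamma * (number of jumps of t) + mu^-2 * |v|^2 on the functions
    f = t + prim v, where t is a step function and prim v is the primitive of v;
    Potts is the case v = 0, and gamma = 0 means no energy at all.  On a mesh the
    energy is a sum of interaction potentials [pot] of neighbouring cells.

    Lower bound, vanishing mesh, gamma > 0 ([liminf_vanishing_mesh]).
    Energies pass to the limit in dual form.  A function f of finite energy comes
    with a finite set K of points, its jumps or the nodes where the potential is
    saturated, such that
    [[
      2 * ip f phi' - |phi|^2 <= mu^2 * (energy left after paying for K)
    ]]
    for all test functions phi vanishing near K, with phi replaced by its samples
    in |phi|^2 if there is a mesh ([duality_bound]): this is Young's inequality
    after an integration or a summation by parts.  Since gamma > 0 the
    sets K have bounded cardinality; along an ultrafilter their cardinality is
    constant and their points converge.  A test function that vanishes near the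
    limit points vanishes near K eventually, so the inequality survives in the
    limit.  Conversely the inequality characterises the limit energy
    ([decomp_of_duality_bound]): by a Riesz representation f has a square
    integrable weak derivative v off the limit points, with |v|^2 bounded by the
    right-hand side, and f - prim v is constant between them by the lemma of
    du Bois-Reymond.  When mu = 0 the bound forces v = 0.
    For gamma = 0 the energies are simply dropped ([fidelity_le]).

    Upper bound, vanishing mesh ([recovery]).  The values of t + prim v at the
    nodes define a function on the mesh whose energy does not exceed that of f
    ([sample_energy]): an interval with a jump costs at most gamma, and the
    Cauchy-Schwarz inequality bounds the others by the integral of v^2.  Sampling
    converges in L^2 by dominated convergence ([sample_cvg_sbv]).  For gamma = 0
    there is no energy and step functions, which are dense, have free recovery
    sequences ([recovery_gamma0]).

    If the limit mesh is 1/n, then n is eventually constant ([scales_isolated])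
    and everything takes place in a space of dimension n, where averages over the
    cells converge ([mean_cvg]).  The potentials converge as functions of their
    parameters, except at a zero increment when mu tends to 0, where they are
    only lower semicontinuous ([pot_cvg], [pot_lsc]); keeping the sequence
    constant avoids that case in the upper bound. *)

Set Implicit Arguments.
Unset Strict Implicit.
Unset Printing Implicit Defensive.

Import Order.TTheory GRing.Theory Num.Theory.
Import numFieldNormedType.Exports.

Local Open Scope classical_set_scope.
Local Open Scope ring_scope.

#[local] Instance ae_muU_filter (R : realType) : Filter (almost_everywhere (muU R)).
Proof. exact: ae_filter_ringOfSetsType. Qed.

(** * Square-integrable functions on the unit interval *)

Section restricted_measure.
Variable R : realType.
Implicit Types (f g : R -> R) (A : set (measurableTypeR R)).
Notation mu := (@lebesgue_measure R).

Lemma muUE A : muU R A = mu (A `&` `[0, 1]%classic).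
Proof. by []. Qed.

Lemma muU_setCitv : muU R (~` `[0, 1]%classic) = 0%E.
Proof. by rewrite muUE setICl measure0. Qed.

Lemma mUI : measurable (`[0, 1]%classic : set (measurableTypeR R)).
Proof. exact: measurable_itv. Qed.

Lemma ae_muU (P : R -> Prop) :
  {ae muU R, forall x, P x} <-> {ae mu, forall x, `[0, 1]%classic x -> P x}.
Proof.
split=> -[N [mN N0 sN]].
  exists (N `&` `[0, 1]%classic); split => //.
  - by apply: measurableI => //; exact: mUI.
  - move=> x /= /not_implyP[x01 nP]; split => //; exact: sN.
exists (N `|` ~` `[0, 1]%classic); split.
- by apply: measurableU => //; apply: measurableC; exact: mUI.
- rewrite muUE setIUl setICl setU0; apply/eqP; rewrite eq_le measure_ge0 andbT.
  rewrite -[leRHS]N0; apply: le_measure; rewrite ?inE//.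
  by apply: measurableI => //; exact: mUI.
- move=> x /= nP; case: (pselect (`[0, 1]%classic x)) => x01; last by right.
  by left; apply: sN => /= /(_ x01).
Qed.

Notation mfunR f := (measurable_fun [set: measurableTypeR R] (f : R -> R)).

Definition Int f := (muU R).-integrable setT (EFin \o f).
Definition I f : R := \int[muU R]_x f x.

Lemma integrable_muU f : mfunR f ->
  Int f <-> mu.-integrable `[0, 1]%classic (EFin \o f).
Proof.
move=> mf.
have mc : measurable (~` `[0, 1]%classic : set (measurableTypeR R)).
  by apply: measurableC; exact: mUI.
have mEf : measurable_fun [set: measurableTypeR R] (EFin \o f).
  exact/measurable_EFinP.
rewrite /Int (@negligible_integrable _ _ _ (muU R) setT (~` `[0, 1]%classic)) //.
rewrite setTD setCK.
have e : (\int[muU R]_(x in `[0%R, 1%R]%classic) `|(EFin \o f) x| =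
  \int[mu]_(x in `[0%R, 1%R]) `|(EFin \o f) x|)%E.
  by apply: eq_measure_integral => A mA A01; rewrite [LHS]muUE setIidl.
split => /integrableP[mf' h]; apply/integrableP; split => //.
  by rewrite -e.
by rewrite e.
exact: muU_setCitv.
Qed.

Lemma I_muU f : mfunR f -> Int f -> I f = \int[mu]_(x in `[0, 1]) f x.
Proof.
move=> mf intf; congr fine.
rewrite (@negligible_integral _ _ _ (muU R) setT (~` `[0, 1]%classic)) //.
- rewrite setTD setCK; apply: eq_measure_integral => A mA A01.
  by rewrite [LHS]muUE setIidl.
- by apply: measurableC; exact: mUI.
- exact: muU_setCitv.
Qed.

(** Functions are handled pointwise, with equality almost everywhere kept explicit,
    so that test functions, primitives and step functions can be added and
    evaluated freely; classes come back only with [L2_class]. *)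
Definition eqae f g := {ae muU R, forall x, f x = g x}.

Lemma eqaeP f g : f = g %[ae muU R] <-> eqae f g.
Proof. by split; apply: filterS => x; [apply|move=> ->]. Qed.

Lemma eqae_refl f : eqae f f.
Proof. exact: aeW. Qed.

Lemma eqae_sym f g : eqae f g -> eqae g f.
Proof. by apply: filterS => x. Qed.

Lemma eqae_trans f g h : eqae f g -> eqae g h -> eqae f h.
Proof. by apply: filterS2 => x -> ->. Qed.

Lemma eq_I f g : mfunR f -> mfunR g -> eqae f g -> I f = I g.
Proof.
move=> mf mg fg; congr fine; apply: ae_eq_integral => //;
  do ?exact/measurable_EFinP.
by apply: filterS fg => x /= -> _.
Qed.

Lemma eq_Int f g : mfunR f -> mfunR g -> eqae f g -> Int f -> Int g.
Proof.
move=> mf mg fg intf.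
apply/integrableP; split; first exact/measurable_EFinP.
case/integrableP: intf => _; congr (_ < _)%E; apply: ae_eq_integral => //;
  do ?by apply/measurable_EFinP/measurableT_comp.
by apply: filterS fg => x /= -> _.
Qed.

Lemma le_Int f g : mfunR f -> (forall x, `|f x| <= g x) -> Int g -> Int f.
Proof.
move=> mf fg ig; apply: le_integrable ig => //; first exact/measurable_EFinP.
by move=> x _; rewrite /= lee_fin (le_trans (fg x))// ler_norm.
Qed.

Lemma IntD f g : Int f -> Int g -> Int (fun x => f x + g x).
Proof. by move=> If Ig; exact: (integrableD measurableT If Ig). Qed.

Lemma IntZ k f : Int f -> Int (fun x => k * f x).
Proof. by move=> If; exact: (integrableZl measurableT k If). Qed.

Lemma I_D f g : Int f -> Int g -> I (fun x => f x + g x) = I f + I g.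
Proof. by move=> ? ?; exact: RintegralD. Qed.

Lemma I_B f g : Int f -> Int g -> I (fun x => f x - g x) = I f - I g.
Proof. by move=> ? ?; exact: RintegralB. Qed.

Lemma I_Z k f : Int f -> I (fun x => k * f x) = k * I f.
Proof. by move=> ?; exact: RintegralZl. Qed.

Lemma I_ge0 f : (forall x, 0 <= f x) -> 0 <= I f.
Proof. by move=> ?; exact: Rintegral_ge0. Qed.

Lemma le_I f g : Int f -> Int g -> (forall x, f x <= g x) -> I f <= I g.
Proof. by move=> ? ? ?; apply: le_Rintegral. Qed.

Lemma Int_mfun f : Int f -> mfunR f.
Proof. by move=> /measurable_int/measurable_EFinP. Qed.

Lemma Int_bounded f M : mfunR f -> (forall x, 0 <= x <= 1 -> `|f x| <= M) ->
  Int f.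
Proof.
move=> mf fM; apply/integrable_muU => //.
apply: measurable_bounded_integrable; first exact: mUI.
- have := @lebesgue_measure_itv R `[0, 1]; rewrite /= lte_fin ltr01 => ->.
  by rewrite oppr0 adde0 ltry.
- exact: measurable_funTS.
- exists M; split; first exact: num_real.
  move=> B MB x /=; rewrite in_itv/= => x01.
  by rewrite (le_trans (fM _ x01))// ltW.
Qed.

Definition L2 f := mfunR f /\ Int (fun x => f x ^+ 2).

Lemma L2_Lfun f : L2 f <-> (f : measurableTypeR R -> R) \in Lfun (muU R) 2%:E.
Proof.
split=> [[mf intf]|Lf]; last first.
  split; last exact: Lfun2_integrable_sqr.
  by case/andP: Lf; rewrite inE.
apply/andP; split; rewrite inE//= /finite_norm unlock /=.
have e : (\int[muU R]_x (`|f x| `^ 2)%:E = \int[muU R]_x (f x ^+ 2)%:E)%E.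
  by apply: eq_integral => x _; rewrite powR_mulrn// real_normK// num_real.
rewrite e; apply: poweR_lty; have := integrable_lty _ intf.
exact.
Qed.

Definition ip f g := I (fun x => f x * g x).
Definition nsq f := ip f f.

Lemma L2_mfun f : L2 f -> mfunR f. Proof. by case. Qed.

Lemma Int_mul f g : L2 f -> L2 g -> Int (fun x => f x * g x).
Proof.
move=> [mf if2] [mg ig2].
apply: (le_Int _ _ (IntD if2 ig2)); first exact: measurable_funM.
move=> x; rewrite normrM -[f x ^+ 2]real_normK ?num_real//.
rewrite -[g x ^+ 2]real_normK ?num_real//.
have := normr_ge0 (f x); have := normr_ge0 (g x).
by move: `|_| `|_| => a b; nra.
Qed.

Lemma L2D f g : L2 f -> L2 g -> L2 (fun x => f x + g x).
Proof.
move=> Lf Lg; have := Int_mul Lf Lg; case: Lf Lg => mf if2 [mg ig2] ifg.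
split; first exact: measurable_funD.
rewrite (_ : (fun x => _) =
  (fun x => (f x ^+ 2 + g x ^+ 2) + 2 * (f x * g x))); last first.
  by apply/funext => x; ring.
by apply: IntD; [apply: IntD|apply: IntZ].
Qed.

Lemma L2Z k f : L2 f -> L2 (fun x => k * f x).
Proof.
move=> [mf if2]; split; first exact: measurable_funM.
rewrite (_ : (fun x => _) = (fun x => k ^+ 2 * f x ^+ 2)); first exact: IntZ.
by apply/funext => x; rewrite exprMn.
Qed.

Lemma L2N f : L2 f -> L2 (fun x => - f x).
Proof.
move=> Lf; rewrite (_ : (fun x => - f x) = (fun x => -1 * f x)).
  exact: L2Z.
by apply/funext => x; rewrite mulN1r.
Qed.

Lemma L2B f g : L2 f -> L2 g -> L2 (fun x => f x - g x).
Proof. by move=> Lf Lg; apply: L2D => //; exact: L2N. Qed.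

Lemma L2_bounded f M : mfunR f -> (forall x, 0 <= x <= 1 -> `|f x| <= M) -> L2 f.
Proof.
move=> mf fM; split => //; apply: (@Int_bounded _ (M ^+ 2)).
  exact: measurable_funX.
move=> x /fM h; rewrite normrX lerXn2r ?nnegrE//.
exact: le_trans h.
Qed.

Lemma L2_cst k : L2 (cst k).
Proof. by apply: (@L2_bounded _ `|k|). Qed.

Lemma L2_Int f : L2 f -> Int f.
Proof.
move=> Lf; have := Int_mul Lf (L2_cst 1).
by under [X in Int X]funext do rewrite /= mulr1.
Qed.

Lemma ipC f g : ip f g = ip g f.
Proof. by congr I; apply/funext => x; rewrite mulrC. Qed.

Lemma ipDl f g h : L2 f -> L2 g -> L2 h ->
  ip (fun x => f x + g x) h = ip f h + ip g h.
Proof.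
move=> Lf Lg Lh; rewrite /ip -I_D; [|exact: Int_mul..].
by congr I; apply/funext => x; rewrite mulrDl.
Qed.

Lemma ipZl k f h : L2 f -> L2 h -> ip (fun x => k * f x) h = k * ip f h.
Proof.
move=> Lf Lh; rewrite /ip -I_Z; last exact: Int_mul.
by congr I; apply/funext => x; rewrite mulrA.
Qed.

Lemma ipBl f g h : L2 f -> L2 g -> L2 h ->
  ip (fun x => f x - g x) h = ip f h - ip g h.
Proof.
move=> Lf Lg Lh; rewrite /ip -I_B; [|exact: Int_mul..].
by congr I; apply/funext => x; rewrite mulrBl.
Qed.

Lemma ipDr f g h : L2 f -> L2 g -> L2 h ->
  ip h (fun x => f x + g x) = ip h f + ip h g.
Proof. by move=> Lf Lg Lh; rewrite ipC ipDl// !(ipC h). Qed.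

Lemma ipBr f g h : L2 f -> L2 g -> L2 h ->
  ip h (fun x => f x - g x) = ip h f - ip h g.
Proof. by move=> Lf Lg Lh; rewrite ipC ipBl// !(ipC h). Qed.

Lemma ipZr k f h : L2 f -> L2 h -> ip h (fun x => k * f x) = k * ip h f.
Proof. by move=> Lf Lh; rewrite ipC ipZl// ipC. Qed.

Lemma nsq_ge0 f : 0 <= nsq f.
Proof. by apply: I_ge0 => x; exact: sqr_ge0. Qed.

Lemma nsqD f g : L2 f -> L2 g ->
  nsq (fun x => f x + g x) = nsq f + 2 * ip f g + nsq g.
Proof.
move=> Lf Lg; rewrite /nsq ipDl ?ipDr//; do ?exact: L2D.
by rewrite (ipC g f); ring.
Qed.

Lemma nsqB f g : L2 f -> L2 g ->
  nsq (fun x => f x - g x) = nsq f - 2 * ip f g + nsq g.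
Proof.
move=> Lf Lg; rewrite /nsq ipBl ?ipBr//; do ?exact: L2B.
by rewrite (ipC g f); ring.
Qed.

Lemma nsqZ k f : L2 f -> nsq (fun x => k * f x) = k ^+ 2 * nsq f.
Proof.
move=> Lf; rewrite /nsq ipZl ?ipZr//; do ?exact: L2Z.
by ring.
Qed.

Lemma nsqBC f g : nsq (fun x => f x - g x) = nsq (fun x => g x - f x).
Proof.
by congr I; apply/funext => x; rewrite -mulrNN !opprB.
Qed.

Lemma ip_young f g : L2 f -> L2 g -> 2 * ip f g <= nsq f + nsq g.
Proof.
move=> Lf Lg; have := nsq_ge0 (fun x => f x - g x).
by rewrite nsqB//; lra.
Qed.

(** Cauchy-Schwarz, from the positivity of k |-> nsq (f - k g). *)
Lemma ip_sq_le f g : L2 f -> L2 g -> ip f g ^+ 2 <= nsq f * nsq g.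
Proof.
move=> Lf Lg; set a := ip f g.
have h k : 0 <= nsq f - 2 * k * a + k ^+ 2 * nsq g.
  have := nsq_ge0 (fun x => f x - k * g x).
  rewrite nsqB//; last exact: L2Z.
  by rewrite ipZr// nsqZ// -/a; lra.
have g0 := nsq_ge0 g.
have [g00|gN0] := eqVneq (nsq g) 0.
  have : a = 0.
    apply/eqP; apply: contraT => aN0.
    have := h ((nsq f + 1) / (2 * a)); rewrite g00.
    have -> : 2 * ((nsq f + 1) / (2 * a)) * a = nsq f + 1 by field.
    by lra.
  by move=> ->; rewrite g00 expr0n/= mulr0.
have gp : 0 < nsq g by rewrite lt_def gN0.
have := h (a / nsq g).
have -> : nsq f - 2 * (a / nsq g) * a + (a / nsq g) ^+ 2 * nsq g =
  (nsq f * nsq g - a ^+ 2) / nsq g by field.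
by rewrite pmulr_lge0 ?invr_gt0// subr_ge0.
Qed.

Definition nrm f := Num.sqrt (nsq f).

Lemma nrm_ge0 f : 0 <= nrm f. Proof. exact: sqrtr_ge0. Qed.

Lemma nrm_sq f : nrm f ^+ 2 = nsq f. Proof. by rewrite sqr_sqrtr// nsq_ge0. Qed.

Lemma nsq_eq0 f : L2 f -> nsq f = 0 -> eqae f (cst 0).
Proof.
move=> [mf if2] f0.
have mf2 : measurable_fun setT (EFin \o (fun x => f x ^+ 2) : measurableTypeR R -> _).
  by apply/measurable_EFinP; exact: measurable_funX.
have [h _] := ae_eq_integral_abs (muU R) measurableT mf2.
have /h : (\int[muU R]_x `|(EFin \o (fun x => f x ^+ 2)%R) x| = 0)%E.
  rewrite -[LHS]fineK; last exact: integrable_fin_num (integrable_abse if2).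
  congr EFin; rewrite -[RHS]f0; congr fine; apply: eq_integral => x _ /=.
  by rewrite ger0_norm ?sqr_ge0// expr2.
apply: filterS => x /= /(_ Logic.I) [] /eqP.
by rewrite sqrf_eq0 => /eqP.
Qed.

Lemma eq_nsq f g : mfunR f -> mfunR g -> eqae f g -> nsq f = nsq g.
Proof.
move=> mf mg fg; apply: eq_I; try exact: measurable_funM.
by apply: filterS fg => x ->.
Qed.

Lemma eq_ip f f' g g' : mfunR f -> mfunR f' -> mfunR g -> mfunR g' ->
  eqae f f' -> eqae g g' -> ip f g = ip f' g'.
Proof.
move=> mf mg mf' mg' ff' gg'; apply: eq_I; try exact: measurable_funM.
by apply: filterS2 ff' gg' => x -> ->.
Qed.

Lemma eq_L2 f g : mfunR g -> eqae f g -> L2 f -> L2 g.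
Proof.
move=> mg fg [mf if2]; split=> //; apply: eq_Int if2; do ?exact: measurable_funX.
by apply: filterS fg => x ->.
Qed.

End restricted_measure.
Arguments I {R} f.

(** * Completeness and Riesz representation *)

Section completeness.
Variable R : realType.
Implicit Types (f g : R -> R).
Notation mfunR f := (measurable_fun [set: measurableTypeR R] (f : R -> R)).

Lemma integral_I f : Int f -> (\int[muU R]_x (f x)%:E = (I f)%:E)%E.
Proof. by move=> If; rewrite /I /Rintegral fineK//; exact: integrable_fin_num. Qed.

(** The increments are at most sqrt C * 2^-k.  The squared form is the one that
    comes out of an L^2 estimate. *)
Lemma cvg_geometric (u : nat -> R) (C : R) :
  (forall k, 4 ^+ k * (u k.+1 - u k) ^+ 2 <= C) -> cvgn u.
Proof.
move=> uC.
have C0 : 0 <= C by apply: le_trans (uC 0%N); rewrite mul1r sqr_ge0.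
have -> : u = (fun n => u 0%N + series (fun k => u k.+1 - u k) n).
  by apply/funext => n; rewrite seriesEnat/= telescope_sumr// addrC subrK.
apply: is_cvgD; first exact: is_cvg_cst.
apply: normed_cvg.
apply: (@series_le_cvg _ _ (geometric (Num.sqrt C) 2^-1)).
- by move=> n /=.
- by move=> n; apply: mulr_ge0; rewrite ?sqrtr_ge0// exprn_ge0// invr_ge0.
- move=> n; suff : `|u n.+1 - u n| <= Num.sqrt C * 2^-1 ^+ n by [].
  have h0 : 0 <= Num.sqrt C * 2^-1 ^+ n.
    by rewrite mulr_ge0 ?sqrtr_ge0// exprn_ge0// invr_ge0.
  rewrite -(@ler_pXn2r _ 2)//.
  have e : (2^-1 ^+ n) ^+ 2 = (4 ^+ n)^-1 :> R.
    by rewrite -exprM mulnC exprM -exprVn; congr (_ ^+ _); field.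
  rewrite real_normK ?num_real// exprMn sqr_sqrtr// e.
  by rewrite ler_pdivlMr ?exprn_gt0// mulrC uC.
apply: is_cvg_geometric_series; rewrite ger0_norm ?invr_ge0//.
by rewrite invf_lt1// ltr1n.
Qed.

(** The rate 8^-k makes the sum of the functions 4^k * (f_ k.+1 - f_ k)^2
    integrable, hence finite almost everywhere, so that f_ converges pointwise
    almost everywhere ([cvg_geometric]); Fatou's lemma then bounds the distance
    to the limit. *)
Lemma L2_complete (f_ : nat -> R -> R) : (forall k, L2 (f_ k)) ->
  (forall k l, (k <= l)%N -> nsq (fun x => f_ l x - f_ k x) <= 8^-1 ^+ k) ->
  exists2 f, L2 f & forall k, nsq (fun x => f x - f_ k x) <= 8^-1 ^+ k.
Proof.
move=> Lf f8.
pose h k x := 4 ^+ k * (f_ k.+1 x - f_ k x) ^+ 2.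
have Ih k : Int (h k) by apply: IntZ; case: (L2B (Lf k.+1) (Lf k)).
have h0 k x : (0 <= (h k x)%:E)%E.
  by rewrite lee_fin; apply: mulr_ge0; rewrite ?sqr_ge0 ?exprn_ge0 ?ler0n.
have mh k : measurable_fun setT (EFin \o h k : measurableTypeR R -> _).
  by apply/measurable_EFinP; exact: Int_mfun (Ih k).
pose H x := (\sum_(k <oo) (h k x)%:E)%E.
have mH : measurable_fun setT (H : measurableTypeR R -> _).
  by rewrite /H; apply: ge0_emeasurable_sum => [k x _ _|k _]; [exact: h0|exact: mh].
have intH : (\int[muU R]_x H x < +oo)%E.
  rewrite integral_nneseries//.
  have hk k : (\int[muU R]_x (h k x)%:E <= ((2^-1) ^+ k)%:E)%E.
    rewrite integral_I// lee_fin /h I_Z; last by case: (L2B (Lf k.+1) (Lf k)).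
    rewrite -[X in I X]/(fun x => (f_ k.+1 x - f_ k x) ^+ 2).
    have /(ler_wpM2l _) := f8 k k.+1 (leqnSn k).
    move=> /(_ (4 ^+ k)); rewrite exprn_ge0// => /(_ isT) h4.
    have -> : I (fun x => (f_ k.+1 x - f_ k x) ^+ 2) =
        nsq (fun x => f_ k.+1 x - f_ k x).
      by congr I; apply/funext => x; rewrite expr2.
    rewrite (le_trans h4)// -exprMn; apply: lerXn2r; rewrite ?nnegrE; lra.
  apply: (@le_lt_trans _ _ (\sum_(k <oo) ((2 : R) / (2 ^ k.+1)%:R)%:E)%E).
    apply: lee_nneseries => k; first by move=> _ _; apply: integral_ge0 => x _; exact: h0.
    move=> _.
    rewrite (le_trans (hk k))// lee_fin natrX exprS invfM mulrA divff// mul1r.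
    by rewrite exprVn.
  by apply: (le_lt_trans (epsilon_trick0 xpredT _)) => //; rewrite ltry.
have cf : {ae muU R, forall x, cvgn (f_ ^~ x)}.
  have intHH : (muU R).-integrable setT H.
    apply/integrableP; split => //; apply: le_lt_trans intH.
    rewrite le_eqVlt; apply/orP; left; apply/eqP; apply: eq_integral => x _.
    by rewrite gee0_abs// nneseries_ge0.
  have := integrable_ae measurableT intHH.
  apply: filterS => x /(_ Logic.I) Hx.
  apply: (@cvg_geometric _ (fine (H x))) => k.
  rewrite -lee_fin fineK//; apply: le_trans (nneseries_lim_ge k.+1 _) => //.
  rewrite big_mkord big_ord_recr/=; apply: leeDr.
  by apply: sume_ge0 => i _; exact: h0.
(* the lower limit is measurable, and is the limit wherever that exists *)
pose f x := fine (limn_einf (fun k => (f_ k x)%:E)).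
have mf : mfunR f.
  rewrite /f; apply: (@measurableT_comp _ _ _ _ _ _ fine) => //.
  rewrite /limn_einf; apply: measurableT_comp => //.
  apply: (@measurable_fun_limn_esup _ _ _ _ (fun n x => - (f_ n x)%:E)%E) => n.
  by apply: measurableT_comp => //; apply/measurable_EFinP; case: (Lf n).
have ff : {ae muU R, forall x, f_ ^~ x @ \oo --> f x}.
  apply: filterS cf => x /cvg_ex[l fl].
  suff -> : f x = l by [].
  rewrite /f (_ : limn_einf _ = l%:E)//.
  by apply: (cvg_limn_einf_sup _).1; apply: cvg_EFin => //; exact: nearW.
have key k : (\int[muU R]_x ((f x - f_ k x) ^+ 2)%:E <= (8^-1 ^+ k)%:E)%E.
  pose u l x := ((f_ l x - f_ k x) ^+ 2)%:E.
  have Lk l := L2B (Lf l) (Lf k).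
  have -> : (\int[muU R]_x ((f x - f_ k x) ^+ 2)%:E =
    \int[muU R]_x (limn_einf (u ^~ x)))%E.
    apply: ae_eq_integral => //.
    - apply/measurable_EFinP; apply: measurable_funX; apply: measurable_funB => //.
      by case: (Lf k).
    - rewrite /limn_einf; apply: measurableT_comp => //.
      apply: (@measurable_fun_limn_esup _ _ _ _ (fun n x => - (u n x))%E) => n.
      apply: measurableT_comp => //; apply/measurable_EFinP.
      by case: (Lk n) => _ /Int_mfun.
    - apply: filterS ff => x fx _; apply/esym.
      apply: (cvg_limn_einf_sup _).1; apply: cvg_EFin; first by apply: nearW.
      rewrite /u/=; apply: (@cvg_comp _ _ _ _ (fun y => y ^+ 2)); last first.
        exact: exprn_continuous.
      by apply: cvgB => //; exact: cvg_cst.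
  apply: (le_trans (fatou _ _ _ _)) => //.
  - by move=> l; apply/measurable_EFinP; case: (Lk l) => _ /Int_mfun.
  - by move=> l x _; rewrite lee_fin sqr_ge0.
  rewrite limn_einf_lim; apply: lime_le; first exact: is_cvg_einfs.
  apply: nearW => n.
  apply: (@le_trans _ _ (\int[muU R]_x u (maxn n k) x)%E).
    by apply: ereal_inf_lbound; exists (maxn n k) => //=; exact: leq_maxl.
  have -> : (\int[muU R]_x u (maxn n k) x = (nsq (fun x => f_ (maxn n k) x - f_ k x))%:E)%E.
    by rewrite integral_I//; case: (Lk (maxn n k)).
  by rewrite lee_fin f8// leq_maxr.
have Ik k : Int (fun x => (f x - f_ k x) ^+ 2).
  apply/integrableP; split.
    apply/measurable_EFinP; apply: measurable_funX; apply: measurable_funB => //.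
    by case: (Lf k).
  under eq_integral do rewrite gee0_abs ?lee_fin ?sqr_ge0//.
  by apply: (le_lt_trans (key k)); rewrite ltry.
exists f => [|k].
  rewrite (_ : f = (fun x => (f x - f_ 0%N x) + f_ 0%N x)).
    apply: L2D => //; split => //; apply: measurable_funB => //.
    by case: (Lf 0%N).
  by apply/funext => x; rewrite subrK.
by have := key k; rewrite integral_I// lee_fin.
Qed.

Lemma sqr_cvg0 T (F : set_system T) {FF : Filter F} (u : T -> R) :
  (fun t => u t ^+ 2) @ F --> 0 -> u @ F --> 0.
Proof.
move=> /cvgr0Pnorm_lt u2; apply/cvgr0Pnorm_lt => e e0.
have := u2 (e ^+ 2); rewrite exprn_gt0// => /(_ isT).
apply: filterS => t; rewrite normrX ltr_pXn2r// ?nnegrE//.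
exact: ltW.
Qed.

Lemma cvg_le_cst T (F : set_system T) {FF : ProperFilter F} (u : T -> R) l b :
  u @ F --> l -> (forall t, u t <= b) -> l <= b.
Proof. by move=> ul ub; apply: (cvgr_to_le ul); exact: nearW. Qed.

Lemma ip_cvg T (F : set_system T) {FF : Filter F} (f_ : T -> R -> R) f g :
  (forall t, L2 (f_ t)) -> L2 f -> L2 g ->
  (fun t => nsq (fun x => f_ t x - f x)) @ F --> 0 ->
  (fun t => ip (f_ t) g) @ F --> ip f g.
Proof.
move=> Lf_ Lf Lg h.
suff : (fun t => ip (f_ t) g - ip f g) @ F --> 0.
  by move/subr_cvg0.
apply: sqr_cvg0; rewrite -(mul0r (nsq g)).
have h' : (fun t => nsq (fun x => f_ t x - f x) * nsq g) @ F --> 0 * nsq g.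
  by apply: cvgM => //; exact: cvg_cst.
rewrite mul0r in h' *.
apply: (squeeze_cvgr _ (cvg_cst 0) h'); apply: nearW => t.
rewrite sqr_ge0 -ipBl// ip_sq_le//; exact: L2B.
Qed.

Lemma nsq_cvg T (F : set_system T) {FF : Filter F} (f_ : T -> R -> R) f :
  (forall t, L2 (f_ t)) -> L2 f ->
  (fun t => nsq (fun x => f_ t x - f x)) @ F --> 0 ->
  (fun t => nsq (f_ t)) @ F --> nsq f.
Proof.
move=> Lf_ Lf h.
rewrite (_ : (fun t => nsq (f_ t)) = fun t =>
  nsq (fun x => f_ t x - f x) + 2 * ip (f_ t) f - nsq f); last first.
  by apply/funext => t; rewrite nsqB//; ring.
rewrite [X in _ --> X](_ : _ = 0 + 2 * ip f f - nsq f); last first.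
  by rewrite /nsq; ring.
apply: cvgB; last exact: cvg_cst.
by apply: cvgD => //; apply: cvgMl_tmp; exact: ip_cvg.
Qed.

Lemma cvg_pow0 : (fun k : nat => (8^-1 : R) ^+ k) @ \oo --> 0.
Proof. by apply: cvg_expr; rewrite ger0_norm// invf_lt1// ltr1n. Qed.

(** L is represented by the maximiser of 2 L f - nsq f over the closure of D.  It
    is the limit of a maximising sequence, which is Cauchy by the parallelogram
    identity.  D need not be closed: that v is a limit of elements of D also
    yields density statements. *)
Lemma riesz (D : (R -> R) -> Prop) (L : (R -> R) -> R) (M : R) :
  (exists f, D f) -> (forall f, D f -> L2 f) ->
  (forall f g, D f -> D g -> D (fun x => f x + g x)) ->
  (forall k f, D f -> D (fun x => k * f x)) ->
  (forall f g, D f -> D g -> L (fun x => f x + g x) = L f + L g) ->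
  (forall k f, D f -> L (fun x => k * f x) = k * L f) ->
  (forall f, D f -> 2 * L f - nsq f <= M) ->
  exists v, [/\ L2 v, nsq v <= M, (forall f, D f -> L f = ip v f) &
    exists2 f_ : nat -> R -> R, (forall k, D (f_ k)) &
      (fun k => nsq (fun x => f_ k x - v x)) @ \oo --> 0].
Proof.
move=> [f0 Df0] DL2 DD DZ LD LZ LM.
pose Q f := 2 * L f - nsq f.
pose A : set R := [set Q f | f in D].
have A0 : A !=set0 by exists (Q f0); exists f0.
have Aub : has_ubound A by exists M => _ [f Df <-]; exact: LM.
pose S := sup A.
have QS f : D f -> Q f <= S by move=> Df; apply: ub_le_sup => //; exists f.
(* by the parallelogram identity, missing the supremum by at most a and b puts
   two functions at squared distance at most 2 (a + b) *)
have ex k : exists f, D f /\ S - 8^-1 ^+ k / 4 < Q f.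
  have e0 : 0 < (8^-1 ^+ k / 4 : R) by rewrite divr_gt0// exprn_gt0.
  have [_ [f Df <-] fS] := sup_adherent e0 (conj A0 Aub).
  by exists f.
pose f_ k := xget f0 [set f | D f /\ S - 8^-1 ^+ k / 4 < Q f].
have f_P k : D (f_ k) /\ S - 8^-1 ^+ k / 4 < Q (f_ k).
  have [f fP] := ex k.
  by have := @xgetPex _ f0 [set f | D f /\ S - 8^-1 ^+ k / 4 < Q f] (ex k).
have Df k := (f_P k).1; have Lf k := DL2 _ (Df k).
have cauchy k l : (k <= l)%N -> nsq (fun x => f_ l x - f_ k x) <= 8^-1 ^+ k.
  move=> kl; have := QS _ (DZ 2^-1 _ (DD _ _ (Df l) (Df k))).
  rewrite /Q LZ; last exact: DD.
  rewrite LD// nsqZ; last exact: L2D.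
  rewrite nsqD// nsqB//.
  have := (f_P k).2; have := (f_P l).2; rewrite /Q.
  have : (8^-1 : R) ^+ l <= 8^-1 ^+ k.
    by rewrite ler_wiXn2l// ?invr_ge0// invf_le1// ler1n.
  lra.
have [v Lv fv] := L2_complete Lf cauchy.
have cv : (fun k => nsq (fun x => f_ k x - v x)) @ \oo --> 0.
  apply: (squeeze_cvgr _ (cvg_cst 0) cvg_pow0); apply: nearW => k.
  by rewrite nsq_ge0/= nsqBC.
have LE f : D f -> L f = ip v f.
  move=> Dfx; have Lfx := DL2 _ Dfx.
  have ipc := ip_cvg Lf Lv Lfx cv.
  pose d := L f - ip v f.
  (* first-order condition at the supremum, in the direction of f *)
  have h t : 2 * t * d - t ^+ 2 * nsq f <= 0.
    have c1 : (fun k => 2 * t * (L f - ip (f_ k) f) - t ^+ 2 * nsq f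
        - 8^-1 ^+ k * 4^-1) @ \oo --> 2 * t * d - t ^+ 2 * nsq f - 0 * 4^-1.
      apply: cvgB; last by apply: cvgMr_tmp; exact: cvg_pow0.
      apply: cvgB; last exact: cvg_cst.
      by apply: cvgMl_tmp; apply: cvgB; [exact: cvg_cst|exact: ipc].
    rewrite mul0r subr0 in c1.
    apply: (cvg_le_cst c1) => k.
    have := QS _ (DD _ _ (Df k) (DZ t _ Dfx)).
    rewrite /Q LD//; last exact: DZ.
    rewrite LZ// nsqD//; last exact: L2Z.
    rewrite ipZr// nsqZ//.
    have := (f_P k).2; rewrite /Q; lra.
  apply/eqP; rewrite -subr_eq0 -/d; apply: contraT => dN0.
  have n0 := nsq_ge0 f.
  have := h (d / (nsq f + 1)).
  have -> : 2 * (d / (nsq f + 1)) * d - (d / (nsq f + 1)) ^+ 2 * nsq f =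
    d ^+ 2 * (nsq f + 2) / (nsq f + 1) ^+ 2.
    by field; lra.
  rewrite leNgt => /negP; case; apply: divr_gt0; last by rewrite exprn_gt0//; lra.
  apply: mulr_gt0; last lra.
  by rewrite exprn_even_gt0.
exists v; split => //; last by exists f_.
have c1 : (fun k => 2 * ip (f_ k) v - nsq (f_ k)) @ \oo --> 2 * ip v v - nsq v.
  by apply: cvgB; [apply: cvgMl_tmp; exact: ip_cvg|exact: nsq_cvg].
have -> : nsq v = 2 * ip v v - nsq v by rewrite /nsq; ring.
apply: (cvg_le_cst c1) => k.
by rewrite ipC -LE//; exact: LM.
Qed.

End completeness.

(** * Smooth bumps and test functions *)

Section smooth_bumps.
Variable R : realType.
Implicit Types (f g phi : R -> R).

(** The functions x^-k * exp (- 1 / x), extended by 0: their span is closed under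
    differentiation, which makes the smoothness of exp (- 1 / x) a single
    induction. *)
Definition base (k : nat) (x : R) : R :=
  if 0 < x then x^-1 ^+ k * expR (- x^-1) else 0.

Lemma base_ge0 k x : 0 <= base k x.
Proof.
rewrite /base; case: ifPn => // x0.
by rewrite mulr_ge0 ?expR_ge0// exprn_ge0// invr_ge0 ltW.
Qed.

(** Exponential growth beats powers: exp y = (exp (y / k.+1))^k.+1 is at least
    (y / k.+1)^k.+1.  The factor x left over gives the derivative at 0. *)
Lemma base_le k x : 0 <= x -> base k x <= k.+1%:R ^+ k.+1 * x.
Proof.
move=> x0; rewrite /base; case: ifPn => [{}x0|_]; last first.
  by rewrite mulr_ge0// exprn_ge0.
set y := x^-1; have y0 : 0 < y by rewrite invr_gt0.
have -> : x = y^-1 by rewrite invrK.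
rewrite expRN ler_pdivlMr// mulrAC -exprSr ler_pdivrMr ?expR_gt0//.
have -> : expR y = expR (y / k.+1%:R) ^+ k.+1.
  by rewrite -expRM_natl mulrCA divff ?mulr1// pnatr_eq0.
rewrite -exprMn; apply: lerXn2r; [by rewrite nnegrE ltW|by rewrite nnegrE mulr_ge0 ?expR_ge0|].
rewrite [leRHS]mulrC -ler_pdivrMr// (le_trans _ (expR_ge1Dx _))// lerDr//.
Qed.

Lemma base_derive (k : nat) (x : R) :
  is_derive x (1 : R) (base k) (base k.+2 x - k%:R * base k.+1 x).
Proof.
have [x0|x0|->] := ltgtP x 0.
- apply: (@near_eq_is_derive _ _ _ (cst 0)).
    near=> y; rewrite /base ifF//; apply/negbTE; rewrite -leNgt ltW//.
    by near: y; exact: lt_nbhsl.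
  rewrite /base !ifF ?mulr0 ?subr0; do ?by apply/negbTE; rewrite -leNgt ltW.
  exact: is_derive_cst.
- apply: (@near_eq_is_derive R R R (fun y => y^-1 ^+ k * expR (- y^-1))).
    near=> y; rewrite /base ifT//.
    by near: y; exact: lt_nbhsr.
  have x0' : x != 0 by rewrite gt_eqF.
  rewrite /base x0.
  have dV : is_derive x 1 (fun y : R => y^-1) (- x ^- 2).
    by apply: is_derive_eq (is_deriveV x0' (is_derive_id _ _)) _; rewrite [_ *: _]mulr1.
  have dE : is_derive x 1 (fun y : R => expR (- y^-1)) (expR (- x^-1) * x ^- 2).
    rewrite (_ : (fun y : R => expR (- y^-1)) = expR \o (fun y => - y^-1))//.
    rewrite -[X in _ * X]opprK; exact: (is_derive1_comp (is_derive_expR _) (is_deriveN dV)).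
  rewrite (_ : (fun y : R => _) =
      (fun y : R => y^-1) ^+ k * (fun y : R => expR (- y^-1))); last first.
    by apply/funext => y; rewrite fctE exprfctE.
  apply: (is_derive_eq (is_deriveM (is_deriveX k dV) dE)).
  rewrite /GRing.scale/= exprfctE.
  case: k => [|k]; first by rewrite !expr0 !mul0r mulr0; field.
  by rewrite [k.+1.-1]/= !exprS; field.
- have b0 j : base j 0 = 0 by rewrite /base ltxx.
  rewrite !b0 mulr0 subr0.
  suff h : (fun h => h^-1 *: ((base k \o shift 0) (h *: 1) - base k 0)) @ 0^' --> (0 : R).
    by apply: DeriveDef; [apply/cvg_ex; exists 0|exact: cvg_lim].
  rewrite b0.
  pose C : R := k.+2%:R ^+ k.+2.
  have C0 : 0 < C by rewrite exprn_gt0.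
  apply/cvgr0Pnorm_le => e e0; near=> h.
  have he : C * `|h| <= e.
    rewrite mulrC -ler_pdivlMr//; near: h; apply: dnbhs0_le.
    by rewrite divr_gt0.
  apply: le_trans he.
  rewrite subr0 /= addr0 [_ *: 1]mulr1.
  have [h0|h0] := leP h 0; first by rewrite /base ltNge h0/= scaler0 normr0 mulr_ge0 ?exprn_ge0.
  rewrite (_ : _ *: _ = base k.+1 h); last first.
    by rewrite /base h0 /GRing.scale/= exprS mulrA.
  by rewrite ger0_norm ?base_ge0// ger0_norm ?(ltW h0)// base_le// ltW.
Unshelve. all: by end_near. Qed.

(** A class closed under differentiation, whose members are therefore smooth. *)
Inductive tame : (R -> R) -> Prop :=
| tame_base k a b : tame (fun x => base k (a * x + b))
| tame_cst c : tame (cst c)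
| tame_add f g : tame f -> tame g -> tame (fun x => f x + g x)
| tame_mul f g : tame f -> tame g -> tame (fun x => f x * g x).

Lemma tame_derive f : tame f ->
  exists2 g, tame g & forall x : R, is_derive x (1 : R) f (g x).
Proof.
elim=> {f} [k a b|c|f g _ [f' tf' df] _ [g' tg' dg]|f g tf [f' tf' df] tg [g' tg' dg]].
- exists (fun x => a * (base k.+2 (a * x + b) + - k%:R * base k.+1 (a * x + b))).
    apply: (tame_mul (tame_cst a)); apply: tame_add; first exact: tame_base.
    by apply: (tame_mul (tame_cst _)); exact: tame_base.
  move=> x.
  rewrite (_ : (fun x => base k (a * x + b)) = base k \o (fun x => a * x + b))//.
  rewrite mulrC mulNr; apply: is_derive1_comp; first exact: base_derive.
  have := is_deriveD (is_deriveZ a (is_derive_id x 1)) (is_derive_cst b x 1).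
  by move/is_derive_eq; apply; rewrite /GRing.scale/= mulr1 addr0.
- by exists (cst 0) => [|x]; [exact: tame_cst|exact: is_derive_cst].
- exists (fun x => f' x + g' x); first exact: tame_add.
  by move=> x; have := is_deriveD (df x) (dg x).
- exists (fun x => f x * g' x + g x * f' x).
    by apply: tame_add; exact: tame_mul.
  by move=> x; have := is_deriveM (df x) (dg x).
Qed.

Definition smooth f := forall (k : nat) (x : R), derivable (derive1n k f) x 1.

Lemma tame_smooth f : tame f -> smooth f.
Proof.
move=> tf k x.
suff : tame (derive1n k f) by move=> /tame_derive[g _ /(_ x)[]].
elim: k => [//|k /tame_derive[g tg dg]].
rewrite derive1nS (_ : derive1 _ = g)//; apply/funext => y.
by rewrite derive1E; have [] := dg y.
Qed.

Lemma smooth_derivable f (x : R) : smooth f -> derivable f x 1.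
Proof. by move/(_ 0%N x). Qed.

Lemma smooth_continuous f : smooth f -> continuous f.
Proof.
by move=> sf x; apply/differentiable_continuous/derivable1_diffP/smooth_derivable.
Qed.

Lemma smooth_derive f : smooth f -> smooth (derive1 f).
Proof. by move=> sf k x; rewrite -derive1Sn; exact: sf. Qed.

Lemma smoothD f g : smooth f -> smooth g -> smooth (fun x => f x + g x).
Proof.
move=> sf sg k.
suff h : derive1n k (fun x => f x + g x) = derive1n k f + derive1n k g.
  by move=> x; rewrite h; apply: derivableD; [exact: sf|exact: sg].
elim: k => // k IH; rewrite !derive1nS IH; apply/funext => x.
by rewrite derive1E deriveD; [rewrite -!derive1E|exact: sf|exact: sg].
Qed.

Lemma smoothZ a f : smooth f -> smooth (fun x => a * f x).
Proof.
move=> sf k.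
suff h : derive1n k (fun x => a * f x) = a *: derive1n k f.
  by move=> x; rewrite h; apply: derivableZ; exact: sf.
elim: k => // k IH; rewrite !derive1nS IH; apply/funext => x.
by rewrite derive1E deriveZ; [rewrite -derive1E|exact: sf].
Qed.

Lemma derive1_smoothD f g x : smooth f -> smooth g ->
  derive1 (fun x => f x + g x) x = derive1 f x + derive1 g x.
Proof.
move=> sf sg; rewrite !derive1E.
by rewrite -deriveD//; exact: smooth_derivable.
Qed.

Lemma derive1_smoothZ a f x : smooth f ->
  derive1 (fun x => a * f x) x = a * derive1 f x.
Proof.
move=> sf; rewrite !derive1E.
have df : derivable f x 1 by exact: smooth_derivable.
exact: (deriveZ a df).
Qed.

(** A pointwise form of having compact support in ]a, b[. *)
Definition supp_in (a b : R) phi :=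
  smooth phi /\ exists c d, [/\ a < c, d < b &
    forall x, (x < c) || (d < x) -> phi x = 0].

Lemma supp_inD a b f g : supp_in a b f -> supp_in a b g ->
  supp_in a b (fun x => f x + g x).
Proof.
move=> [sf [c [d [ac db f0]]]] [sg [c' [d' [ac' db' g0]]]].
split; first exact: smoothD.
exists (Num.min c c'), (Num.max d d'); rewrite lt_min ac ac' gt_max db db'.
split => // x; rewrite lt_min gt_max => /orP[] /andP[h h'].
  by rewrite f0 ?h// g0 ?h'// addr0.
by rewrite f0 ?h ?orbT// g0 ?h' ?orbT// addr0.
Qed.

Lemma supp_inZ a b k f : supp_in a b f -> supp_in a b (fun x => k * f x).
Proof.
move=> [sf [c [d [ac db f0]]]]; split; first exact: smoothZ.
by exists c, d; split => // x /f0 ->; rewrite mulr0.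
Qed.

Lemma supp_inS a b a' b' f : a' <= a -> b <= b' -> supp_in a b f -> supp_in a' b' f.
Proof.
move=> aa bb [sf [c [d [ac db f0]]]]; split => //; exists c, d; split => //.
- exact: le_lt_trans ac.
- exact: lt_le_trans bb.
Qed.

Lemma supp_in_near0 a b f x : supp_in a b f -> (x <= a) || (b <= x) ->
  \forall y \near x, f y = 0.
Proof.
move=> [sf [c [d [ac db f0]]]] /orP[xa|bx].
  near=> y; apply: f0; apply/orP; left; near: y; apply: lt_nbhsl.
  exact: le_lt_trans ac.
near=> y; apply: f0; apply/orP; right; near: y; apply: lt_nbhsr.
exact: lt_le_trans bx.
Unshelve. all: by end_near. Qed.

Lemma supp_in_eq0 a b f x : supp_in a b f -> (x <= a) || (b <= x) -> f x = 0.
Proof. by move=> /supp_in_near0 h /h /nbhs_singleton. Qed.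

Lemma near0_derive f x : (\forall y \near x, f y = 0) -> derive1 f x = 0.
Proof.
move=> f0; rewrite derive1E (@near_eq_derive _ _ _ f (cst 0))//.
exact: derive_cst.
Qed.

Lemma test_functionP phi : test_function phi <-> supp_in 0 1 phi.
Proof.
split=> [[sphi cs s01]|[sphi [c [d [c0 d1 phi0]]]]].
  split => //.
  have h (x : R) : ~ (0 < x < 1) -> \forall y \near x, phi y = 0.
    move=> x01.
    have : ~ closure [set x | phi x != 0] x.
      by move=> /s01 /=; rewrite in_itv.
    move=> nc; have /open_nbhs_nbhs : open_nbhs x (~` closure [set x | phi x != 0]).
      by split=> //; apply: closed_openC; exact: closed_closure.
    apply: filterS => y /= ny; apply/eqP; apply: contra_notT ny => y0.
    exact: subset_closure.
  have phi0 (x : R) : ~ (0 < x < 1) -> phi x = 0 by move=> /h /nbhs_singleton.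
  have /nbhs_ballP[c /= c0 hc] : \forall y \near (0 : R), phi y = 0.
    by apply: h; rewrite ltxx.
  have /nbhs_ballP[d /= d0 hd] : \forall y \near (1 : R), phi y = 0.
    by apply: h; rewrite ltxx andbF.
  exists (c / 2), (1 - d / 2); split; [lra|lra|move=> x /orP[xc|dx]].
    have [x0|x0] := leP x 0; first by apply: phi0; rewrite ltNge x0.
    by apply: hc; rewrite /ball/= sub0r normrN ger0_norm ?ltW//; lra.
  have [x1|x1] := leP 1 x.
    by apply: phi0 => /andP[_]; rewrite ltNge x1.
  by apply: hd; rewrite /ball/= ger0_norm ?subr_ge0 ?ltW//; lra.
have sub : [set x | phi x != 0] `<=` `[c, d]%classic.
  move=> x /= phix; rewrite in_itv/= !leNgt -negb_or.
  by apply: contra phix => /phi0 ->.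
have csub : closure [set x | phi x != 0] `<=` `[c, d]%classic.
  rewrite closureE => x; apply; split => //.
  exact: itv_closed.
split => //.
  apply: (subclosed_compact _ (@segment_compact _ c d)) => //.
  exact: closed_closure.
move=> x /csub /=; rewrite !in_itv/= => /andP[cx xd].
by rewrite (lt_le_trans c0)// (le_lt_trans xd).
Qed.

(** exp (- 1 / (N x)) is exp (- 1 / x) to the power 1 / N, so that for large N
    these bumps approach the indicator function of ]c, d[. *)
Definition exp_bump (c d : R) (N : nat) (x : R) :=
  base 0 (N.+1%:R * (x - c)) * base 0 (N.+1%:R * (d - x)).

Lemma exp_bump_smooth c d N : smooth (exp_bump c d N).
Proof.
apply: tame_smooth.
rewrite /exp_bump (_ : (fun x => _) = fun x => base 0 (N.+1%:R * x + - (N.+1%:R * c)) *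
   base 0 (- N.+1%:R * x + N.+1%:R * d)).
  by apply: tame_mul; exact: tame_base.
by apply/funext => x; congr (base _ _ * base _ _); ring.
Qed.

Lemma exp_bump_out c d N x : (x <= c) || (d <= x) -> exp_bump c d N x = 0.
Proof.
rewrite /exp_bump /base; case/orP => h.
  by rewrite pmulr_rgt0// subr_gt0 ltNge h mul0r.
by rewrite [X in _ * X]ifF ?mulr0// pmulr_rgt0// subr_gt0 ltNge h.
Qed.

Lemma exp_bump_supp a b c d N : a < c -> d < b -> supp_in a b (exp_bump c d N).
Proof.
move=> ac db; split; first exact: exp_bump_smooth.
by exists c, d; split => // x h; apply: exp_bump_out; case/orP: h => /ltW ->; rewrite ?orbT.
Qed.

Lemma base0_le1 x : 0 <= base 0 x <= 1.
Proof.
rewrite base_ge0/= /base; case: ifPn => // x0.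
by rewrite expr0 mul1r -expR0 ler_expR oppr_le0 invr_ge0 ltW.
Qed.

Lemma exp_bump_ge0_le1 c d N x : 0 <= exp_bump c d N x <= 1.
Proof.
have /andP[h1 h2] := base0_le1 (N.+1%:R * (x - c)).
have /andP[h3 h4] := base0_le1 (N.+1%:R * (d - x)).
by rewrite mulr_ge0//= mulr_ile1.
Qed.

Lemma base0_cvg x : 0 < x -> (fun N : nat => base 0 (N.+1%:R * x)) @ \oo --> (1 : R).
Proof.
move=> x0.
rewrite (_ : (fun N => _) = fun N : nat => expR (- ((N.+1%:R)^-1 * x^-1))); last first.
  by apply/funext => N; rewrite /base mulr_gt0// expr0 mul1r invfM.
rewrite -[X in _ --> X]expR0 -oppr0 -(mul0r x^-1).
apply: continuous_cvg; first exact: continuous_expR.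
by apply: cvgN; apply: cvgMr_tmp; exact: cvg_harmonic.
Qed.

Lemma exp_bump_cvg c d x : c < x < d -> exp_bump c d ^~ x @ \oo --> (1 : R).
Proof.
move=> /andP[cx xd]; rewrite -(mulr1 1).
by apply: cvgM; apply: base0_cvg; rewrite subr_gt0.
Qed.

End smooth_bumps.

(** * Primitives, and density of the test functions *)

Section primitives.
Variable R : realType.
Implicit Types (f g v w phi : R -> R).
Notation mfunR f := (measurable_fun [set: measurableTypeR R] (f : R -> R)).
Notation mu := (@lebesgue_measure R).
#[local] Instance ae_leb_filter : Filter (almost_everywhere mu).
Proof. exact: ae_filter_ringOfSetsType. Qed.

Lemma ae_leb (P : R -> Prop) : {ae mu, forall x, P x} -> {ae muU R, forall x, P x}.
Proof. by move=> h; apply/ae_muU; apply: filterS h => x ? _. Qed.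

Lemma ae_neq (d : R) : {ae muU R, forall x, x <> d}.
Proof.
apply: ae_leb; exists [set d]; split => //; first exact: lebesgue_measure_set1.
by move=> x /= /contrapT.
Qed.

Lemma ae_01 : {ae muU R, forall x, 0 < x < 1}.
Proof.
have h : {ae muU R, forall x : R, 0 <= x <= 1}.
  by apply/ae_muU; apply: aeW => x /=; rewrite in_itv.
apply: filterS3 h (ae_neq 0) (ae_neq 1) => x /andP[x0 x1] /eqP xN0 /eqP xN1.
by rewrite !lt_def xN0 x0 eq_sym xN1.
Qed.

Lemma ae_notin (s : seq R) : {ae muU R, forall x, x \notin s}.
Proof.
elim: s => [|d s IH]; first exact: aeW.
by apply: filterS2 (ae_neq d) IH => x /eqP xd xs; rewrite inE negb_or xd.
Qed.

Lemma dct_I (u_ : nat -> R -> R) u g : (forall n, mfunR (u_ n)) -> mfunR u ->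
  {ae muU R, forall x, u_ ^~ x @ \oo --> u x} -> Int g ->
  {ae muU R, forall x, forall n, `|u_ n x| <= g x} ->
  (fun n => I (u_ n)) @ \oo --> I u.
Proof.
move=> mu_ mfu uu Ig ug.
have [|||||Iu _ h] := @dominated_convergence _ _ _ (muU R) setT measurableT
    (fun n => EFin \o u_ n) (EFin \o u) (EFin \o g).
- by move=> n; exact/measurable_EFinP.
- exact/measurable_EFinP.
- apply: filterS uu => x ux _; apply: cvg_EFin => //; exact: nearW.
- exact: Ig.
- by apply: filterS ug => x ux n _; rewrite /= lee_fin.
rewrite /I /Rintegral; apply: fine_cvg; rewrite fineK //.
exact: integrable_fin_num.
Qed.

Lemma nsq_dct (u_ : nat -> R -> R) u M : (forall n, mfunR (u_ n)) -> mfunR u ->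
  {ae muU R, forall x, u_ ^~ x @ \oo --> u x} ->
  {ae muU R, forall x, forall n, `|u_ n x| <= M} ->
  (fun n => nsq (fun x => u_ n x - u x)) @ \oo --> 0.
Proof.
move=> mu_ mfu uu uM.
have -> : 0 = I (cst 0 : R -> R).
  by rewrite /I /Rintegral integral0.
apply: (@dct_I _ _ (cst ((M + M) ^+ 2))).
- by move=> n; apply: measurable_funM; exact: measurable_funB.
- exact: measurable_cst.
- apply: filterS uu => x ux.
  rewrite -[X in _ --> X]/(0 : R) -(mulr0 0).
  have h : (fun n => u_ n x - u x) @ \oo --> 0 by apply/subr_cvg0.
  exact: cvgM.
- exact/L2_Int/L2_cst.
apply: filterS2 uu uM => x ux xM n; rewrite -expr2 normrX lerXn2r ?nnegrE//.
  by rewrite addr_ge0//; apply: le_trans (xM n).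
rewrite (le_trans (ler_normB _ _))// lerD// ?xM//.
by apply: (cvgr_to_le (cvg_norm ux)); exact: nearW.
Qed.

(** Intervals are open on the left so that J is additive in the interval. *)
Definition J (a b : R) f := I (fun x => f x * \1_(`]a, b]%classic) x).

Lemma mfun_indic (i : interval R) : mfunR (\1_([set` i])).
Proof. exact: measurable_indic. Qed.

Lemma indic_le1 (A : set R) x : `|\1_A x| <= 1 :> R.
Proof. by rewrite indicE; case: (_ \in _); rewrite ?normr1// normr0. Qed.

Lemma L2_indic (i : interval R) : L2 (\1_([set` i]) : R -> R).
Proof. by apply: (@L2_bounded _ _ 1) => [|x _]; [exact: mfun_indic|exact: indic_le1]. Qed.

Lemma Int_indicM (i : interval R) f : Int f -> Int (fun x => f x * \1_([set` i]) x).
Proof.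
move=> If; have mf := Int_mfun If.
apply: (@le_Int _ _ (fun x => `|f x|)).
- by apply: measurable_funM => //; exact: mfun_indic.
- by move=> x; rewrite normrM ler_piMr// indic_le1.
- by have := integrable_norm If.
Qed.

Lemma L2_indicM (i : interval R) f : L2 f -> L2 (fun x => f x * \1_([set` i]) x).
Proof.
move=> [mf If]; split; first by apply: measurable_funM => //; exact: mfun_indic.
rewrite (_ : (fun x => _) = (fun x => f x ^+ 2 * \1_([set` i]) x)).
  exact: Int_indicM.
apply/funext => x; rewrite exprMn; congr (_ * _); rewrite indicE.
by case: (_ \in _); rewrite ?expr1n ?expr0n.
Qed.

Lemma J_cat a b c f : Int f -> a <= b -> b <= c -> J a b f + J b c f = J a c f.
Proof.
move=> If ab bc; rewrite /J -I_D; do ?exact: Int_indicM.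
congr I; apply/funext => x; rewrite -mulrDr; congr (_ * _).
rewrite !indicE !mem_setE !in_itv/=.
have [xb|bx] := leP x b.
  by rewrite andbT addr0 (le_trans xb bc) andbT.
by rewrite andbF add0r (le_lt_trans ab bx).
Qed.

Lemma J_xx a f : J a a f = 0.
Proof.
rewrite /J (_ : (fun x => _) = cst 0) ?/I ?/Rintegral ?integral0//.
by apply/funext => x; rewrite set_itv_ge ?bnd_simp ?ltxx// indic0 mulr0.
Qed.

Lemma J_B a b f g : Int f -> Int g -> J a b (fun x => f x - g x) = J a b f - J a b g.
Proof.
move=> If Ig; rewrite /J -I_B; do ?exact: Int_indicM.
by congr I; apply/funext => x; rewrite mulrBl.
Qed.

Lemma J_leb a b f : 0 <= a -> b <= 1 -> Int f ->
  J a b f = \int[mu]_(x in `]a, b]) f x.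
Proof.
move=> a0 b1 If; have mf := Int_mfun If.
rewrite /J I_muU; last exact: Int_indicM; last first.
  by apply: measurable_funM => //; exact: mfun_indic.
rewrite Rintegral_mkcond [RHS]Rintegral_mkcond; apply: eq_Rintegral => x _.
rewrite !patchE !mem_setE !in_itv/= indicE mem_setE in_itv/=.
case: ifPn => [|xU]; case: ifPn; rewrite ?mulr1 ?mulr0//.
move=> /andP[ax xb]; move: xU.
by rewrite (le_trans a0 (ltW ax)) (le_trans xb b1).
Qed.

Lemma J_cst a b k : 0 <= a -> a <= b -> b <= 1 -> J a b (cst k) = k * (b - a).
Proof.
move=> a0 ab b1; rewrite J_leb//; last exact/L2_Int/L2_cst.
rewrite Rintegral_cst//; congr (_ * _).
have := @lebesgue_measure_itv R `]a, b]; rewrite /= lte_fin => ->.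
by move: ab; rewrite le_eqVlt => /predU1P[->|ab]; [rewrite ltxx subrr|rewrite ab].
Qed.

Lemma J01 f : Int f -> J 0 1 f = I f.
Proof.
move=> If; have mf := Int_mfun If; apply: eq_I => //.
  by apply: measurable_funM => //; exact: mfun_indic.
by apply: filterS ae_01 => x /andP[x0 x1]; rewrite indicE mem_setE in_itv/= x0 ltW// mulr1.
Qed.

Lemma eq_J a b f g : mfunR f -> mfunR g ->
  {ae muU R, forall x, a < x <= b -> f x = g x} -> J a b f = J a b g.
Proof.
move=> mf mg fg; apply: eq_I; try by apply: measurable_funM => //; exact: mfun_indic.
apply: filterS fg => x; rewrite indicE mem_setE in_itv/=.
by case: (_ && _) => [->//|_]; rewrite !mulr0.
Qed.

Lemma J_sq_le a b f : 0 <= a -> a <= b -> b <= 1 -> L2 f ->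
  J a b f ^+ 2 <= (b - a) * J a b (fun x => f x ^+ 2).
Proof.
move=> a0 ab b1 Lf.
pose c x : R := \1_(`]a, b]%classic) x.
have cc x : c x * c x = c x.
  by rewrite /c indicE; case: (_ \in _); rewrite ?mulr1 ?mulr0.
have Lfc := @L2_indicM `]a, b] _ Lf; have Lc := L2_indic `]a, b].
have -> : J a b f = ip (fun x => f x * c x) c.
  by congr I; apply/funext => x; rewrite -mulrA cc.
rewrite (le_trans (ip_sq_le _ _))// mulrC.
have -> : nsq c = b - a.
  rewrite -[RHS]mul1r -(J_cst 1 a0 ab b1); congr I; apply/funext => x.
  by rewrite cc mul1r.
suff -> : nsq (fun x => f x * c x) = J a b (fun x => f x ^+ 2) by [].
by congr I; apply/funext => x; rewrite mulrACA cc expr2.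
Qed.

Lemma J_ge0 a b f : (forall x, 0 <= f x) -> 0 <= J a b f.
Proof.
by move=> f0; apply: I_ge0 => x; rewrite mulr_ge0// indicE; case: (_ \in _).
Qed.

Lemma J_le_nsq a b f : L2 f -> J a b (fun x => f x ^+ 2) <= nsq f.
Proof.
move=> [mf If]; apply: le_I; first exact: Int_indicM.
  by under [X in Int X]funext do rewrite -expr2.
move=> x; rewrite -expr2 ler_piMr ?sqr_ge0//.
Qed.

Definition prim v x := J 0 x v.

Lemma primB v x y : Int v -> 0 <= x -> x <= y -> prim v y - prim v x = J x y v.
Proof. by move=> Iv x0 xy; rewrite /prim -(J_cat Iv x0 xy) addrAC subrr add0r. Qed.

(** Cauchy-Schwarz on the interval between x and y. *)
Lemma prim_holder v x y : L2 v -> 0 <= x <= 1 -> 0 <= y <= 1 ->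
  (prim v y - prim v x) ^+ 2 <= `|y - x| * nsq v.
Proof.
move=> Lv.
wlog xy : x y / x <= y => [h x01 y01|/andP[x0 x1] /andP[y0 y1]].
  have [xy|/ltW yx] := leP x y; first exact: h.
  by rewrite -sqrrN opprB distrC h.
rewrite primB//; last exact: L2_Int.
rewrite (le_trans (J_sq_le _ _ _ _))// ger0_norm ?subr_ge0//.
by rewrite ler_wpM2l ?subr_ge0// J_le_nsq.
Qed.

Lemma prim_out v x : Int v -> 1 <= x -> prim v x = prim v 1.
Proof.
move=> Iv x1; have mv := Int_mfun Iv.
apply: eq_I; try by apply: measurable_funM => //; exact: mfun_indic.
apply: filterS ae_01 => y /andP[y0 y1].
by rewrite !indicE !mem_setE !in_itv/= y0 (ltW y1) (le_trans (ltW y1) x1).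
Qed.

Lemma prim_neg v x : x <= 0 -> prim v x = 0.
Proof.
move=> x0; rewrite /prim /J (_ : (fun x => _) = cst 0) ?/I ?/Rintegral ?integral0//.
by apply/funext => y; rewrite set_itv_ge ?bnd_simp -?leNgt// indic0 mulr0.
Qed.

Lemma prim_derive_ae v : Int v ->
  {ae muU R, forall x, derivable (prim v) x 1 /\ derive1 (prim v) x = v x}.
Proof.
move=> Iv; have mv := Int_mfun Iv.
pose f := v \_ `[0, 1]%classic.
have Iv' : mu.-integrable `[0, 1]%classic (EFin \o v) by apply/integrable_muU.
have intf : mu.-integrable setT (EFin \o f).
  rewrite /f -restrict_EFin.
  by apply/integrable_restrict => //; rewrite setTI.
have intS (D : set (measurableTypeR R)) : measurable D ->
    mu.-integrable D (EFin \o f).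
  by move=> mD; apply: integrableS intf.
have h := @FTC1 R f (BRight 0) (fun y => intS _ (measurable_itv _))
  (integrable_locally (@mUI R) Iv').
have {}h := ae_leb h.
apply: filterS2 ae_01 h => x /andP[x0 x1] /(_ _)[|dF F'].
  exact: x0.
have FE : \forall y \near x,
    \int[mu]_(t in [set` Interval (BRight 0) (BRight y)]) f t = prim v y.
  near=> y; rewrite /prim J_leb//; last first.
    by apply/ltW; near: y; exact: lt_nbhsl.
  apply: eq_Rintegral => z; rewrite mem_setE in_itv/= => /andP[z0 zy].
  rewrite /f patchE mem_setE in_itv/= ltW//= (le_trans zy)// ltW//.
  by near: y; exact: lt_nbhsl.
have fv : f x = v x by rewrite /f patchE mem_setE in_itv/= !ltW.
rewrite -fv -F' !derive1E; split; first exact: near_eq_derivable dF.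
exact/esym/near_eq_derive.
Unshelve. all: by end_near. Qed.

Lemma prim_continuous v : L2 v -> continuous (prim v).
Proof.
move=> Lv.
pose clip (x : R) := Num.max 0 (Num.min x 1).
have clip01 x : 0 <= clip x <= 1.
  by rewrite /clip le_max lexx/= ge_max ler01 ge_min lexx orbT.
have clipE x : prim v (clip x) = prim v x.
  rewrite /clip; have [x1|x1] := leP x 1.
    by have [//|x0] := leP 0 x; rewrite !prim_neg// ltW.
  rewrite max_r ?ler01//; apply/esym/prim_out; [exact: L2_Int|exact: ltW].
have clip_lip x y : `|clip x - clip y| <= `|x - y|.
  rewrite /clip ler_norml.
  have := ler_norm (x - y); have := ler_norm (y - x); rewrite (distrC y x).
  move: `|x - y| => n h1 h2.
  have [x1|x1] := leP x 1; have [y1|y1] := leP y 1; rewrite ?(max_r ler01).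
  - have [x0|x0] := leP 0 x; have [y0|y0] := leP 0 y; apply/andP; split; lra.
  - have [x0|x0] := leP 0 x; apply/andP; split; lra.
  - have [y0|y0] := leP 0 y; apply/andP; split; lra.
  - by apply/andP; split; lra.
move=> x; apply/cvgrPdist_le => e e0.
have N0 : 0 < nsq v + 1 by have := nsq_ge0 v; lra.
near=> y.
rewrite -[prim v x]clipE -[prim v y]clipE.
rewrite -(@ler_pXn2r _ 2)// ?nnegrE ?(ltW e0)// real_normK ?num_real//.
rewrite (le_trans (prim_holder Lv (clip01 y) (clip01 x)))//.
rewrite (@le_trans _ _ (`|x - y| * (nsq v + 1)))//.
  by apply: ler_pM => //; [exact: nsq_ge0|lra].
rewrite -ler_pdivlMr//; near: y; apply: cvgr_dist_le; last first.
  by rewrite divr_gt0// exprn_gt0.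
exact: cvg_id.
Unshelve. all: by end_near. Qed.

Lemma continuous_mfun f : continuous f -> mfunR f.
Proof. exact: continuous_measurable_fun. Qed.

Lemma continuous_bounded01 f : continuous f ->
  exists M, forall x, 0 <= x <= 1 -> `|f x| <= M.
Proof.
move=> cf.
have [|c _ hc] := @EVT_max R (fun x => `|f x|) 0 1 ler01.
  by apply: continuous_subspaceT => x; apply: cvg_norm; exact: cf.
by exists `|f c| => x x01; apply: hc; rewrite in_itv.
Qed.

Lemma L2_continuous f : continuous f -> L2 f.
Proof.
move=> cf; have [M fM] := continuous_bounded01 cf.
by apply: (@L2_bounded _ _ M) => //; exact: continuous_mfun.
Qed.

Lemma prim_L2 v : L2 v -> L2 (prim v).
Proof. by move=> ?; apply: L2_continuous; exact: prim_continuous. Qed.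

Lemma prim_B f g x : Int f -> Int g -> prim (fun y => f y - g y) x = prim f x - prim g x.
Proof. exact: J_B. Qed.

(** By Lebesgue differentiation w is almost everywhere the derivative of its
    primitive. *)
Lemma prim_cst_eq0 w a b : Int w ->
  (forall x y, 0 < x < 1 -> 0 < y < 1 -> a < x -> x <= y -> y < b -> J x y w = 0) ->
  {ae muU R, forall x, a < x < b -> w x = 0}.
Proof.
move=> Iw w0; apply: filterS2 ae_01 (prim_derive_ae Iw) => x /andP[x0 x1] [_ <-] /andP[ax xb].
rewrite derive1E (@near_eq_derive _ _ _ _ (cst (prim w x))) ?derive_cst//.
near=> y.
have y0 : 0 < y by near: y; exact: lt_nbhsr.
have y1 : y < 1 by near: y; exact: lt_nbhsl.
have ay : a < y by near: y; exact: lt_nbhsr.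
have yb : y < b by near: y; exact: lt_nbhsl.
apply/eqP; rewrite -subr_eq0; apply/eqP.
have [xy|/ltW yx] := leP x y.
  by rewrite primB ?w0 ?x0 ?y0// ltW.
by apply/eqP; rewrite -oppr_eq0 opprB primB ?w0 ?x0 ?y0// ltW.
Unshelve. all: by end_near. Qed.

(** Testing against smooth functions determines the integrals over intervals. *)
Lemma exp_bump_I w c d : L2 w -> (fun N => ip w (exp_bump c d N)) @ \oo --> J c d w.
Proof.
move=> Lw; have mw := L2_mfun Lw.
have mb N : mfunR (exp_bump c d N).
  by apply: continuous_mfun; apply: smooth_continuous; exact: exp_bump_smooth.
apply: (@dct_I _ _ (fun x => `|w x|)).
- by move=> n; apply: measurable_funM.
- by apply: measurable_funM => //; exact: mfun_indic.
- apply: filterS (ae_neq d) => x xd.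
  apply: cvgMl_tmp; rewrite indicE mem_setE in_itv/=.
  have [cx|xc] := ltP c x; last first.
    by under eq_fun do rewrite exp_bump_out ?xc//; exact: cvg_cst.
  have [xd'|dx] := leP x d; last first.
    by under eq_fun do rewrite exp_bump_out ?(ltW dx) ?orbT//; exact: cvg_cst.
  apply: exp_bump_cvg; rewrite cx lt_neqAle xd' andbT; exact/eqP.
- have := L2_Int Lw; exact: integrable_norm.
- apply: aeW => x n; rewrite normrM ler_piMr//.
  by have /andP[b0 b1] := exp_bump_ge0_le1 c d n x; rewrite ger0_norm.
Qed.

(** Fundamental lemma of the calculus of variations: by [exp_bump_I] the integrals
    of w over subintervals vanish. *)
Lemma ortho_interval w a b : L2 w ->
  (forall phi, supp_in 0 1 phi -> supp_in a b phi -> ip w phi = 0) ->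
  {ae muU R, forall x, a < x < b -> w x = 0}.
Proof.
move=> Lw h; apply: prim_cst_eq0; first exact: L2_Int.
move=> x y /andP[x0 x1] /andP[y0 y1] ax xy yb.
have := @exp_bump_I w x y Lw.
rewrite (_ : (fun N => _) = cst 0).
  by move=> c; apply: (cvg_unique (@Rhausdorff R) c); exact: cvg_cst.
by apply/funext => N; apply: h; exact: exp_bump_supp.
Qed.

Lemma smooth_L2 f : smooth f -> L2 f.
Proof. by move=> ?; apply: L2_continuous; exact: smooth_continuous. Qed.

Lemma cst0_smooth : smooth (cst 0 : R -> R).
Proof. exact/tame_smooth/tame_cst. Qed.

Lemma cst0_supp a b : a < b -> supp_in a b (cst 0 : R -> R).
Proof.
move=> ab; split; first exact: cst0_smooth.
by exists ((a + b) / 2), ((a + b) / 2); split=> //; rewrite ?midf_lt.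
Qed.

(** The representative v of ip g on the test functions is a limit of them, and
    g - v, orthogonal to all of them, vanishes. *)
Lemma test_dense g : L2 g -> exists2 f_ : nat -> R -> R,
  (forall k, supp_in 0 1 (f_ k)) & (fun k => nsq (fun x => f_ k x - g x)) @ \oo --> 0.
Proof.
move=> Lg.
have [||||||f Sf|v [Lv _ vE [f_ Sf_ f_v]]] :=
    @riesz R (supp_in 0 1) (fun f => ip g f) (nsq g).
- by exists (cst 0); apply: cst0_supp; exact: ltr01.
- by move=> f [/smooth_L2].
- by move=> f h; exact: supp_inD.
- by move=> k f; exact: supp_inZ.
- by move=> f h [/smooth_L2 ? _] [/smooth_L2 ? _]; exact: ipDr.
- by move=> k f [/smooth_L2 ? _]; exact: ipZr.
- have Lf := smooth_L2 Sf.1.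
  by have := ip_young Lg Lf; lra.
exists f_ => //.
suff gv : eqae g v.
  have Lf k := smooth_L2 (Sf_ k).1.
  rewrite (_ : (fun k => _) = (fun k => nsq (fun x => f_ k x - v x)))//.
  apply/funext => k; apply: eq_nsq; do ?by apply: L2_mfun; exact: L2B.
  by apply: filterS gv => x ->.
have h : {ae muU R, forall x, 0 < x < 1 -> g x - v x = 0}.
  apply: ortho_interval; first exact: L2B.
  move=> phi Sp _; have Lp := smooth_L2 Sp.1.
  by rewrite ipBl// vE// subrr.
by apply: filterS2 ae_01 h => x x01 /(_ x01)/eqP; rewrite subr_eq0 => /eqP.
Qed.

End primitives.

(** * Integration by prim_by_parts and the lemma of du Bois-Reymond *)

Section integration_by_parts.
Variable R : realType.
Implicit Types (f g v w phi : R -> R).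
Notation mfunR f := (measurable_fun [set: measurableTypeR R] (f : R -> R)).
Notation mu := (@lebesgue_measure R).

(** Local form of [prim_cst_eq0], for conditions Q such as avoiding finitely many
    points. *)
Lemma prim_locally_cst (w : R -> R) (Q : R -> Prop) : Int w ->
  {ae muU R, forall x, Q x -> \forall y \near x, prim w y = prim w x} ->
  {ae muU R, forall x, Q x -> w x = 0}.
Proof.
move=> Iw; apply: filterS2 (prim_derive_ae Iw) => x [_ <-] h /h wx.
by rewrite derive1E (@near_eq_derive _ _ _ _ (cst (prim w x))) ?derive_cst.
Qed.

Lemma J_FTC h a b : (forall x : R, derivable h x (1 : R)) -> continuous (derive1 h) ->
  0 <= a -> a <= b -> b <= 1 -> J a b (derive1 h) = h b - h a.
Proof.
move=> dh ch a0; rewrite le_eqVlt => /predU1P[->|ab] b1.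
  by rewrite J_xx subrr.
have Ih : Int (derive1 h) by apply: L2_Int; exact: L2_continuous.
rewrite J_leb// Rintegral_itv_obnd_cbnd; last first.
  have mh := Int_mfun Ih.
  apply: (integrableS (@mUI R)).
  - exact: measurable_itv.
  - move=> x /=; rewrite !in_itv/= => /andP[ax xb].
    by rewrite (le_trans a0 (ltW ax)) (le_trans xb b1).
  - exact/integrable_muU.
rewrite /Rintegral (@continuous_FTC2 _ _ h)//.
- by apply: continuous_subspaceT.
- have ch' : continuous h.
    by move=> x; apply/differentiable_continuous/derivable1_diffP.
  split => //.
  + by apply: cvg_at_right_filter; exact: ch'.
  + by apply: cvg_at_left_filter; exact: ch'.
Qed.

Lemma prim_derive f (x : R) : continuous f -> 0 < x < 1 ->
  is_derive x (1 : R) (prim f) (f x).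
Proof.
move=> cf /andP[x0 x1].
have If : Int f by apply: L2_Int; exact: L2_continuous.
have mf := Int_mfun If.
have intf : mu.-integrable [set` Interval (BRight 0) (BRight 1)] (EFin \o f).
  apply: (integrableS (@mUI R)).
  - exact: measurable_itv.
  - by move=> y /=; rewrite !in_itv/= => /andP[y0 ->]; rewrite ltW.
  - exact/integrable_muU.
have [||dF F'] := continuous_FTC1 x1 intf; first exact: x0.
  exact: cf.
have FE : \forall y \near x,
    \int[mu]_(t in [set` Interval (BRight 0) (BRight y)]) f t = prim f y.
  near=> y; rewrite /prim J_leb//.
  by apply/ltW; near: y; exact: lt_nbhsl.
apply: (near_eq_is_derive FE); rewrite -F' derive1E.
exact/derivableP.
Unshelve. all: by end_near. Qed.

Lemma I_cst (k : R) : I (cst k : R -> R) = k.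
Proof. by rewrite -J01 ?J_cst ?subr0 ?mulr1//; exact/L2_Int/L2_cst. Qed.

Lemma prim_sq_le w x : L2 w -> prim w x ^+ 2 <= nsq w.
Proof.
move=> Lw; wlog x01 : x / 0 <= x <= 1.
  move=> h; have [x1|x1] := leP 1 x.
    by rewrite prim_out//; [apply: h; rewrite ler01 lexx|exact: L2_Int].
  have [x0|x0] := leP 0 x; first by apply: h; rewrite x0 ltW.
  by rewrite prim_neg ?expr0n ?nsq_ge0// ltW.
have := @prim_holder _ w 0 x Lw _ x01; rewrite lexx ler01 => /(_ isT).
rewrite (prim_neg w (lexx _)) !subr0 => h; apply: (le_trans h).
by case/andP: x01 => x0 x1; rewrite ger0_norm// ler_piMl// nsq_ge0.
Qed.

Lemma nsq_prim_le w : L2 w -> nsq (prim w) <= nsq w.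
Proof.
move=> Lw; rewrite -[leRHS]I_cst; apply: le_I.
- by have [_] := prim_L2 Lw; under [X in Int X -> _]funext do rewrite expr2.
- exact/L2_Int/L2_cst.
- by move=> x; rewrite -expr2; exact: prim_sq_le.
Qed.

Lemma prim_by_parts_smooth f phi : smooth f -> supp_in 0 1 phi ->
  ip (prim f) (derive1 phi) = - ip f phi.
Proof.
move=> sf Sphi; have sphi := Sphi.1.
have cf := smooth_continuous sf; have cphi := smooth_continuous sphi.
have cphi' := smooth_continuous (smooth_derive sphi).
have Lf := smooth_L2 sf; have Lphi := smooth_L2 sphi.
have Lphi' := smooth_L2 (smooth_derive sphi).
have Lpf := prim_L2 Lf; have cpf := prim_continuous Lf.
have Imul u w : L2 u -> L2 w -> ip u w = \int[mu]_(x in `[0, 1]) (u x * w x).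
  move=> Lu Lw; have Iuw := Int_mul Lu Lw.
  by rewrite /ip I_muU//; exact: Int_mfun Iuw.
rewrite !Imul//.
rewrite (@Rintegration_by_parts _ (prim f) phi f (derive1 phi)) //.
- have -> : phi 1 = 0 by apply: (supp_in_eq0 Sphi); rewrite lexx orbT.
  have -> : phi 0 = 0 by apply: (supp_in_eq0 Sphi); rewrite lexx.
  by rewrite !mulr0 subrr sub0r.
- by apply: continuous_subspaceT.
- split.
  + by move=> x; rewrite in_itv/= => x01; have [] := prim_derive cf x01.
  + by apply: cvg_at_right_filter; exact: cpf.
  + by apply: cvg_at_left_filter; exact: cpf.
- move=> x; rewrite in_itv/= => x01; rewrite derive1E.
  by have [] := prim_derive cf x01.
- by apply: continuous_subspaceT.
- split.
  + by move=> x _; exact: smooth_derivable.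
  + by apply: cvg_at_right_filter; exact: cphi.
  + by apply: cvg_at_left_filter; exact: cphi.
Qed.

(** Both sides are continuous in v for the L^2 norm, so density of the test
    functions reduces the formula to smooth v. *)
Lemma prim_by_parts v phi : L2 v -> supp_in 0 1 phi ->
  ip (prim v) (derive1 phi) = - ip v phi.
Proof.
move=> Lv Sphi; have [f_ Sf fv] := test_dense Lv.
have Lf k := smooth_L2 (Sf k).1.
have Lphi := smooth_L2 Sphi.1; have Lphi' := smooth_L2 (smooth_derive Sphi.1).
have c1 := ip_cvg Lf Lv Lphi fv.
have c2 : (fun k => ip (prim (f_ k)) (derive1 phi)) @ \oo --> ip (prim v) (derive1 phi).
  apply: ip_cvg => //; [by move=> k; exact: prim_L2|exact: prim_L2|].
  apply: (squeeze_cvgr _ (cvg_cst 0) fv); apply: nearW => k.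
  rewrite nsq_ge0/= (_ : (fun x => _) = prim (fun x => f_ k x - v x)).
    by apply: nsq_prim_le; exact: L2B.
  by apply/funext => x; rewrite prim_B//; exact: L2_Int.
apply: (cvg_unique (@Rhausdorff R) c2).
rewrite (_ : (fun k => _) = (fun k => - ip (f_ k) phi)).
  by apply: cvgN; exact: c1.
by apply/funext => k; rewrite prim_by_parts_smooth//; exact: (Sf k).1.
Qed.

Lemma J_eq0 a b f : mfunR f -> (forall x, a < x <= b -> f x = 0) -> J a b f = 0.
Proof.
move=> mf f0; rewrite (@eq_J _ _ _ f (cst 0))//; last exact: aeW.
rewrite /J (_ : (fun x => _) = cst 0) ?I_cst//.
by apply/funext => x; rewrite mul0r.
Qed.

(** A bump of mean zero is the derivative of a bump. *)
Lemma prim_supp (a b : R) (chi : R -> R) : 0 <= a -> b <= 1 -> supp_in a b chi -> I chi = 0 ->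
  supp_in a b (prim chi) /\ derive1 (prim chi) = chi.
Proof.
move=> a0 b1 [sc [c [d [ac db chi0]]]] Ichi.
have cc := smooth_continuous sc.
have Ic := L2_Int (smooth_L2 sc); have mc := Int_mfun Ic.
have p0 x : (x < c) || (d < x) -> prim chi x = 0.
  have [x0|x0] := leP x 0; first by rewrite prim_neg.
  move=> /orP[xc|dx].
    apply: J_eq0 => // y /andP[y0 yx].
    by apply: chi0; rewrite (le_lt_trans yx xc).
  have [x1|x1] := leP 1 x; first by rewrite prim_out// /prim J01.
  apply/eqP; rewrite -oppr_eq0 -[X in X == _]add0r -{1}Ichi -J01// primB ?(ltW x1) ?(ltW x0)//.
  apply/eqP; apply: J_eq0 => // y /andP[xy _].
  by apply: chi0; rewrite (lt_trans dx xy) orbT.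
have dp (x : R) : is_derive x (1 : R) (prim chi) (chi x).
  have [xc|cx] := ltP x c.
    rewrite chi0 ?xc//; apply: (@near_eq_is_derive R R R (cst 0)).
    by near=> y; rewrite p0//; apply/orP; left; near: y; exact: lt_nbhsl.
  have [dx|xd] := ltP d x.
    rewrite chi0 ?dx ?orbT//; apply: (@near_eq_is_derive R R R (cst 0)).
    by near=> y; rewrite p0//; apply/orP; right; near: y; exact: lt_nbhsr.
  apply: prim_derive => //.
  by rewrite (lt_le_trans (le_lt_trans a0 ac) cx) (le_lt_trans xd (lt_le_trans db b1)).
have d1 : derive1 (prim chi) = chi.
  by apply/funext => x; rewrite derive1E; have [] := dp x.
split => //; split; last by exists c, d.
move=> [|k] x; first by have [] := dp x.
by rewrite derive1Sn d1.
Unshelve. all: by end_near. Qed.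

(** With eta a fixed bump, phi - (I phi / I eta) eta is the derivative of a test
    function ([prim_supp]), so that w - k is orthogonal to every phi, k
    being the average of w against eta. *)
Lemma du_bois_reymond w a b : L2 w -> 0 <= a -> a < b -> b <= 1 ->
  (forall phi, supp_in a b phi -> ip w (derive1 phi) = 0) ->
  exists k, {ae muU R, forall x, a < x < b -> w x = k}.
Proof.
move=> Lw a0 ab b1 h.
pose c := (2 * a + b) / 3; pose d := (a + 2 * b) / 3.
have ac : a < c by rewrite /c; lra.
have cd : c < d by rewrite /c /d; lra.
have db : d < b by rewrite /d; lra.
have [N IN] : exists N, 0 < I (exp_bump c d N).
  have := @exp_bump_I R (cst 1) c d (L2_cst 1); rewrite J_cst; try lra.
  rewrite mul1r => /(cvgr_gt (d - c)) /(_ 0).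
  rewrite subr_gt0 => /(_ cd)[N _ /(_ N (leqnn _))]/= hN; exists N.
  rewrite (_ : I _ = ip (cst 1) (exp_bump c d N))//.
  by congr I; apply/funext => x; rewrite mul1r.
pose eta := exp_bump c d N.
have Seta : supp_in a b eta by exact: exp_bump_supp.
pose k := ip w eta / I eta.
exists k.
have Leta := smooth_L2 Seta.1.
have : {ae muU R, forall x, a < x < b -> w x - k = 0}.
  apply: ortho_interval; first by apply: L2B => //; exact: L2_cst.
  move=> phi _ Sphi; have Lphi := smooth_L2 Sphi.1.
  pose m := - (I phi / I eta).
  have Schi : supp_in a b (fun x => phi x + m * eta x).
    by apply: supp_inD => //; exact: supp_inZ.
  have Ichi : I (fun x => phi x + m * eta x) = 0.
    rewrite I_D ?I_Z; try exact: L2_Int; last by apply: L2_Int; exact: L2Z.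
    by rewrite /m mulNr divfK ?subrr// gt_eqF.
  have [Spsi dpsi] := prim_supp a0 b1 Schi Ichi.
  have := h _ Spsi; rewrite dpsi ipDr//; last exact: L2Z.
  rewrite ipZr// ipBl//; last exact: L2_cst.
  have -> : ip (cst k) phi = k * I phi.
    by rewrite /ip I_Z//; exact: L2_Int.
  have IN0 : I eta != 0 by rewrite gt_eqF.
  rewrite /k /m => e; apply/eqP; rewrite subr_eq0; apply/eqP.
  move/eqP: e; rewrite addr_eq0 => /eqP ->; by field.
by move=> h0; apply: filterS h0 => x hx /hx /eqP; rewrite subr_eq0 => /eqP.
Qed.

End integration_by_parts.

(** * Right-continuous step functions *)

Section step_functions.
Variable R : realType.
Implicit Types (t : R -> R) (P s : seq R).

Lemma gap_right (z : R) P : exists2 e, 0 < e & forall p, p \in P -> ~~ (z < p < z + e).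
Proof.
elim: P => [|p P [e e0 h]]; first by exists 1.
have [pz|zp] := leP p z.
  exists e => // q; rewrite inE => /predU1P[->|/h//].
  by rewrite ltNge pz.
exists (Num.min e (p - z)); first by rewrite lt_min e0 subr_gt0.
move=> q; rewrite inE => /predU1P[->|/h].
  rewrite negb_and -!leNgt; apply/orP; right.
  by rewrite -lerBrDl ge_min lexx orbT.
apply: contra => /andP[-> qe] /=; apply: (lt_le_trans qe).
by rewrite lerD2l ge_min lexx.
Qed.

Lemma gap_left (z : R) P : exists2 e, 0 < e & forall p, p \in P -> ~~ (z - e < p < z).
Proof.
have [e e0 h] := gap_right (- z) [seq - p | p <- P].
exists e => // p pP; have := h (- p) (map_f _ pP).
apply: contra => /andP[h1 h2]; rewrite ltrN2 h2/=; lra.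
Qed.

Definition jset t : set R := [set x : R | 0 < x < 1 /\ ~ {for x, continuous t}].

Lemma stepU_right t z : stepU t -> 0 <= z < 1 ->
  exists2 e, 0 < e & forall y, z <= y < z + e -> y <= 1 -> t y = t z.
Proof.
move=> [[s sP] rc _] z01; have [e e0 he] := gap_right z s.
case/andP: (z01) => z0 z1; exists e => // y /andP[zy ye] y1.
have [->//|yz] := eqVneq y z; have {zy}zy : z < y by rewrite lt_def yz.
have := rc _ z01.
have tE : \forall x \near z^'+, t x = t y.
  near=> x.
  have zx : z < x by near: x; exact: nbhs_right_gt.
  have xy : x < y by near: x; exact: nbhs_right_lt.
  apply: sP => //; [lra|exact: ltW|move=> p ps].
  have := he _ ps; apply: contra => /andP[xp py].
  by rewrite (lt_le_trans zx xp) (le_lt_trans py ye).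
move=> c; apply/esym; apply: (cvg_unique (@Rhausdorff R) c); exact: cvg_near_cst tE.
Unshelve. all: by end_near. Qed.

Lemma stepU_left t z : stepU t -> 0 < z <= 1 ->
  exists2 e, 0 < e & forall x y, 0 <= x -> z - e < x -> x < z -> 0 <= y ->
    z - e < y -> y < z -> t x = t y.
Proof.
move=> [[s sP] _ _] /andP[z0 z1]; have [e e0 he] := gap_left z s.
exists e => // x y x0 zx xz y0 zy yz.
wlog xy : x y x0 zx xz y0 zy yz / x <= y.
  move=> h; have [xy|/ltW yx] := leP x y; first exact: h.
  by apply/esym/h.
apply: sP => //; first by rewrite (le_trans (ltW yz)).
move=> p ps; have := he _ ps; apply: contra => /andP[xp py].
by rewrite (lt_le_trans zx xp) (le_lt_trans py yz).
Qed.

Lemma stepU_left_lim t z : stepU t -> 0 < z <= 1 -> t @ z^'- --> t z ->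
  exists2 e, 0 < e & forall x, 0 <= x -> z - e < x <= z -> t x = t z.
Proof.
move=> st z01 lc; have [e e0 he] := stepU_left st z01.
have /andP[z0 z1] := z01.
exists e => // x x0 /andP[ex]; rewrite le_eqVlt => /predU1P[->//|xz].
apply/esym; apply: (cvg_unique (@Rhausdorff R) lc); apply: cvg_near_cst.
near=> y; apply/esym; apply: he => //.
- by near: y; apply: nbhs_left_ge.
- by near: y; apply: nbhs_left_gt; rewrite ltrBlDr ltrDl.
Unshelve. all: by end_near. Qed.

Lemma stepU_locally t z : stepU t -> 0 < z < 1 -> {for z, continuous t} ->
  \forall y \near z, t y = t z.
Proof.
move=> st /andP[z0 z1] ct.
have [|e e0 he] := stepU_right st (z := z); first by rewrite ltW.
have [||d d0 hd] := stepU_left_lim st (z := z); first by rewrite z0 ltW.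
  exact: cvg_at_left_filter.
near=> y; have [zy|yz] := leP z y.
  apply: he; last by apply/ltW; near: y; exact: lt_nbhsl.
  by rewrite zy/=; near: y; apply: lt_nbhsl; rewrite ltrDl.
apply: hd; first by apply/ltW; near: y; exact: lt_nbhsr.
by rewrite ltW// andbT; near: y; apply: lt_nbhsr; rewrite ltrBlDr ltrDl.
Unshelve. all: by end_near. Qed.

Lemma gap_around (z : R) P : z \notin P ->
  exists2 e, 0 < e & forall p, p \in P -> ~~ (z - e < p < z + e).
Proof.
move=> zP; have [e e0 he] := gap_right z P; have [d d0 hd] := gap_left z P.
exists (Num.min e d); first by rewrite lt_min e0.
move=> p pP; have := he _ pP; have := hd _ pP; rewrite !negb_and -!leNgt.
have pz : p != z by apply: contraNneq zP => <-.
have m1 : Num.min e d <= e by rewrite ge_min lexx.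
have m2 : Num.min e d <= d by rewrite ge_min lexx orbT.
case/orP=> h1; case/orP => h2; apply/orP.
- left; lra.
- left; lra.
- by have : p = z by [lra]; move=> /eqP; rewrite (negbTE pz).
- right; lra.
Qed.

Lemma jset_sub t s : (forall x y, 0 <= x -> x <= y -> y <= 1 ->
    (forall z, z \in s -> ~~ (x <= z <= y)) -> t x = t y) ->
  forall z, jset t z -> z \in s.
Proof.
move=> sP z [/andP[z0 z1] nc]; apply: contra_notT nc => zs.
have [e e0 he] := gap_around zs.
have : \forall y \near z, t y = t z.
  near=> y.
  have y0 : 0 < y by near: y; exact: lt_nbhsr.
  have y1 : y < 1 by near: y; exact: lt_nbhsl.
  have ye : z - e < y by near: y; apply: lt_nbhsr; rewrite ltrBlDr ltrDl.
  have ey : y < z + e by near: y; apply: lt_nbhsl; rewrite ltrDl.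
  have [zy|/ltW yz] := leP z y; [apply/esym|]; apply: sP => //; do ?exact: ltW.
    move=> p /he; apply: contra => /andP[? ?]; apply/andP; split; lra.
  move=> p /he; apply: contra => /andP[? ?]; apply/andP; split; lra.
move=> tE; rewrite /prop_for /continuous_at.
exact: cvg_near_cst tE.
Unshelve. all: by end_near. Qed.

Lemma jset_finite t : stepU t -> finite_set (jset t).
Proof.
move=> [[s sP] _ _].
by apply: (@sub_finite_set _ _ [set` s]) => [z /(jset_sub sP)//|]; exact: finite_seq.
Qed.

Lemma njumps_le t P : (forall z, jset t z -> z \in P) -> (njumps t <= size P)%N.
Proof.
move=> h; have fj : finite_set (jset t).
  by apply: (@sub_finite_set _ _ [set` P]) => [z /h//|]; exact: finite_seq.
rewrite /njumps -/(jset t); apply: uniq_leq_size.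
  exact: fset_uniq.
by move=> z; rewrite in_fset_set// inE => /h.
Qed.

Lemma njumps_seq t : stepU t -> exists2 P : seq R, size P = njumps t &
  forall z, z \in P <-> jset t z.
Proof.
move=> st; exists (enum_fset (fset_set (jset t))) => //.
move=> z; rewrite in_fset_set; last exact: jset_finite.
by rewrite inE.
Qed.

(** Without jump t is locally constant on ]x, y[, so its derivative vanishes
    there and the mean value theorem applies. *)
Lemma stepU_const t x y : stepU t -> 0 <= x -> x <= y -> y <= 1 ->
  (forall z, x < z <= y -> ~ jset t z) -> t x = t y.
Proof.
move=> st x0; rewrite le_eqVlt => /predU1P[->//|xy] y1 nj.
have ct z : x < z <= y -> z < 1 -> {for z, continuous t}.
  move=> /andP[xz zy] z1; apply: contrapT => nc; apply: (nj z); first by rewrite xz.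
  by split => //; rewrite z1 (le_lt_trans x0 xz).
have dt z : x < z < y -> is_derive z (1 : R) t (cst 0 z).
  move=> /andP[xz zy]; have z1 := lt_le_trans zy y1.
  have z0 := le_lt_trans x0 xz.
  have := stepU_locally st (z := z); rewrite z0 z1 => /(_ isT (ct z _ z1)).
  rewrite xz ltW// => /(_ isT) tz.
  by apply: (@near_eq_is_derive R R R (cst (t z))); apply: filterS tz => w ->.
have dt' z : z \in `]x, y[ -> is_derive z (1 : R) t (cst 0 z).
  by rewrite in_itv/=; exact: dt.
have [|c _] := @MVT R t (cst 0) x y xy dt'.
  apply: derivable_oo_LRcontinuous_within; split.
  - by move=> z; rewrite in_itv/= => /dt[].
  - by case: st => _ + _; apply; rewrite x0 (lt_le_trans xy).
  - have [y1'|y1'] := eqVneq y 1; first by rewrite y1'; case: st.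
    apply: cvg_at_left_filter; apply: ct; first by rewrite xy lexx.
    by rewrite lt_neqAle y1'.
by rewrite mul0r => /eqP; rewrite subr_eq0 => /eqP.
Qed.

Lemma stepU_ext t t' : (forall x, 0 <= x <= 1 -> t x = t' x) -> stepU t -> stepU t'.
Proof.
move=> tt' [[s sP] rc lc]; split.
- exists s => x y x0 xy y1 h; rewrite -!tt' ?x0 ?y1 ?(le_trans xy)//.
    exact: sP.
  by rewrite (le_trans x0 xy).
- move=> x x01; have := rc _ x01; case/andP: x01 => x0 x1.
  rewrite tt' ?x0 ?ltW//; move=> hc; apply: (cvg_trans _ hc); apply: near_eq_cvg; near=> y.
  apply: tt'; apply/andP; split; apply: ltW; last by near: y; exact: nbhs_right_lt.
  by apply: (le_lt_trans x0); near: y; exact: nbhs_right_gt.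
- rewrite -tt' ?ler01 ?lexx//; apply: (cvg_trans _ lc); apply: near_eq_cvg; near=> y.
  apply: tt'; apply/andP; split; apply: ltW; first by near: y; exact: nbhs_left_gt.
  by near: y; exact: nbhs_left_lt.
Unshelve. all: by end_near. Qed.

Lemma jset_ext t t' : (forall x, 0 <= x <= 1 -> t x = t' x) -> jset t = jset t'.
Proof.
move=> tt'; suff h u u' : (forall x, 0 <= x <= 1 -> u x = u' x) -> jset u `<=` jset u'.
  by apply/seteqP; split; apply: h => // x /tt'.
move=> uu' x [/andP[x0 x1] nc]; split; first by rewrite x0.
apply: contra_not nc; rewrite /prop_for /continuous_at -uu' ?ltW//.
move=> hc; apply: (cvg_trans _ hc); apply: near_eq_cvg; near=> y; apply/esym/uu'.
by apply/andP; split; apply: ltW; near: y; [exact: lt_nbhsr|exact: lt_nbhsl].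
Unshelve. all: by end_near. Qed.

(** t x depends only on the position of x relative to the points of s, and there
    are finitely many positions. *)
Lemma stepU_bounded t : stepU t -> exists M, forall x, 0 <= x <= 1 -> `|t x| <= M.
Proof.
move=> [[s sP] _ _].
(* which points of s lie below x, and which equal x *)
pose code (x : R) := ([tuple of [seq p < x | p <- in_tuple s]],
  [tuple of [seq p == x | p <- in_tuple s]]).
have codeP x y : 0 <= x <= 1 -> 0 <= y <= 1 -> code x = code y -> t x = t y.
  wlog xy : x y / x <= y.
    move=> h x01 y01 cxy; have [xy|/ltW yx] := leP x y; first exact: h.
    by apply/esym/h.
  move=> /andP[x0 x1] /andP[y0 y1] [e1 e2].
  have [->//|xNy] := eqVneq x y.
  have h1 : {in s, (fun p => p < x) =1 (fun p => p < y)}.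
    by apply/eq_in_map; exact: e1.
  have h2 : {in s, (fun p => p == x) =1 (fun p => p == y)}.
    by apply/eq_in_map; exact: e2.
  apply: sP => // p ps; have {}h1 := h1 _ ps; have {}h2 := h2 _ ps.
  apply/negP => /andP[xp py].
  move: h1; rewrite /= ltNge xp/= => /esym/negbT; rewrite -leNgt => yp.
  have py' : p = y by apply/eqP; rewrite eq_le py.
  by move: h2 xNy; rewrite /= py' eqxx eq_sym => ->.
pose f c : R := xget 0 [set y | exists2 x, 0 <= x <= 1 & code x = c /\ y = `|t x|].
exists (\sum_c f c) => x x01.
have fx : f (code x) = `|t x|.
  have := @xgetPex _ 0 [set y | exists2 x', 0 <= x' <= 1 & code x' = code x /\ y = `|t x'|].
  rewrite -/(f (code x)) => -[|x' x'01 [cx ->]]; first by exists `|t x|; exists x.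
  by rewrite (codeP x' x).
rewrite -fx (bigD1 (code x))//= lerDl; apply: sumr_ge0 => c _.
rewrite /f; case: xgetP => [y _ [x' _ [_ ->]]|_] //.
Qed.

End step_functions.

(** * Step functions plus primitives *)

Section decompositions.
Variable R : realType.
Implicit Types (t v : R -> R) (P s : seq R).
Notation mfunR f := (measurable_fun [set: measurableTypeR R] (f : R -> R)).

(** The values of a step function outside [0, 1] are arbitrary and may spoil its
    measurability. *)
Definition clip01 t (x : R) : R := if 0 <= x <= 1 then t x else 0.

Lemma clip01E t x : 0 <= x <= 1 -> clip01 t x = t x.
Proof. by rewrite /clip01 => ->. Qed.

Lemma stepU_clip t : stepU t -> stepU (clip01 t).
Proof. by apply: stepU_ext => x x01; rewrite clip01E. Qed.

Lemma jset_clip t : jset (clip01 t) = jset t.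
Proof. by apply: jset_ext => x x01; rewrite clip01E. Qed.

Lemma njumps_clip t : njumps (clip01 t) = njumps t.
Proof. by rewrite /njumps -!/(jset _) jset_clip. Qed.

Lemma eqae_clip t : eqae t (clip01 t).
Proof.
apply: filterS (ae_01 R) => x /andP[x0 x1].
by rewrite clip01E// !ltW.
Qed.

Lemma clip_mfun t : stepU t -> mfunR (clip01 t).
Proof.
move=> st _ Y mY; rewrite setTI.
set A := clip01 t @^-1` Y.
(* off the jumps and the endpoints t is locally constant, so that there A is open *)
have cs : countable (A `&` (jset t `|` [set 0; 1])).
  apply: finite_set_countable; apply: finite_setIr; rewrite finite_setU; split.
    exact: jset_finite.
  exact: finite_set2.
have -> : A = interior [set x | 0 < x < 1 /\ Y (t x)] `|`
    (A `&` (jset t `|` [set 0; 1])) `|` (A `&` ~` `[0, 1]%classic).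
  apply/seteqP; split=> x.
    move=> Ax; case: (pselect (`[0, 1]%classic x)) => [|x01]; last by right.
    rewrite /= in_itv/= => x01; left.
    case: (pselect ((jset t `|` [set 0; 1]) x)) => nj; [by right|left].
    move/not_orP: nj => [nj /not_orP[/eqP x0 /eqP x1]].
    have x01' : 0 < x < 1 by move: x01; rewrite !lt_def x0 eq_sym x1.
    have ct : {for x, continuous t}.
      by apply: contrapT => nc; apply: nj.
    rewrite /interior /=.
    have tx := stepU_locally st x01' ct; case/andP: x01' => x0' x1'.
    near=> y; split.
      by apply/andP; split; near: y; [exact: lt_nbhsr|exact: lt_nbhsl].
    have -> : t y = t x by near: y.
    by move: Ax; rewrite /A /= clip01E.
  move=> [[|[]//]|[]//] /interior_subset [/andP[x0 x1] Yx].
  by rewrite /A/= clip01E// !ltW.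
apply: measurableU; first apply: measurableU.
- by apply: open_measurable; exact: open_interior.
- by apply: countable_measurable => //; exact: measurable_set1.
- have mc : measurable (~` `[0, 1]%classic : set (measurableTypeR R)).
    by apply: measurableC; exact: mUI.
  case: (pselect (Y 0)) => Y0.
    rewrite (_ : A `&` _ = ~` `[0, 1]%classic)//.
    apply/seteqP; split => x; [by case|move=> x01; split=> //].
    rewrite /A /= /clip01 ifF//; apply/negbTE/negP => x01'; apply: x01.
    by rewrite /= in_itv.
  rewrite (_ : A `&` _ = set0)//; apply/seteqP; split => x //= [+ x01].
  rewrite /A /= /clip01 ifF//; apply/negbTE/negP => x01'; apply: x01.
  by rewrite /= in_itv.
Unshelve. all: by end_near. Qed.

Lemma clip_bounded t : stepU t -> exists M, forall x, `|clip01 t x| <= M.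
Proof.
move=> /stepU_bounded[M tM]; exists M => x; rewrite /clip01; case: ifPn => [/tM//|_].
by rewrite normr0; apply: le_trans (tM 0 _); rewrite ?normr_ge0 ?lexx ?ler01.
Qed.

Lemma clip_L2 t : stepU t -> L2 (clip01 t).
Proof.
move=> st; have [M tM] := clip_bounded st.
by apply: (@L2_bounded _ _ M) => //; exact: clip_mfun.
Qed.

Lemma ae_exists (a b : R) (Q : R -> Prop) : 0 <= a -> a < b -> b <= 1 ->
  {ae muU R, forall x, Q x} -> exists2 x, a < x < b & Q x.
Proof.
move=> a0 ab b1 aQ; apply: contrapT => h.
have : J a b (cst 1 : R -> R) = 0.
  rewrite (@eq_J _ _ _ _ (cst 0)) ?J_cst ?mul0r// ?ltW//.
  apply: filterS2 aQ (ae_neq b) => x Qx xb /andP[ax xb']; exfalso; apply: h.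
  by exists x => //; rewrite ax lt_neqAle xb' andbT; exact/eqP.
rewrite (J_cst 1 a0 (ltW ab) b1) mul1r => /eqP; rewrite subr_eq0 => /eqP ba.
by move: ab; rewrite ba ltxx.
Qed.

(** Normal form of the elements of SBV_2: the constant of integration is put in t,
    and v is the derivative. *)
Definition decomp (x : R -> R) t v :=
  [/\ stepU t, mfunR t, L2 v & eqae x (fun y => t y + prim v y)].

(** t z is the value of w almost everywhere just after z, or just before z = 1:
    this choice makes t right-continuous, and continuous at 1. *)
Lemma piecewise_cst (w : R -> R) P : L2 w ->
  (forall a b, 0 <= a -> a < b -> b <= 1 -> (forall p, p \in P -> ~~ (a < p < b)) ->
    exists k, {ae muU R, forall x, a < x < b -> w x = k}) ->
  exists t, [/\ stepU t, (forall z, jset t z -> z \in P) & eqae w t].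
Proof.
move=> Lw h.
pose good (z k : R) := exists2 e, 0 < e & {ae muU R, forall x,
  (if z < 1 then z < x < z + e else z - e < x < z) -> w x = k}.
pose t z := xget 0 [set k | good z k].
have good_uniq z k k' : 0 <= z <= 1 -> good z k -> good z k' -> k = k'.
  move=> /andP[z0 z1] [e e0 ek] [d d0 dk].
  have m0 : 0 < Num.min e d by rewrite lt_min e0.
  have m1 : Num.min e d <= e by rewrite ge_min lexx.
  have m2 : Num.min e d <= d by rewrite ge_min lexx orbT.
  have [zl|zl] := ltP z 1.
    rewrite zl in ek dk.
    have [|||x /andP[zx]] := ae_exists _ _ _ (filterI ek dk) (a := z) (b := Num.min (z + Num.min e d) 1).
    - exact: z0.
    - by rewrite lt_min zl andbT ltrDl.
    - by rewrite ge_min lexx orbT.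
    rewrite lt_min => /andP[xe _] [<-]; last by rewrite zx/= (lt_le_trans xe)// lerD2l.
    by apply; rewrite zx/= (lt_le_trans xe)// lerD2l.
  rewrite ltNge zl/= in ek dk.
  have [|||x /andP[+ zx]] := ae_exists _ _ _ (filterI ek dk) (a := Num.max (z - Num.min e d) 0) (b := z).
  - by rewrite le_max lexx orbT.
  - by rewrite gt_max (lt_le_trans ltr01 zl) ltrBlDr ltrDl m0.
  - exact: z1.
  rewrite gt_max => /andP[xe _] [<-]; last by rewrite zx andbT (le_lt_trans _ xe)// lerD2l lerN2.
  by apply; rewrite zx andbT (le_lt_trans _ xe)// lerD2l lerN2.
have tE a b k : 0 <= a -> a < b -> b <= 1 ->
    {ae muU R, forall x, a < x < b -> w x = k} ->
    forall z, a <= z -> (z < b) || (b == 1) && (z == 1) -> t z = k.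
  move=> a0 ab b1 wk z az zb.
  have gk : good z k.
    have [zl|zl] := ltP z 1.
      have {}zb : z < b by move: zb => /orP[//|/andP[_ /eqP z1]]; rewrite z1 ltxx in zl.
      exists (b - z); rewrite ?subr_gt0// zl; apply: filterS wk => x wx /andP[zx xz].
      by apply: wx; rewrite (le_lt_trans az zx)/= (lt_le_trans xz)// subrKC.
    have [b1' z1] : b = 1 /\ z = 1.
      case/orP: zb => [zb|/andP[/eqP ? /eqP ?]//].
      by have := lt_le_trans (le_lt_trans zl zb) b1; rewrite ltxx.
    exists (b - a); rewrite ?subr_gt0// z1 ltxx; apply: filterS wk => x wx /andP[zx xz].
    by apply: wx; rewrite b1' xz andbT; move: zx; rewrite b1' opprB addrC subrK.
  have z01 : 0 <= z <= 1.
    rewrite (le_trans a0 az)/=; case/orP: zb => [/ltW/le_trans->//|/andP[_ /eqP ->]//].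
  apply: (good_uniq z) => //.
  by apply: (@xgetPex _ 0 [set k | good z k]); exists k.
have hgap a b : 0 <= a -> a < b -> b <= 1 -> (forall p, p \in P -> ~~ (a < p < b)) ->
    exists2 k, {ae muU R, forall x, a < x < b -> w x = k} &
     forall z, a <= z -> (z < b) || (b == 1) && (z == 1) -> t z = k.
  by move=> a0 ab b1 /h[//|//|//|k hk]; exists k => //; exact: tE hk.
have tP x y : 0 <= x -> x <= y -> y <= 1 ->
    (forall z, z \in P -> ~~ (x <= z <= y)) -> t x = t y.
  move=> x0 xy y1 nP.
  have [->//|xNy] := eqVneq x y.
  have {xNy}xy : x < y by rewrite lt_neqAle xNy.
  have [e e0 he] := gap_right y P.
  pose b := Num.min (y + e) 1.
  have yb : y <= b by rewrite le_min y1 andbT lerDl ltW.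
  have be : b <= y + e by rewrite ge_min lexx.
  have [||||k _ tk] := @hgap x b => //.
  - exact: lt_le_trans yb.
  - by rewrite ge_min lexx orbT.
  - move=> p pP; apply: contra (nP _ pP) => /andP[xp pb]; rewrite (ltW xp)/= leNgt.
    apply/negP => yp; have := he _ pP; rewrite yp/= => /negP; apply.
    exact: lt_le_trans be.
  rewrite !tk// ?(lt_le_trans xy yb) ?(ltW xy)//.
  have [y1'|y1'] := ltP y 1; first by rewrite lt_min ltrDl e0 y1'.
  have -> : y = 1 by apply/eqP; rewrite eq_le y1.
  by rewrite /b eqxx andbT; apply/orP; right; rewrite eq_le ge_min lexx orbT le_min lexx andbT; lra.
have rc x : 0 <= x < 1 -> exists2 e, 0 < e & x + e <= 1 /\ forall y, x <= y < x + e -> t y = t x.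
  move=> /andP[x0 x1]; have [e e0 he] := gap_right x P.
  pose b := Num.min (x + e) 1.
  have xb : x < b by rewrite lt_min x1 andbT ltrDl.
  have [||||k _ tk] := @hgap x b => //.
  - by rewrite ge_min lexx orbT.
  - move=> p /he; apply: contra => /andP[-> pb] /=.
    by rewrite (lt_le_trans pb)// ge_min lexx.
  exists (b - x); rewrite ?subr_gt0// subrKC ge_min lexx orbT; split => // y /andP[xy yb].
  by rewrite !tk// ?yb ?xb.
have lc : exists2 e, 0 < e & forall y, 1 - e < y <= 1 -> t y = t 1.
  have [e e0 he] := gap_left 1 P.
  pose a := Num.max (1 - e) 0.
  have a1 : a < 1 by rewrite gt_max ltr01 andbT ltrBlDr ltrDl.
  have [||||k _ tk] := @hgap a 1 => //.
  - by rewrite le_max lexx orbT.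
  - move=> p /he; apply: contra => /andP[ap ->]; rewrite andbT.
    by apply: le_lt_trans ap; rewrite le_max lexx.
  exists (1 - a); rewrite ?subr_gt0// => y; rewrite subKr => /andP[ay y1].
  have ty z : a <= z -> z <= 1 -> t z = k.
    by move=> az z1; apply: tk => //; rewrite eqxx/= orbC -le_eqVlt.
  by rewrite !ty// ltW.
have st : stepU t.
  split; first by exists P.
  - move=> x x01; have [e e0 [_ he]] := rc _ x01; apply: cvg_near_cst; near=> y.
    apply: he; apply/andP; split; first by apply/ltW; near: y; exact: nbhs_right_gt.
    by near: y; apply: nbhs_right_lt; rewrite ltrDl.
  - have [e e0 he] := lc; apply: cvg_near_cst; near=> y; apply: he.
    apply/andP; split; last by apply/ltW; near: y; exact: nbhs_left_lt.
    by near: y; apply: nbhs_left_gt; rewrite ltrBlDr ltrDl.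
exists t; split => //; first exact: jset_sub tP.
have cL := clip_L2 st.
apply: eqae_trans (eqae_sym (eqae_clip t)).
have Lwt := L2B Lw cL.
suff : {ae muU R, forall x, (0 < x < 1 /\ x \notin P) -> w x - clip01 t x = 0}.
  move=> h1; apply: filterS3 (ae_01 R) (ae_notin P) h1 => x x01 xP.
  by move=> /(_ (conj x01 xP)) /eqP; rewrite subr_eq0 => /eqP.
apply: prim_locally_cst; first exact: L2_Int.
apply: aeW => x [/andP[x0 x1] xP].
have [e e0 he] := gap_around xP.
pose a := Num.max (x - e) 0; pose b := Num.min (x + e) 1.
have ax : a < x by rewrite gt_max x0 andbT ltrBlDr ltrDl.
have xb : x < b by rewrite lt_min x1 andbT ltrDl.
have a0 : 0 <= a by rewrite le_max lexx orbT.
have b1 : b <= 1 by rewrite ge_min lexx orbT.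
have [||||k wk tk] := @hgap a b => //.
- exact: lt_trans xb.
- move=> p /he; apply: contra => /andP[ap pb]; rewrite (le_lt_trans _ ap) ?(lt_le_trans pb)//.
    by rewrite ge_min lexx.
  by rewrite le_max lexx.
have J0 y z : a < y -> y <= z -> z < b -> J y z (fun x => w x - clip01 t x) = 0.
  move=> ay yz zb.
  transitivity (J y z (cst 0 : R -> R)); last first.
    by rewrite J_cst ?mul0r ?(le_trans a0 (ltW ay)) ?(le_trans (ltW zb) b1).
  apply: eq_J; [exact: L2_mfun Lwt|exact: measurable_cst|].
  apply: filterS wk => u wu /andP[yu uz].
  have au := lt_trans ay yu; have ub := le_lt_trans uz zb.
  rewrite wu ?au ?ub// clip01E ?(le_trans a0 (ltW au)) ?(le_trans (ltW ub) b1)//.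
  by rewrite tk ?subrr ?(ltW au) ?ub.
near=> y.
have ay : a < y by near: y; exact: lt_nbhsr.
have yb : y < b by near: y; exact: lt_nbhsl.
have Iwt := L2_Int Lwt.
apply/eqP; rewrite -subr_eq0; have [xy|/ltW yx] := leP x y.
  by rewrite primB ?J0// ltW.
by rewrite -oppr_eq0 opprB primB ?J0 ?(le_trans a0 (ltW ay)).
Unshelve. all: by end_near. Qed.

(** Recognises finite energy from its dual formulation.  [riesz] on the test
    functions that vanish near P gives v; between points of P, f - prim v is
    orthogonal to the derivatives of test functions, hence constant. *)
Lemma decomp_of_duality_bound (x : R -> R) P M : L2 x ->
  (forall phi, supp_in 0 1 phi -> (forall p, p \in P -> \forall y \near p, phi y = 0) ->
    2 * ip x (derive1 phi) - nsq phi <= M) ->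
  exists t v, [/\ decomp x t v, (njumps t <= size P)%N & nsq v <= M].
Proof.
move=> Lx h.
pose D phi := supp_in 0 1 phi /\ (forall p, p \in P -> \forall y \near p, phi y = 0).
have DL phi : D phi -> L2 phi by move=> [[/smooth_L2]].
have DL' phi : D phi -> L2 (derive1 phi).
  by move=> [[sp _] _]; exact/smooth_L2/smooth_derive.
have [||||||phi [Sp np]|u [Lu uM uE _]] := @riesz R D (fun phi => ip x (derive1 phi)) M.
- exists (cst 0); split; first exact/cst0_supp/ltr01.
  by move=> p _; near=> y.
- exact: DL.
- move=> f g [Sf f0] [Sg g0]; split; first exact: supp_inD.
  by move=> p pP; apply: filterS2 (f0 _ pP) (g0 _ pP) => y -> ->; rewrite addr0.
- move=> k f [Sf f0]; split; first exact: supp_inZ.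
  by move=> p pP; apply: filterS (f0 _ pP) => y ->; rewrite mulr0.
- move=> f g Df Dg.
  rewrite (_ : derive1 _ = (fun y => derive1 f y + derive1 g y)).
    by apply: ipDr => //; exact: DL'.
  by apply/funext => y; apply: derive1_smoothD; [exact: Df.1.1|exact: Dg.1.1].
- move=> k f Df.
  rewrite (_ : derive1 _ = (fun y => k * derive1 f y)).
    by apply: ipZr => //; exact: DL'.
  by apply/funext => y; apply: derive1_smoothZ; exact: Df.1.1.
- exact: h.
(* u represents phi |-> ip x phi', hence is minus the weak derivative *)
pose v y := -1 * u y.
have Lv : L2 v by exact: L2Z.
have LW : L2 (fun y => x y - prim v y) by apply: L2B => //; exact: prim_L2.
have [|t [st tP tE]] := @piecewise_cst (fun y => x y - prim v y) P LW.
  move=> a b a0 ab b1 nP; apply: du_bois_reymond => // phi Sphi.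
  have S1 : supp_in 0 1 phi by exact: supp_inS Sphi.
  have Dphi : D phi.
    split => // p pP; apply: (supp_in_near0 Sphi).
    by have := nP _ pP; rewrite negb_and -!leNgt.
  have Lp := DL _ Dphi; have Lp' := DL' _ Dphi.
  rewrite ipBl//; last exact: prim_L2.
  rewrite prim_by_parts// uE// /v ipZl//; ring.
exists (clip01 t), v; split.
- split => //; [exact: stepU_clip|exact: clip_mfun|].
  apply: filterS2 tE (eqae_clip t) => y e1 e2.
  by rewrite -e2 -e1 subrK.
- by rewrite njumps_clip; exact: njumps_le.
- by rewrite nsqZ// sqrrN expr1n mul1r.
Unshelve. all: by end_near. Qed.

(** Both sums are right-continuous, so they agree on [0, 1[ and not just almost
    everywhere; primitives are continuous, so the jumps are those of the step
    parts, and off the jumps the primitives differ by a local constant. *)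
Lemma decomp_uniq (x x' : R -> R) t v t' v' : eqae x x' -> decomp x t v -> decomp x' t' v' ->
  jset t = jset t' /\ eqae v v'.
Proof.
move=> xx' [st mt Lv xE] [st' mt' Lv' xE'].
have e : eqae (fun y => t y + prim v y) (fun y => t' y + prim v' y).
  exact: eqae_trans (eqae_sym xE) (eqae_trans xx' xE').
have E z : 0 <= z < 1 -> t z + prim v z = t' z + prim v' z.
  move=> z01; case/andP: (z01) => z0 z1.
  pose d y := (t y + prim v y) - (t' y + prim v' y).
  have dc : d @ z^'+ --> d z.
    apply: cvgB; apply: cvgD.
    - by case: st => _ + _; exact.
    - by apply: cvg_at_right_filter; exact: prim_continuous.
    - by case: st' => _ + _; exact.
    - by apply: cvg_at_right_filter; exact: prim_continuous.
  apply/eqP; rewrite -subr_eq0 -/(d z); apply: contraT => dN0.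
  have : \forall y \near z^'+, d y != 0.
    by apply: cvgr_neq0 dc dN0.
  move=> [r /= r0 hr].
  have [|||y /andP[zy]] := ae_exists _ _ _ e (a := z) (b := Num.min (z + r) 1).
  - exact: z0.
  - by rewrite lt_min z1 andbT ltrDl.
  - by rewrite ge_min lexx orbT.
  rewrite lt_min => /andP[yr _] dy.
  have : d y != 0.
    by apply: hr => //; rewrite /ball/= distrC ger0_norm ?subr_ge0 ?(ltW zy)// ltrBlDl.
  by rewrite /d dy subrr eqxx.
have key (u u' w w' : R -> R) : L2 w -> L2 w' ->
    (forall z, 0 <= z < 1 -> u z + prim w z = u' z + prim w' z) -> jset u `<=` jset u'.
  move=> Lw Lw' uE z [/andP[z0 z1] nc]; split; first by rewrite z0.
  apply: contra_not nc => cu'; rewrite /prop_for /continuous_at.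
  have c : (fun y => u' y + prim w' y - prim w y) @ z --> u' z + prim w' z - prim w z.
    by apply: cvgB; [apply: cvgD => //; exact: prim_continuous|exact: prim_continuous].
  rewrite -uE ?(ltW z0)// addrK in c.
  apply: cvg_trans c; apply: near_eq_cvg; near=> y; rewrite -uE ?addrK//.
  apply/andP; split; last by near: y; exact: lt_nbhsl.
  by apply/ltW; near: y; exact: lt_nbhsr.
split.
  apply/seteqP; split; first exact: (key t t' v v' Lv Lv' E).
  by apply: (key _ _ v' v Lv' Lv) => z /E.
have [P _ PE] := njumps_seq st; have [P' _ PE'] := njumps_seq st'.
have Ivv := L2_Int (L2B Lv Lv').
suff : {ae muU R, forall x, (0 < x < 1 /\ x \notin P ++ P') -> v x - v' x = 0}.
  move=> h1; apply: filterS3 (ae_01 R) (ae_notin (P ++ P')) h1 => y y01 yP.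
  by move=> /(_ (conj y01 yP)) /eqP; rewrite subr_eq0 => /eqP.
apply: prim_locally_cst => //; apply: aeW => y [y01 yP].
move: yP; rewrite mem_cat negb_or => /andP[yP yP'].
have cj (u : R -> R) (Q : seq R) : stepU u -> (forall z, z \in Q <-> jset u z) -> y \notin Q ->
    \forall z \near y, u z = u y.
  move=> su QE yQ; apply: stepU_locally => //; apply: contrapT => nc.
  by move: yQ => /negP; apply; apply/QE.
have h1 := cj _ _ st PE yP; have h2 := cj _ _ st' PE' yP'.
case/andP: y01 => y0 y1.
near=> z; rewrite !prim_B; do ?exact: L2_Int.
have z01 : 0 <= z < 1.
  by apply/andP; split; [apply/ltW; near: z; exact: lt_nbhsr|near: z; exact: lt_nbhsl].
have := E _ z01; have := E y; rewrite (ltW y0) y1 => /(_ isT).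
have -> : t z = t y by near: z.
have -> : t' z = t' y by near: z.
lra.
Unshelve. all: by end_near. Qed.

End decompositions.

(** * The classes of the problem and the functionals without mesh *)

Section classes.
Variable R : realType.
Implicit Types (f g : L2U R) (t v h : R -> R).
Notation mfunR f := (measurable_fun [set: measurableTypeR R] (f : R -> R)).

Lemma L2U_L2 f : L2 f.
Proof. by apply/L2_Lfun; exact: fL2. Qed.

Notation L0U := {mfun_ muU R, measurableTypeR R >-> measurableTypeR R}.

Lemma L2_class h : L2 h -> exists f : L2U R, eqae f h.
Proof.
move=> Lh; have mh := L2_mfun Lh.
have hm : (h : measurableTypeR R -> measurableTypeR R) \in mfun by rewrite inE.
pose F0 : L0U := (\pi_L0U (mfun_Sub hm))%qT.
have F0h : eqae F0 h.
  have : (repr F0 = mfun_Sub hm %[mod L0U])%qT by rewrite reprK.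
  by move=> /eqmodP /asboolP; apply: filterS => x; apply.
have fin : finite_norm (muU R) 2%:E F0.
  have LF : L2 F0.
    apply: eq_L2 (eqae_sym F0h) Lh.
    exact: (measurable_funPT (repr F0)).
  by have /L2_Lfun/andP[_] := LF; rewrite inE.
by exists (LebesgueSpace.Pack (LebesgueSpace.Class (isFinLebesgue.Build _ _ _ _ _ _ F0 fin))).
Qed.

Lemma normL2E h : L2 h -> normL2 h = nrm h.
Proof.
move=> [mh Ih]; rewrite /normL2 unlock /=.
have -> : (\int[muU R]_x (`|(EFin \o h) x| `^ 2) = (nsq h)%:E)%E.
  rewrite /nsq -[RHS]integral_I; last by under [X in Int X]funext do rewrite -expr2.
  apply: eq_integral => x _; rewrite /= powR_mulrn// real_normK ?num_real//.
by rewrite poweR_EFin /= powR12_sqrt// nsq_ge0.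
Qed.

Lemma normL2_sq h : L2 h -> normL2 h ^+ 2 = nsq h.
Proof. by move=> Lh; rewrite normL2E// nrm_sq. Qed.

Lemma distL2_nrm f g : distL2 f g = nrm (fun x => f x - g x).
Proof. by apply: normL2E; apply: L2B; exact: L2U_L2. Qed.

Lemma ball_L2U f g e : ball f e g <-> nrm (fun x => f x - g x) < e.
Proof. by rewrite -distL2_nrm. Qed.

Lemma cvg_L2U T (F : set_system T) {FF : Filter F} (f_ : T -> L2U R) f :
  f_ @ F --> f -> (fun s => nsq (fun x => f_ s x - f x)) @ F --> 0.
Proof.
move=> cf; apply/cvgr0Pnorm_lt => e e0.
have d0 : 0 < Num.sqrt e by rewrite sqrtr_gt0.
have h : \forall s \near F, ball f (Num.sqrt e) (f_ s) by exact: cf (nbhsx_ballx f _ d0).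
apply: filterS h => s /ball_L2U.
rewrite ltr_sqrt// nsqBC ger0_norm ?nsq_ge0//.
Qed.

Lemma weak_derivative_prim (F v : L2U R) :
  weak_derivative F v <-> exists c, eqae F (fun x => c + prim v x).
Proof.
have Lv := L2U_L2 v; have LF := L2U_L2 F; have Lpv := prim_L2 Lv.
split=> [wF|[c Fc] phi /test_functionP Sphi].
  have LW : L2 (fun x => F x - prim v x) by exact: L2B.
  have [||||c hc] := @du_bois_reymond R (fun x => F x - prim v x) 0 1 LW => //.
    move=> phi Sphi; have Lphi' := smooth_L2 (smooth_derive Sphi.1).
    rewrite ipBl// prim_by_parts// opprK; apply/eqP; rewrite addr_eq0; apply/eqP.
    by apply: wF; apply/test_functionP.
  exists c; apply: filterS2 (ae_01 R) hc => x x01 /(_ x01)/eqP.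
  by rewrite subr_eq => /eqP.
have Lphi' := smooth_L2 (smooth_derive Sphi.1); have Lphi := smooth_L2 Sphi.1.
have Lc : L2 (cst c : R -> R) := L2_cst c.
transitivity (ip (fun x => c + prim v x) (derive1 phi)).
  apply: eq_ip (eqae_refl _) => //; do ?exact: L2_mfun.
  by apply: L2_mfun; exact: L2D.
rewrite (ipDl Lc)// prim_by_parts//.
have -> : ip (cst c) (derive1 phi) = 0.
  rewrite /ip I_Z; last exact: L2_Int.
  rewrite -J01 ?J_FTC ?lexx ?ler01//; last first.
  - exact: L2_Int.
  - exact/smooth_continuous/smooth_derive/Sphi.1.
  - by move=> x; exact: smooth_derivable Sphi.1.
  have -> : phi 1 = 0 by apply: (supp_in_eq0 Sphi); rewrite lexx orbT.
  have -> : phi 0 = 0 by apply: (supp_in_eq0 Sphi); rewrite lexx.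
  by rewrite subrr mulr0.
by rewrite add0r.
Qed.

Lemma eq_prim v v' : mfunR v -> mfunR v' -> eqae v v' -> prim v = prim v'.
Proof.
move=> mv mv' vv'; apply/funext => x; apply: eq_J => //.
by apply: filterS vv' => y ->.
Qed.

Lemma stepU_addc t c : stepU t -> stepU (fun x => t x + c).
Proof.
move=> [[s sP] rc lc]; split.
- by exists s => x y x0 xy y1 h; rewrite (sP x y).
- by move=> x x01; apply: cvgD; [exact: rc|exact: cvg_cst].
- by apply: cvgD => //; exact: cvg_cst.
Qed.

Lemma jset_addc t c : jset (fun x => t x + c) = jset t.
Proof.
suff h (u : R -> R) (d : R) : jset (fun x => u x + d) `<=` jset u.
  apply/seteqP; split; first exact: h.
  have := h (fun x => t x + c) (- c).
  by under [X in jset X `<=` _]eq_fun do rewrite addrK.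
move=> z [z01 nc]; split => //; apply: contra_not nc => cu.
by apply: cvgD => //; exact: cvg_cst.
Qed.

(** A weak derivative determines F up to a constant, which moves into the step
    part without changing its jumps. *)
Lemma sbv2_decomp f (t : R -> R) F (v : L2U R) : stepU t -> weak_derivative F v ->
  (f : R -> R) = (fun x => t x + F x) %[ae muU R] ->
  exists2 t', decomp f t' v & jset t' = jset t.
Proof.
move=> st /weak_derivative_prim[c Fc] /eqaeP ftF.
exists (clip01 (fun x => t x + c)); last by rewrite jset_clip jset_addc.
split; [exact: (stepU_clip (stepU_addc _ st))|exact: (clip_mfun (stepU_addc _ st))|exact: L2U_L2|].
apply: filterS3 ftF Fc (eqae_clip (fun x => t x + c)) => x -> -> <-.
by rewrite addrA.
Qed.

(** The choices hidden in the decomposition and in the derivative are harmless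
    by [decomp_uniq]. *)
Lemma sbv2_jumps_derivative f t v : decomp f t v ->
  [/\ SBV2 f, sbv2_jumps f = njumps t &
     \int[muU R]_x (sbv2_derivative f x) ^+ 2 = nsq v].
Proof.
move=> dftv; have [st mt Lv ftv] := dftv.
have Lpv := prim_L2 Lv.
have [F Fp] := L2_class Lpv; have [V Vv] := L2_class Lv.
have wFV : weak_derivative F V.
  apply/weak_derivative_prim; exists 0.
  rewrite (eq_prim (L2_mfun (L2U_L2 V)) (L2_mfun Lv) Vv).
  by apply: filterS Fp => x ->; rewrite add0r.
have Sf : sbv2_decompositions f !=set0.
  exists (t, F); split => //; first by exists V.
  apply/eqaeP; apply: filterS2 ftv Fp => x /= -> ->.
  by [].
split => //; have := @xgetPex _ (cst 0, f) _ Sf.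
  rewrite -/(sbv2_decomposition f) => -[st' [V' wV'] e].
  have [t' d' jt'] := sbv2_decomp st' wV' e.
  have [jj _] := decomp_uniq (eqae_refl _) d' dftv.
  by rewrite /sbv2_jumps /njumps -!/(jset _) -jt' jj.
rewrite -/(sbv2_decomposition f) => -[st' H e].
have := @xgetPex _ (sbv2_decomposition f).2 _ H.
rewrite -/(sobolev_derivative _) -/(sbv2_derivative f) => wd.
have [t' d' jt'] := sbv2_decomp st' wd e.
have [_ vv] := decomp_uniq (eqae_refl _) d' dftv.
rewrite (_ : \int[muU R]_x _ = nsq (sbv2_derivative f)).
  by apply: eq_nsq => //; apply: L2_mfun => //; exact: L2U_L2.
by apply: eq_Rintegral => x _; rewrite expr2.
Qed.

Lemma SBV2_decomp f : SBV2 f -> exists t v, decomp f t v.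
Proof.
move=> [[t F] [/= st [v wv] e]].
by have [t' d _] := sbv2_decomp st wv e; exists t', v.
Qed.

Lemma stepU_decomp f : in_class (@stepU R) f -> exists t, decomp f t (cst 0).
Proof.
move=> [t [st /eqaeP ft]]; exists (clip01 t).
split; [exact: stepU_clip|exact: clip_mfun|exact: L2_cst|].
apply: filterS2 ft (eqae_clip t) => x -> ->.
rewrite (_ : prim _ x = 0) ?addr0//; apply: J_eq0 => //.
Qed.

Lemma nsq_cst0 : nsq (cst 0 : R -> R) = 0.
Proof.
rewrite /nsq /ip (_ : (fun x => _) = cst 0) ?I_cst//.
by apply/funext => x; rewrite mulr0.
Qed.

Lemma decomp_step f t v : decomp f t v -> nsq v = 0 -> in_class (@stepU R) f.
Proof.
move=> [st mt Lv ftv] v0; exists t; split => //; apply/eqaeP.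
have vz := nsq_eq0 Lv v0.
apply: filterS ftv => x ->; rewrite (eq_prim (L2_mfun Lv) _ vz)//.
by rewrite (_ : prim _ x = 0) ?addr0//; apply: J_eq0.
Qed.

Variable g : L2U R.

Lemma normL2_sub f : normL2 (f \- g) ^+ 2 = nsq (fun x => f x - g x).
Proof. by apply: normL2_sq; apply: L2B; exact: L2U_L2. Qed.

(** As the inverse of 0 is 0, the Mumford-Shah formula also covers Potts, which
    is the case m = 0 with the constraint nsq v = 0. *)
Lemma functional0_eq (gamma m : R) f t v : 0 < gamma -> 0 <= m -> decomp f t v ->
  (m = 0 -> nsq v = 0) ->
  functional g (gamma, m, 0) f =
    (gamma * (njumps t)%:R + (m ^+ 2)^-1 * nsq v + nsq (fun x => f x - g x))%:E.
Proof.
move=> g0 m0 d v0; rewrite /functional g0 ltxx.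
have [Sf jf df] := sbv2_jumps_derivative d.
have [m1|m1] := ltP 0 m.
  rewrite /mumford_shah /extend_pinfty; case: asboolP => // _.
  by rewrite jf df normL2_sub.
have mz : m = 0 by apply/eqP; rewrite eq_le m1.
rewrite /continuous_potts /extend_pinfty; case: asboolP => [_|nS]; last first.
  by exfalso; apply: nS; apply: decomp_step d (v0 mz).
by rewrite jf normL2_sub mz expr0n invr0 mul0r addr0.
Qed.

Lemma functional0_le (gamma m : R) f t v : 0 <= gamma -> 0 <= m -> decomp f t v ->
  (m = 0 -> nsq v = 0) ->
  (functional g (gamma, m, 0%R) f <=
    (gamma * (njumps t)%:R + (m ^+ 2)^-1 * nsq v + nsq (fun x => f x - g x))%R%:E)%E.
Proof.
rewrite le_eqVlt => /predU1P[<-|g0] m0 d v0; last by rewrite (functional0_eq g0 m0 d).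
rewrite /functional ltxx /continuous_L2 lee_fin mul0r add0r.
rewrite (_ : \int[muU R]_x _ = nsq (fun x => f x - g x)).
  by rewrite lerDr mulr_ge0 ?nsq_ge0// invr_ge0 sqr_ge0.
by apply: eq_Rintegral => x _; rewrite expr2.
Qed.

Lemma functional0_g0 (m : R) f :
  functional g (0, m, 0) f = (nsq (fun x => f x - g x))%:E.
Proof.
rewrite /functional ltxx /continuous_L2; congr EFin.
Qed.

Lemma functional0_inv (gamma m : R) f : 0 < gamma -> 0 <= m ->
  (functional g (gamma, m, 0%R) f < +oo)%E ->
  exists t v, decomp f t v /\ (m = 0 -> nsq v = 0).
Proof.
move=> g0 m0; rewrite /functional g0 ltxx.
have [m1|m1] := ltP 0 m.
  rewrite /mumford_shah /extend_pinfty; case: asboolP => // Sf _.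
  have [t [v d]] := SBV2_decomp Sf; exists t, v; split => // mz.
  by rewrite mz ltxx in m1.
rewrite /continuous_potts /extend_pinfty; case: asboolP => // Sf _.
have [t d] := stepU_decomp Sf; exists t, (cst 0); split => // _.
exact: nsq_cst0.
Qed.

End classes.

(** * Functions constant on the cells of a mesh *)

Section cells.
Variable R : realType.
Implicit Types (f g : L2U R) (t v h u : R -> R) (n k : nat) (c d : nat -> R).
Notation mfunR f := (measurable_fun [set: measurableTypeR R] (f : R -> R)).

Definition grid n k : R := k%:R / n%:R.

Lemma grid_le n j k : (0 < n)%N -> (grid n j <= grid n k) = (j <= k)%N.
Proof. by move=> n0; rewrite /grid ler_pM2r ?ler_nat// invr_gt0 ltr0n. Qed.

Lemma grid_lt n j k : (0 < n)%N -> (grid n j < grid n k) = (j < k)%N.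
Proof. by move=> n0; rewrite /grid ltr_pM2r ?ltr_nat// invr_gt0 ltr0n. Qed.

Lemma grid_ge0 n k : 0 <= grid n k.
Proof. by rewrite divr_ge0. Qed.

Lemma gridnn n : (0 < n)%N -> grid n n = 1.
Proof. by move=> n0; rewrite /grid divff// pnatr_eq0 -lt0n. Qed.

Lemma grid_le1 n k : (0 < n)%N -> (k <= n)%N -> grid n k <= 1.
Proof. by move=> n0 kn; rewrite -[leRHS](gridnn n0) grid_le. Qed.

Lemma gridS n k : grid n k.+1 - grid n k = n%:R^-1.
Proof. by rewrite /grid -mulrBl -natrB// subSnn mul1r. Qed.

Lemma cellE n k (x : R) : (0 < n)%N -> (k < n)%N ->
  cell n k x <-> grid n k <= x /\ (x < grid n k.+1 \/ (k.+1 = n /\ x = 1)).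
Proof.
move=> n0 kn; rewrite /cell -!/(grid _ _); case: eqP => [kn1|kn1]; rewrite /= in_itv/=.
  split=> [/andP[kx]|[kx [|[_ ->]]]].
  - rewrite le_eqVlt => /predU1P[->|x1].
      by split; [rewrite grid_le1// ltnW|right].
    by split => //; left; rewrite kn1 gridnn.
  - by rewrite kn1 gridnn// => /ltW ->; rewrite kx.
  - by rewrite lexx andbT grid_le1// ltnW.
split=> [/andP[kx xk]|[-> [->//|[]//]]].
by split => //; left.
Qed.

Lemma cell_grid n k : (0 < n)%N -> (k < n)%N -> @cell R n k (grid n k).
Proof. by move=> n0 kn; apply/cellE => //; split => //; left; rewrite grid_lt. Qed.

Lemma cell_inj n j k (x : R) : (0 < n)%N -> (j < n)%N -> (k < n)%N ->
  cell n j x -> cell n k x -> j = k.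
Proof.
move=> n0; wlog jk : j k / (j <= k)%N => [h jn kn cj ck|jn kn cj ck].
  have [jk|/ltnW kj] := leqP j k; first exact: h.
  by apply/esym/h.
apply/eqP; rewrite eqn_leq jk/=.
move/cellE : cj => []// jx xj; move/cellE : ck => []// kx xk.
case: xj => [xj|[jn1 _]]; last by rewrite -ltnS jn1.
by have := le_lt_trans kx xj; rewrite grid_lt// ltnS.
Qed.

Lemma cell_exists n (x : R) : (0 < n)%N -> 0 <= x <= 1 -> exists2 k, (k < n)%N & cell n k x.
Proof.
move=> n0 /andP[x0]; rewrite le_eqVlt => /predU1P[->|x1].
  exists n.-1; first by rewrite prednK.
  apply/cellE; rewrite ?prednK//; split; last by right.
  by rewrite grid_le1// leq_pred.
have n0' : 0 < n%:R :> R by rewrite ltr0n.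
have /andP[h1 h2] := truncn_itv (mulr_ge0 (ltW n0') x0).
set k := Num.truncn _ in h1 h2; exists k.
  by rewrite -(ltr_nat R) (le_lt_trans h1)// gtr_pMr.
apply/cellE => //.
  by rewrite -(ltr_nat R) (le_lt_trans h1)// gtr_pMr.
rewrite /grid ler_pdivrMr// mulrC h1; split => //; left.
by rewrite ltr_pdivlMr// mulrC.
Qed.

Lemma cell_measurable n k : measurable (cell n k : set (measurableTypeR R)).
Proof. by rewrite /cell; case: ifP => _; exact: measurable_itv. Qed.

Definition stepn n c : R -> R := fun x => \sum_(k < n) c k * \1_(cell n k) x.

Lemma stepn_cell n k c x : (0 < n)%N -> (k < n)%N -> cell n k x -> stepn n c x = c k.
Proof.
move=> n0 kn kx; rewrite /stepn (bigD1 (Ordinal kn))//= indicE mem_set// mulr1.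
rewrite big1 ?addr0// => j jk; rewrite indicE memNset ?mulr0// => jx.
by move/eqP: jk; apply; apply: val_inj; exact: cell_inj jx kx.
Qed.

Lemma stepn_grid n k c : (0 < n)%N -> (k < n)%N -> stepn n c (grid n k) = c k.
Proof. by move=> n0 kn; apply: stepn_cell => //; exact: cell_grid. Qed.

Lemma stepn_mfun n c : mfunR (stepn n c).
Proof.
apply: measurable_sum => k; apply: measurable_funM => //.
by apply: measurable_indic; exact: cell_measurable.
Qed.

Lemma stepn_bounded n c x : (0 < n)%N -> 0 <= x <= 1 ->
  `|stepn n c x| <= \sum_(k < n) `|c k|.
Proof.
move=> n0 x01; have [k kn kx] := cell_exists n0 x01.
rewrite (stepn_cell c n0 kn kx) (bigD1 (Ordinal kn))//= lerDl.
by apply: sumr_ge0.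
Qed.

Lemma stepn_L2 n c : (0 < n)%N -> L2 (stepn n c).
Proof.
move=> n0; apply: L2_bounded; first exact: stepn_mfun.
by move=> x; exact: stepn_bounded.
Qed.

Lemma stepn_stepUn n c : (0 < n)%N -> stepUn n (stepn n c).
Proof.
move=> n0; split; last first.
  by move=> k kn x y kx ky; rewrite !(stepn_cell c n0 kn).
have cc k x : (k < n)%N -> grid n k <= x -> x < grid n k.+1 -> stepn n c x = c k.
  by move=> kn kx xk; apply: stepn_cell => //; apply/cellE => //; split => //; left.
split.
- exists [seq grid n k | k <- iota 0 n.+1] => x y x0 xy y1 h.
  have [k kn kx] := cell_exists n0 (introT andP (conj x0 (le_trans xy y1))).
  have [j jn jy] := cell_exists n0 (introT andP (conj (le_trans x0 xy) y1)).
  rewrite (stepn_cell c n0 kn kx) (stepn_cell c n0 jn jy); congr c.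
  move/cellE : kx => []// kx xk; move/cellE : jy => []// jy yj.
  apply/eqP; rewrite eqn_leq; apply/andP; split; rewrite leqNgt; apply/negP => jk.
    case: yj => [yj|[jn1 _]]; last by move: kn; rewrite -jn1 ltnS leqNgt jk.
    have := le_lt_trans (le_trans kx xy) yj; rewrite grid_lt// ltnS.
    by rewrite leqNgt jk.
  have : grid n j \in [seq grid n k | k <- iota 0 n.+1].
    by apply: map_f; rewrite mem_iota /= add0n ltnS ltnW.
  move=> /h; rewrite jy andbT => /negP; apply.
  case: xk => [xk|[kn1 _]]; last by move: jn; rewrite -kn1 ltnS leqNgt jk.
  by apply: (le_trans (ltW xk)); rewrite grid_le.
- move=> x /andP[x0 x1].
  have [k kn kx] := cell_exists n0 (introT andP (conj x0 (ltW x1))).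
  rewrite (stepn_cell c n0 kn kx); apply: cvg_near_cst.
  move/cellE : kx => []// kx [xk|[_ x1']]; last by rewrite x1' ltxx in x1.
  near=> y; apply: cc => //.
    by apply/ltW/(le_lt_trans kx); near: y; exact: nbhs_right_gt.
- have n1 : (n.-1 < n)%N by rewrite prednK.
  have c1 : cell n n.-1 (1 : R).
    apply/cellE; rewrite ?prednK//; split; last by right.
    by rewrite grid_le1// leq_pred.
  rewrite (stepn_cell c n0 n1 c1); apply: cvg_near_cst.
  near=> y; apply: cc => //; rewrite ?prednK ?gridnn//.
    apply/ltW; near: y; apply: nbhs_left_gt.
    by rewrite -[ltRHS](gridnn n0) grid_lt.
Unshelve. all: by end_near. Qed.

(** Open on the left where [cell] is open on the right; only null sets differ. *)
Definition Jn n k h := J (grid n k) (grid n k.+1) h.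

Lemma ip_stepn n c h : (0 < n)%N -> L2 h -> ip (stepn n c) h = \sum_(k < n) c k * Jn n k h.
Proof.
move=> n0 Lh; have Ih := L2_Int Lh; have mh := L2_mfun Lh.
have Ik k : Int (fun x => h x * \1_(`]grid n k, grid n k.+1]) x).
  exact: Int_indicM.
have e : eqae (fun x => stepn n c x * h x)
    (fun x => \sum_(k < n) c k * (h x * \1_(`]grid n k, grid n k.+1]) x)).
  apply: filterS2 (ae_01 R) (ae_notin [seq grid n k | k <- iota 0 n.+1]) => x x01 xg.
  have ng k : (k <= n)%N -> x != grid n k.
    move=> kn; apply: contraNneq xg => ->; apply: map_f.
    by rewrite mem_iota /= add0n ltnS.
  rewrite /stepn mulr_suml; apply: eq_bigr => k _.
  rewrite -mulrA; congr (_ * _); rewrite mulrC; congr (_ * _).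
  rewrite !indicE; congr (_%:R); congr (nat_of_bool _).
  have kn := ltn_ord k; apply/idP/idP; rewrite !inE; last first.
    rewrite /= in_itv/= => /andP[/ltW kx xk]; apply/cellE => //.
    by split => //; left; rewrite lt_neqAle xk ng.
  move=> /cellE[]// kx xk; rewrite /= in_itv/= lt_def kx ng ?(ltnW kn)//=.
  by case: xk => [/ltW//|[_ x1]]; move: x01; rewrite x1 ltxx andbF.
rewrite /ip (eq_I _ _ e); first last.
- apply: measurable_sum => k; apply: measurable_funM => //.
  by apply: measurable_funM => //; exact: mfun_indic.
- by apply: measurable_funM => //; exact: stepn_mfun.
have h1 (s : seq 'I_n) :
    Int (fun x => \sum_(k <- s) c k * (h x * \1_(`]grid n k, grid n k.+1]) x)) /\
    I (fun x => \sum_(k <- s) c k * (h x * \1_(`]grid n k, grid n k.+1]) x)) =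
    \sum_(k <- s) c k * Jn n k h.
  elim: s => [|k s [IH1 IH2]].
    under eq_fun do rewrite big_nil.
    by rewrite big_nil I_cst; split => //; exact/L2_Int/L2_cst.
  under eq_fun do rewrite big_cons.
  have Ick : Int (fun x => c k * (h x * \1_(`]grid n k, grid n k.+1]) x)) by exact: IntZ.
  by split; [exact: IntD|rewrite I_D// I_Z// IH2 big_cons].
exact: (h1 _).2.
Qed.

Lemma Jn_cst n k (a : R) : (0 < n)%N -> (k < n)%N -> Jn n k (cst a) = a / n%:R.
Proof.
move=> n0 kn; rewrite /Jn J_cst ?grid_ge0 ?grid_le ?grid_le1// gridS//.
Qed.

Lemma Jn_stepn n k c : (0 < n)%N -> (k < n)%N -> Jn n k (stepn n c) = c k / n%:R.
Proof.
move=> n0 kn; rewrite -(Jn_cst (c k) n0 kn); apply: eq_J => //; first exact: stepn_mfun.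
apply: filterS (ae_neq (grid n k.+1)) => x xN /andP[kx xk].
apply: stepn_cell => //; apply/cellE => //; split; first exact: ltW.
by left; rewrite lt_neqAle xk andbT; exact/eqP.
Qed.

Lemma nsq_stepn n c : (0 < n)%N -> nsq (stepn n c) = n%:R^-1 * \sum_(k < n) c k ^+ 2.
Proof.
move=> n0; rewrite /nsq ip_stepn//; last exact: stepn_L2.
rewrite mulr_sumr; apply: eq_bigr => k _; rewrite Jn_stepn//; ring.
Qed.

Lemma stepnB n c d x : stepn n c x - stepn n d x = stepn n (fun k => c k - d k) x.
Proof. by rewrite /stepn -sumrB; apply: eq_bigr => k _; rewrite mulrBl. Qed.

Lemma stepUn_stepn n u x : (0 < n)%N -> stepUn n u -> 0 <= x <= 1 ->
  u x = stepn n (fun k => u (grid n k)) x.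
Proof.
move=> n0 [_ uP] x01; have [k kn kx] := cell_exists n0 x01.
rewrite (stepn_cell _ n0 kn kx); apply: (uP k) => //; exact: cell_grid.
Qed.

Lemma in_class_stepn n f : (0 < n)%N ->
  in_class (stepUn n) f <-> exists c, eqae f (stepn n c).
Proof.
move=> n0; split=> [[u [su /eqaeP fu]]|[c fc]].
  exists (fun k => u (grid n k)); apply: filterS2 (ae_01 R) fu => x /andP[x0 x1] ->.
  by apply: stepUn_stepn => //; rewrite !ltW.
by exists (stepn n c); split; [exact: stepn_stepUn|exact/eqaeP].
Qed.

(** Any representative in [stepUn n] is constant on the cells, so its values at the
    nodes are determined although a node is a null set. *)
Lemma rep_grid n f c k : (0 < n)%N -> eqae f (stepn n c) -> (k < n)%N ->
  rep (stepUn n) f (grid n k) = c k.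
Proof.
move=> n0 fc kn.
have ex : reps (stepUn n) f !=set0.
  by exists (stepn n c); split; [exact: stepn_stepUn|exact/eqaeP].
have := @xgetPex _ (f : R -> R) _ ex.
rewrite -/(rep (stepUn n) f) => -[[_ uP] /eqaeP fu].
have e := eqae_trans (eqae_sym fu) fc.
have [|||x /andP[kx xk] ux] := ae_exists _ _ _ e (a := grid n k) (b := grid n k.+1).
- exact: grid_ge0.
- by rewrite grid_lt.
- by rewrite grid_le1.
have cx : cell n k x by apply/cellE => //; split; [exact: ltW|left].
rewrite -(stepn_cell c n0 kn cx) -ux; apply: (uP k) => //.
exact: cell_grid.
Qed.

End cells.

(** * The discrete functionals *)

Section discretization.
Variable R : realType.
Implicit Types (f g : L2U R) (t v h u : R -> R) (n k : nat) (c : nat -> R).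
Notation mfunR f := (measurable_fun [set: measurableTypeR R] (f : R -> R)).
Notation grid := (@grid R).

Section fidelity.
Variable g : L2U R.

Definition mean n k : R := n%:R * Jn n k g.

(** The squared distance from g to the functions constant on the cells, see
    [defect_le]. *)
Definition defect n : R := nsq (fun x => stepn n (mean n) x - g x).

Lemma cond_mean_stepn n : (0 < n)%N -> cond_mean g n = stepn n (mean n).
Proof.
move=> n0; apply/funext => x; rewrite /cond_mean /stepn; apply: eq_bigr => k _.
congr (_ * _ * _); rewrite Rintegral_mkcond /Jn /J /I.
have Lg := L2U_L2 g; have mg := L2_mfun Lg.
rewrite -!/(grid _ _).
transitivity (I (fun y => g y * \1_(`[grid n k, grid n k.+1]%classic) y)).
  congr fine; apply: eq_integral => y _; rewrite patchE indicE.
  by case: ifPn; rewrite ?mulr1 ?mulr0.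
apply: eq_I.
- by apply: measurable_funM => //; exact: mfun_indic.
- by apply: measurable_funM => //; exact: mfun_indic.
apply: filterS (ae_neq (grid n k)) => y /eqP yk; congr (_ * _).
by rewrite !indicE !mem_setE !in_itv/= lt_def yk.
Qed.

(** On each cell stepn n (mean n) has the same integral as g, so their difference
    is orthogonal to the functions constant on the cells. *)
Lemma pythagoras n c : (0 < n)%N ->
  nsq (fun x => stepn n c x - g x) =
  n%:R^-1 * \sum_(k < n) (c k - mean n k) ^+ 2 + defect n.
Proof.
move=> n0; have Lg := L2U_L2 g.
have Lc := stepn_L2 c n0; have Lm := stepn_L2 (mean n) n0.
have n0' : n%:R != 0 :> R by rewrite pnatr_eq0 -lt0n.
rewrite -(nsq_stepn (fun k => c k - mean n k) n0).
rewrite (_ : (fun x => stepn n c x - g x) = (fun x =>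
  stepn n (fun k => c k - mean n k) x + (stepn n (mean n) x - g x))); last first.
  by apply/funext => x; rewrite -stepnB; ring.
rewrite nsqD; [|exact: stepn_L2|exact: L2B].
rewrite (_ : ip _ _ = 0) ?mulr0 ?addr0//.
rewrite ip_stepn//; last exact: L2B.
apply: big1 => k _.
rewrite /Jn J_B; [|exact: L2_Int..].
by rewrite -!/(Jn _ _ _) Jn_stepn// /mean mulrAC divff// mul1r subrr mulr0.
Qed.

Lemma defect_ge0 n : 0 <= defect n. Proof. exact: nsq_ge0. Qed.

Lemma defect_le n c : (0 < n)%N -> defect n <= nsq (fun x => stepn n c x - g x).
Proof.
move=> n0; rewrite (pythagoras c n0) lerDr mulr_ge0 ?invr_ge0//.
by apply: sumr_ge0 => k _; exact: sqr_ge0.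
Qed.

Lemma discrete_fidelityE n u : (0 < n)%N ->
  discrete_fidelity g n u =
  nsq (fun x => stepn n (fun k => u (grid n k)) x - g x) - defect n.
Proof.
move=> n0; rewrite pythagoras// addrK /discrete_fidelity; congr (_ * _).
apply: eq_bigr => k _; rewrite cond_mean_stepn// -!/(grid _ _).
by rewrite stepn_grid.
Qed.

End fidelity.

Definition sample n u : R -> R := stepn n (fun k => u (grid n k)).

(** Where u is continuous, its value at the node below x tends to u x; then
    dominated convergence applies. *)
Lemma sample_cvg u M : mfunR u -> (forall x, 0 <= x <= 1 -> `|u x| <= M) ->
  {ae muU R, forall x, {for x, continuous u}} ->
  (fun n => nsq (fun x => sample n u x - u x)) @ \oo --> 0.
Proof.
move=> mfu uM cu; rewrite -(cvg_shiftS (fun n => nsq (fun x => sample n u x - u x))).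
apply: (@nsq_dct _ (fun n => sample n.+1 u) u M) => //.
- by move=> n; exact: stepn_mfun.
- apply: filterS2 (ae_01 R) cu => x /andP[x0 x1] ux.
  have gx n : exists2 y, sample n.+1 u x = u y & `|x - y| <= n.+1%:R^-1.
    have x01 : 0 <= x <= 1 by rewrite !ltW.
    have [k kn kx] := cell_exists (ltn0Sn n) x01.
    exists (grid n.+1 k); first exact: stepn_cell kx.
    move/cellE : kx => []// kx xk.
    rewrite ger0_norm ?subr_ge0// -(gridS R _ k) lerD2r.
    case: xk => [/ltW//|[_ x1']]; by rewrite x1' ltxx in x1.
  apply/cvgrPdist_le => e e0.
  move/cvgrPdist_le : (ux) => /(_ _ e0)/nbhs_ballP[d /= d0 hd].
  have hn : \forall n \near \oo, n.+1%:R^-1 < d.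
    have := @cvg_harmonic R; move/cvgrPdist_lt => /(_ _ d0); apply: filterS => n /=.
    by rewrite sub0r normrN ger0_norm// invr_ge0.
  apply: filterS hn => n nd; have [y -> xy] := gx n.
  by apply: hd; rewrite /ball/= (le_lt_trans xy).
- apply: filterS (ae_01 R) => x /andP[x0 x1] n.
  have x01 : 0 <= x <= 1 by rewrite !ltW.
  have [k kn kx] := cell_exists (ltn0Sn n) x01.
  rewrite /sample (stepn_cell _ _ kn kx)//; apply: uM.
  by rewrite grid_ge0 grid_le1// ltnW.
Qed.

Lemma sample_cvg_continuous u : continuous u ->
  (fun n => nsq (fun x => sample n u x - u x)) @ \oo --> 0.
Proof.
move=> cu; have [M uM] := continuous_bounded01 cu.
apply: (sample_cvg (M := M)) => //; first exact: continuous_mfun.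
by apply: aeW => x; exact: cu.
Qed.

Lemma sample_cvg_sbv t v : stepU t -> mfunR t -> L2 v ->
  (fun n => nsq (fun x => sample n (fun x => t x + prim v x) x - (t x + prim v x)))
    @ \oo --> 0.
Proof.
move=> st mt Lv; have cp := prim_continuous Lv.
have [M tM] := stepU_bounded st; have [N pN] := continuous_bounded01 cp.
have [P _ PE] := njumps_seq st.
apply: (@sample_cvg _ (M + N)).
- by apply: measurable_funD => //; exact: continuous_mfun.
- by move=> x x01; rewrite (le_trans (ler_normD _ _))// lerD ?tM ?pN.
- apply: filterS2 (ae_01 R) (ae_notin P) => x x01 xP.
  apply: cvgD; last exact: cp.
  by apply: contrapT => nc; move/negP: xP; apply; apply/PE.
Qed.

(** Test functions are dense and are approximated by their own samples. *)
Lemma defect_cvg g : defect g @ \oo --> 0.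
Proof.
have Lg := L2U_L2 g; have [f_ Sf fg] := test_dense Lg.
apply/cvgr0Pnorm_le => e e0.
have e4 : 0 < e / 4 by rewrite divr_gt0.
have [k hk] : exists k, nsq (fun x => f_ k x - g x) < e / 4.
  have /cvgr0Pnorm_lt/(_ _ e4)[k _ /(_ k (leqnn k))/=] := fg.
  by rewrite ger0_norm ?nsq_ge0// => ?; exists k.
have Lf := smooth_L2 (Sf k).1.
have := sample_cvg_continuous (smooth_continuous (Sf k).1).
move/cvgr0Pnorm_lt/(_ _ e4) => hs.
near=> n.
have n0 : (0 < n)%N by near: n; exists 1%N.
rewrite ger0_norm ?defect_ge0// (le_trans (defect_le _ (fun k' => f_ k (grid n k')) n0))//.
have : `|nsq (fun x => sample n (f_ k) x - f_ k x)| < e / 4 by near: n.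
rewrite ger0_norm ?nsq_ge0//.
have Ls : L2 (sample n (f_ k)) by exact: stepn_L2.
rewrite -/(sample n (f_ k)).
rewrite (_ : (fun x => sample n (f_ k) x - g x) = (fun x =>
  (sample n (f_ k) x - f_ k x) + (f_ k x - g x))); last first.
  by apply/funext => x; ring.
rewrite (nsqD (L2B Ls Lf) (L2B Lf Lg)).
have := ip_young (L2B Ls Lf) (L2B Lf Lg).
move: hk; lra.
Unshelve. all: by end_near. Qed.

Lemma ip_stepn_derive n c phi : (0 < n)%N -> supp_in 0 1 phi ->
  ip (stepn n c) (derive1 phi) =
  - \sum_(k < n.-1) (c k.+1 - c k) * phi (grid n k.+1).
Proof.
move=> n0 Sphi; have sphi := Sphi.1.
rewrite ip_stepn//; last exact/smooth_L2/smooth_derive.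
have -> : \sum_(k < n) c k * Jn n k (derive1 phi) =
    \sum_(k < n) c k * (phi (grid n k.+1) - phi (grid n k)).
  apply: eq_bigr => k _; congr (_ * _); apply: J_FTC.
  - by move=> x; exact: smooth_derivable.
  - exact/smooth_continuous/smooth_derive.
  - exact: grid_ge0.
  - by rewrite grid_le.
  - by rewrite grid_le1.
case: n n0 => // n _ /=.
have p1 : phi (grid n.+1 n.+1) = 0.
  by apply: (supp_in_eq0 Sphi); rewrite gridnn// lexx orbT.
have p0 : phi (grid n.+1 0) = 0.
  by apply: (supp_in_eq0 Sphi); rewrite /grid mul0r lexx.
under eq_bigr do rewrite mulrBr.
rewrite sumrB big_ord_recr/= p1 mulr0 addr0 [X in _ - X]big_ord_recl/= p0 mulr0 add0r.
rewrite -sumrB -sumrN; apply: eq_bigr => k _.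
by rewrite /bump/= add1n; ring.
Qed.

(** The interaction of two neighbouring cells whose values differ by d, in the
    three discrete regimes at once. *)
Definition pot (gamma m : R) n (d : R) : R :=
  if 0 < gamma then
    if 0 < m then Num.min (n%:R / m ^+ 2 * d ^+ 2) gamma else gamma * (d != 0)%:R
  else 0.

Lemma pot_ge0 gamma m n d : 0 <= pot gamma m n d.
Proof.
rewrite /pot; case: ifPn => // g0; case: ifPn => m0.
  by rewrite le_min (ltW g0) andbT mulr_ge0 ?sqr_ge0// divr_ge0// sqr_ge0.
by rewrite mulr_ge0// ltW.
Qed.

Lemma pot_le gamma m n d : 0 <= gamma -> pot gamma m n d <= gamma.
Proof.
move=> g0; rewrite /pot; case: ifPn => // _; case: ifPn => m0.
  by rewrite ge_min lexx orbT.
by rewrite ler_piMr// lern1 leq_b1.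
Qed.

(** Quadratic upper bound of the potential; for m = 0 its right-hand side is 0,
    whence the condition on d. *)
Lemma pot_small gamma m n d : 0 <= gamma -> 0 <= m -> (m = 0 -> d = 0) ->
  pot gamma m n d <= (m ^+ 2)^-1 * (n%:R * d ^+ 2).
Proof.
move=> g0; rewrite le_eqVlt => /predU1P[<- /(_ erefl) ->|m0 _].
  by rewrite /pot ltxx eqxx mulr0 expr0n/= !mulr0; case: ifP.
rewrite /pot m0; case: ifPn => _; last first.
  by rewrite mulr_ge0 ?invr_ge0 ?sqr_ge0// mulr_ge0 ?sqr_ge0.
by rewrite ge_min; apply/orP; left; rewrite [leRHS]mulrA (mulrC _ n%:R).
Qed.

Lemma functional_discrete g gamma m n f c : 0 <= gamma -> 0 <= m -> (0 < n)%N ->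
  eqae f (stepn n c) ->
  functional g (gamma, m, n%:R^-1) f =
    (\sum_(k < n.-1) pot gamma m n (c k.+1 - c k) +
      (nsq (fun x => f x - g x) - defect g n))%:E.
Proof.
move=> g0 m0 n0 fc.
have nV : 0 < n%:R^-1 :> R by rewrite invr_gt0 ltr0n.
rewrite /functional nV invrK natrK.
have inC : in_class (stepUn n) f by apply/in_class_stepn => //; exists c.
pose u := rep (stepUn n) f.
have uc k : (k < n)%N -> u (grid n k) = c k by exact: rep_grid.
have fid : discrete_fidelity g n u = nsq (fun x => f x - g x) - defect g n.
  rewrite discrete_fidelityE//; congr (_ - _); apply: eq_nsq.
  - by apply: L2_mfun; apply: L2B; [exact: stepn_L2|exact: L2U_L2].
  - by apply: L2_mfun; apply: L2B; exact: L2U_L2.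
  apply: filterS fc => x ->; congr (_ - _); apply: eq_bigr => k _.
  by rewrite uc.
have dE (k : 'I_n.-1) : u (k.+1%:R / n%:R) - u (k%:R / n%:R) = c k.+1 - c k.
  have kn : (k.+1 < n)%N by rewrite -ltn_predRL.
  by rewrite -!/(grid _ _) !uc// ltnW.
rewrite /pot; case: ifPn => gg; last first.
  rewrite /discrete_L2 /extend_pinfty; case: asboolP => // _.
  by rewrite -/u fid big1// add0r.
case: ifPn => mm.
  rewrite /blake_zisserman /extend_pinfty; case: asboolP => // _.
  rewrite -/u fid; congr (_ + _)%:E; apply: eq_bigr => k _.
  by rewrite dE.
rewrite /discrete_potts /extend_pinfty; case: asboolP => // _.
rewrite -/u fid; congr (_ + _)%:E.
rewrite -mulr_sumr; congr (_ * _); rewrite -sum1_card natr_sum big_mkcond/=.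
apply: eq_bigr => k _; rewrite inE/= -subr_eq0 dE.
by case: eqP.
Qed.

Lemma functional_discrete_inv g (gamma m : R) n f : (0 < n)%N ->
  (functional g (gamma, m, (n%:R^-1)%R) f < +oo)%E ->
  exists c, eqae f (stepn n c).
Proof.
move=> n0.
have nV : 0 < n%:R^-1 :> R by rewrite invr_gt0 ltr0n.
move=> h; apply/(in_class_stepn f n0); move: h.
rewrite /functional nV invrK natrK.
rewrite /discrete_L2 /discrete_potts /blake_zisserman /extend_pinfty.
by case: ifPn => _; [case: ifPn => _|]; case: asboolP.
Qed.

Lemma sum_Jn n j h : (0 < n)%N -> (j <= n)%N -> Int h ->
  \sum_(k < j) Jn n k h = J 0 (grid n j) h.
Proof.
move=> n0 + Ih; elim: j => [_|j IH jn].
  by rewrite big_ord0 /grid mul0r J_xx.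
rewrite big_ord_recr/= IH ?(ltnW jn)// J_cat// ?grid_ge0// grid_le//.
Qed.

(** Between two nodes without a jump in between, Cauchy-Schwarz bounds the squared
    increment of prim v by n^-1 times the integral of v^2; with a jump, the
    potential is at most gamma. *)
Lemma sample_energy gamma m n t v : 0 <= gamma -> 0 <= m -> (0 < n)%N ->
  stepU t -> L2 v -> (m = 0 -> nsq v = 0) ->
  \sum_(k < n.-1) pot gamma m n (t (grid n k.+1) + prim v (grid n k.+1) -
    (t (grid n k) + prim v (grid n k))) <=
  gamma * (njumps t)%:R + (m ^+ 2)^-1 * nsq v.
Proof.
move=> g0 m0 n0 st Lv v0; pose u x := t x + prim v x.
have [P sP PE] := njumps_seq st.
pose jump k := has (fun p => grid n k < p <= grid n k.+1) P.
have kn (k : 'I_n.-1) : (k.+1 < n)%N by rewrite -ltn_predRL.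
have nn0 : 0 < n%:R :> R by rewrite ltr0n.
pose E k := (m ^+ 2)^-1 * Jn n k (fun x => v x ^+ 2).
have E0 k : 0 <= E k.
  rewrite mulr_ge0 ?invr_ge0 ?sqr_ge0//; apply: J_ge0 => x; exact: sqr_ge0.
have hk (k : 'I_n.-1) : pot gamma m n (u (grid n k.+1) - u (grid n k)) <=
    gamma * (jump k)%:R + E k.
  have [jk|njk] := boolP (jump k).
    by rewrite mulr1 (le_trans (pot_le _ _ _ _))// lerDl.
  rewrite mulr0 add0r.
  have -> : u (grid n k.+1) - u (grid n k) = Jn n k v.
    have tE : t (grid n k) = t (grid n k.+1).
      apply: (stepU_const st); rewrite ?grid_ge0 ?grid_le ?grid_le1 ?(ltnW (kn k))//.
      by move=> z zk /PE zP; move/hasPn : njk => /(_ _ zP); rewrite zk.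
    by rewrite /u tE opprD addrACA subrr add0r primB ?grid_ge0 ?grid_le//; exact: L2_Int.
  have Jsq : Jn n k v ^+ 2 <= n%:R^-1 * Jn n k (fun x => v x ^+ 2).
    rewrite -(gridS R n k); apply: J_sq_le => //.
    - exact: grid_ge0.
    - by rewrite grid_le.
    - by rewrite grid_le1// ltnW.
  apply: (le_trans (pot_small _ _ _ _)) => //.
    move=> /v0 nv0; apply/eqP; rewrite -sqrf_eq0 eq_le sqr_ge0 andbT.
    apply: (le_trans Jsq); rewrite mulr_ge0_le0 ?invr_ge0//.
    by rewrite -nv0; exact: J_le_nsq.
  apply: ler_wpM2l; first by rewrite invr_ge0 sqr_ge0.
  by rewrite -ler_pdivlMl.
apply: (@le_trans _ _ (\sum_(k < n.-1) (gamma * (jump k)%:R + E k))).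
  by apply: ler_sum => k _; exact: hk.
rewrite big_split/= -mulr_sumr; apply: lerD.
  apply: ler_wpM2l => //; rewrite -natr_sum ler_nat -sP.
  have -> : (\sum_(k < n.-1) jump k = \sum_(k < n.-1 | jump k) 1)%N.
    by rewrite [RHS]big_mkcond/=; apply: eq_bigr => k _; case: (jump k).
  rewrite sum1_card.
  (* the half-open intervals between nodes are disjoint, so no jump is counted twice *)
  pose w (k : 'I_n.-1) := nth 0 P (find (fun p => grid n k < p <= grid n k.+1) P).
  have wP (k : 'I_n.-1) : jump k -> grid n k < w k <= grid n k.+1.
    by move=> jk; apply: (nth_find 0 jk).
  have w_inj : {in [pred k : 'I_n.-1 | jump k] &, injective w}.
    move=> j k; rewrite !inE => /wP/andP[j1 j2] /wP/andP[k1 k2] wjk.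
    apply/val_inj/eqP; rewrite eqn_leq /=.
    have := lt_le_trans j1 (_ : w j <= grid n k.+1); rewrite {1}wjk => /(_ k2).
    have := lt_le_trans k1 (_ : w k <= grid n j.+1); rewrite -{1}wjk => /(_ j2).
    by rewrite !grid_lt// !ltnS => -> ->.
  rewrite cardE -(size_map w); apply: uniq_leq_size.
    rewrite map_inj_in_uniq ?enum_uniq// => j k; rewrite !mem_enum.
    exact: w_inj.
  move=> x /mapP[k]; rewrite mem_enum => jk ->.
  by apply: mem_nth; rewrite -has_find; exact: jk.
rewrite -mulr_sumr; apply: ler_wpM2l; first by rewrite invr_ge0 sqr_ge0.
by rewrite sum_Jn ?leq_pred ?J_le_nsq//; case: Lv.
Qed.

End discretization.

(** * Gamma-convergence by ultrafilters and almost optimal points *)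

Section gamma_convergence.
Variable R : realType.

Lemma near_infty_proper_within (D : set nat) : (forall N, exists2 n, (N <= n)%N & D n) ->
  ProperFilter (within D \oo).
Proof.
move=> h; split; last exact: within_filter.
by move=> [N _ hN]; have [n Nn Dn] := h N; exact: (hN n Nn Dn).
Qed.

(** If F x exceeded the lower limit, some level a in between would be undercut at
    infinitely many indices.  An ultrafilter containing these indices and finer
    than the filter at infinity replaces a subsequence, and needs no further
    extraction to make bounded quantities converge. *)
Lemma gamma_liminf (X : metricType R) (F_ : nat -> X -> \bar R) (F : X -> \bar R) :
  (forall (U : set_system nat) (x : X) (x_ : nat -> X) (a : R), UltraFilter U ->
    \oo `<=` U -> x_ @ U --> x -> U [set s | (F_ s (x_ s) < a%:E)%E] ->
    (F x <= a%:E)%E) ->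
  forall (x : X) (x_ : nat -> X), x_ @ \oo --> x ->
    (F x <= limn_einf (fun j => F_ j (x_ j)))%E.
Proof.
move=> h x x_ xx; rewrite leNgt; apply/negP => lt.
have [a la aF] : exists2 a : R, (limn_einf (fun j => F_ j (x_ j)) < a%:E)%E & (a%:E < F x)%E.
  move: lt; set l := limn_einf _; case: l => [l| |]; case: (F x) => [r| |]//.
  - by rewrite lte_fin => lr; exists ((l + r) / 2); rewrite lte_fin midf_lt.
  - by move=> _; exists (l + 1); rewrite ?lte_fin ?ltrDl ?ltry.
  - by move=> _; exists (r - 1); rewrite ?lte_fin ?ltrBlDr ?ltrDl ?ltNyr.
  - by move=> _; exists 0; rewrite ?ltNyr ?ltry.
pose D := [set s | (F_ s (x_ s) < a%:E)%E].
have PD : ProperFilter (within D \oo).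
  apply: near_infty_proper_within => N.
  have : (einfs (fun j => F_ j (x_ j)) N < a%:E)%E.
    apply: le_lt_trans la; rewrite limn_einf_lim.
    apply: lime_ge; first exact: is_cvg_einfs.
    exists N => // m /= Nm; exact: nondecreasing_einfs.
  by move=> /ereal_inf_lt[_ [n /= Nn <-] na]; exists n.
have [U [UU DU]] := ultraFilterLemma PD.
have oU : \oo `<=` U.
  by move=> A [N _ NA]; apply: DU; exists N => // n Nn _; exact: NA.
have UD : U D by apply: DU; exists 0%N.
have xU : x_ @ U --> x by move=> A /xx ?; exact: oU.
have := h U x x_ a UU oU xU UD.
by rewrite leNgt aF.
Qed.

(** A diagonal choice among the almost optimal points. *)
Lemma gamma_limsup (X : metricType R) (F_ : nat -> X -> \bar R) (x : X) (b : R) :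
  (forall e, 0 < e -> \forall s \near \oo,
     exists2 y, ball x e y & (F_ s y <= (b + e)%:E)%E) ->
  exists2 x_ : nat -> X, x_ @ \oo --> x &
    (limn_esup (fun j => F_ j (x_ j)) <= b%:E)%E.
Proof.
move=> h.
pose e (k : nat) : R := k.+1%:R^-1.
have e0 k : 0 < e k by rewrite invr_gt0 ltr0n.
pose good s k y := ball x (e k) y /\ (F_ s y <= (b + e k)%:E)%E.
pose A s (k : nat) := `[< exists y, good s k y >].
(* the best accuracy 1/(k+1) available at index s among k <= s *)
pose K s : nat := \max_(k < s.+1 | A s k) k.
pose x_ s := xget x [set y | good s (K s) y].
have key k : \forall s \near \oo, ball x (e k) (x_ s) /\ (F_ s (x_ s) <= (b + e k)%:E)%E.
  have [N _ hN] := h _ (e0 k).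
  exists (maxn N k) => // s /=; rewrite geq_max => /andP[Ns ks].
  have Ask : A s k by apply/asboolP; have [y y1 y2] := hN s Ns; exists y.
  have ks' : (k < s.+1)%N by rewrite ltnS.
  have kK : (k <= K s)%N by apply: (@leq_bigmax_cond _ _ (fun i : 'I_s.+1 => i : nat) (Ordinal ks')).
  have AK : A s (K s).
    have c : (0 < #|[pred i : 'I_s.+1 | A s i]|)%N.
      by apply/card_gt0P; exists (Ordinal ks').
    have [i Ai Ki] := eq_bigmax_cond (fun i : 'I_s.+1 => i : nat) c.
    have -> : K s = i by rewrite -[RHS]Ki; apply: eq_bigl.
    exact: Ai.
  have [b1 b2] : good s (K s) (x_ s).
    by move/asboolP: AK; apply: xgetPex.
  have eK : e (K s) <= e k by rewrite lef_pV2 ?posrE ?ltr0n// ler_nat ltnS.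
  split; first exact: le_ball b1.
  by apply: (le_trans b2); rewrite lee_fin lerD2l.
have ex_e (d : R) : 0 < d -> exists k, e k <= d.
  move=> d0; have := @cvg_harmonic R; move/cvgrPdist_le => /(_ _ d0)[k _ /(_ k (leqnn k))]/=.
  by rewrite sub0r normrN ger0_norm ?invr_ge0// => ?; exists k.
exists x_.
  apply/cvg_ballP => d d0; have [k kd] := ex_e d d0.
  by apply: filterS (key k) => s [+ _]; exact: le_ball.
apply/lee_addgt0Pr => d d0; have [k kd] := ex_e d d0.
rewrite limn_esup_lim; apply: lime_le; first exact: is_cvg_esups.
have [N _ hN] := key k; exists N => // n Nn.
apply: ge_ereal_sup => _ [m /= nm <-].
have [_ hm] := hN m (leq_trans Nn nm).
by apply: (le_trans hm); rewrite -EFinD lee_fin lerD2l.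
Qed.

Lemma ultra_cvg (T : Type) (U : set_system T) (u : T -> R) (a b : R) : UltraFilter U ->
  (forall s, a <= u s <= b) -> exists2 p, a <= p <= b & u @ U --> p.
Proof.
move=> UU uab.
have PU : ProperFilter (u @ U) by exact: fmap_proper_filter.
have [|p [pab clp]] := @segment_compact R a b (u @ U) PU.
  apply: (@filterE _ U) => s; change (u s \in `[a, b]); rewrite in_itv; exact: uab.
exists p; first by move: pab; rewrite /= in_itv.
move=> V pV; have [//|nV] := in_ultra_setVsetC (u @^-1` V) UU.
by have [y [Vy]] := clp (~` V) V nV pV.
Qed.

Lemma ultra_bounded_cst (T : Type) (U : set_system T) (u : T -> nat) B : UltraFilter U ->
  U [set s | (u s <= B)%N] -> exists J, U [set s | u s = J].
Proof.
move=> UU; elim: B => [h|B IH h].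
  by exists 0%N; apply: filterS h => s /=; rewrite leqn0 => /eqP.
have [h1|h1] := in_ultra_setVsetC [set s | (u s <= B)%N] UU; first exact: IH.
exists B.+1; apply: filterS2 h h1 => s /= h2 /negP; rewrite -ltnNge => h3.
by apply/eqP; rewrite eqn_leq h2.
Qed.

(** The quantity psi n attached to the mesh t = 1/n, and l when there is no mesh;
    it turns limits in n into limits in t. *)
Definition at_scale (psi : nat -> R) (l t : R) : R :=
  if t == 0 then l else psi (Num.truncn t^-1).

Lemma at_scale_cvg (T : Type) (U : set_system T) (FU : Filter U) (psi : nat -> R) (l : R)
    (t_ : T -> R) :
  (forall s, scales (t_ s)) -> t_ @ U --> 0 -> psi @ \oo --> l ->
  (fun s => at_scale psi l (t_ s)) @ U --> l.
Proof.
move=> st t0 pl; apply/cvgrPdist_le => e e0.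
move/cvgrPdist_le : pl => /(_ _ e0)[N _ hN].
have N0 : 0 < N.+1%:R^-1 :> R by rewrite invr_gt0.
move/cvgr0Pnorm_lt : t0 => /(_ _ N0); apply: filterS => s ts.
rewrite /at_scale; case: (st s) => [->|[n n0 tn]].
  by rewrite eqxx subrr normr0 ltW.
rewrite tn invr_eq0 pnatr_eq0 -[n == 0%N]negbK -lt0n n0/= invrK natrK.
apply: hN => /=; move: ts; rewrite tn ger0_norm ?invr_ge0//.
by rewrite ltf_pV2 ?posrE ?ltr0n// ltr_nat => /ltnW/ltnW.
Qed.

End gamma_convergence.

(** * Recovery sequences for vanishing meshes *)

Section limits.
Variables (R : realType) (g : L2U R).
Implicit Types (f : L2U R) (t v h u : R -> R) (n k : nat) (c : nat -> R).
Notation mfunR f := (measurable_fun [set: measurableTypeR R] (f : R -> R)).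

Lemma nsq_sub_cvg T (F : set_system T) {FF : Filter F} (f_ : T -> R -> R) (f h : R -> R) :
  (forall s, L2 (f_ s)) -> L2 f -> L2 h ->
  (fun s => nsq (fun x => f_ s x - f x)) @ F --> 0 ->
  (fun s => nsq (fun x => f_ s x - h x)) @ F --> nsq (fun x => f x - h x).
Proof.
move=> Lf_ Lf Lh c; apply: (@nsq_cvg _ _ _ _ (fun s x => f_ s x - h x)).
- by move=> s; exact: L2B.
- exact: L2B.
rewrite (_ : (fun s => _) = (fun s => nsq (fun x => f_ s x - f x)))//.
apply/funext => s; congr nsq; apply/funext => x; ring.
Qed.

Lemma inv_sqr_cvg T (F : set_system T) {FF : Filter F} (m_ : T -> R) (m N : R) :
  m_ @ F --> m -> (m = 0 -> N = 0) ->
  (fun s => (m_ s ^+ 2)^-1 * N) @ F --> (m ^+ 2)^-1 * N.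
Proof.
move=> mc N0; have [mz|mN] := eqVneq m 0.
  by rewrite (N0 mz) mulr0; under eq_fun do rewrite mulr0; exact: cvg_cst.
apply: cvgMr_tmp; apply: cvgV; first by rewrite sqrf_eq0.
exact: (cvgM mc mc).
Qed.

(** Samples of t + prim v at the indices with a mesh, f itself at the others. *)
Lemma recovery (gamma_ m_ t_ : nat -> R) (gamma m : R) f t v :
  (forall s, 0 <= gamma_ s) -> (forall s, 0 <= m_ s) -> (forall s, scales (t_ s)) -> 0 <= m ->
  gamma_ @ \oo --> gamma -> m_ @ \oo --> m -> t_ @ \oo --> 0 ->
  decomp f t v -> (m = 0 -> nsq v = 0) ->
  forall e, 0 < e -> \forall s \near \oo, exists2 y : L2U R, ball f e y &
    (functional g (gamma_ s, m_ s, t_ s) y <=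
      (gamma * (njumps t)%:R + (m ^+ 2)^-1 * nsq v + nsq (fun x => f x - g x) + e)%R%:E)%E.
Proof.
move=> gamma0 m0 ts mm0 gc mc tc d v0 e e0; have [st mt Lv fE] := d.
have Lf := L2U_L2 f; have Lg := L2U_L2 g.
pose u x := t x + prim v x.
have Lu : L2 u by apply: eq_L2 fE Lf; apply: measurable_funD => //; apply: L2_mfun; exact: prim_L2.
have c1 : (fun s => gamma_ s * (njumps t)%:R + (m_ s ^+ 2)^-1 * nsq v) @ \oo -->
    gamma * (njumps t)%:R + (m ^+ 2)^-1 * nsq v.
  by apply: cvgD; [exact: cvgMr_tmp|exact: inv_sqr_cvg].
have c2 := sample_cvg_sbv st mt Lv; rewrite -/u in c2.
have Lsn n : (0 < n)%N -> L2 (sample n u) by move=> n0; exact: stepn_L2.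
have c3 : (fun n => nsq (fun x => sample n.+1 u x - g x)) @ \oo --> nsq (fun x => f x - g x).
  rewrite (_ : nsq (fun x => f x - g x) = nsq (fun x => u x - g x)).
    apply: nsq_sub_cvg => //; first by move=> n; exact: Lsn.
    by rewrite (cvg_shiftS (fun n => nsq (fun x => sample n u x - u x))).
  apply: eq_nsq; do ?by apply: L2_mfun; exact: L2B.
  by apply: filterS fE => x ->.
have e2 : 0 < e / 2 by rewrite divr_gt0.
have he : 0 < e ^+ 2 by rewrite exprn_gt0.
have [N [N0 hN]] : exists N, (0 < N)%N /\ forall n, (N <= n)%N ->
    nsq (fun x => sample n u x - u x) < e ^+ 2 /\
    nsq (fun x => sample n u x - g x) <= nsq (fun x => f x - g x) + e / 2.
  move/cvgr0Pnorm_lt : c2 => /(_ _ he)[N1 _ h1].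
  have lt1 : nsq (fun x => f x - g x) < nsq (fun x => f x - g x) + e / 2 by rewrite ltrDl.
  move/cvgr_le : c3 => /(_ _ lt1)[N2 _ h2].
  exists (maxn N1 N2).+1; split => // n; case: n => // n; rewrite ltnS geq_max => /andP[n1 n2].
  split; first by have := h1 n.+1 (leqW n1); rewrite /= ger0_norm ?nsq_ge0.
  exact: h2.
have hv : \forall s \near \oo, m_ s = 0 -> nsq v = 0.
  have [mz|mN] := eqVneq m 0; first by apply: nearW => s _; exact: v0.
  have mp : 0 < m by rewrite lt_def mN.
  move/cvgr_gt : mc => /(_ _ mp); apply: filterS => s ms ms0.
  by move: ms; rewrite ms0 ltxx.
have ht : \forall s \near \oo, t_ s < N%:R^-1.
  by move/cvgr_lt : tc; apply; rewrite invr_gt0 ltr0n.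
have lt2 : gamma * (njumps t)%:R + (m ^+ 2)^-1 * nsq v <
    gamma * (njumps t)%:R + (m ^+ 2)^-1 * nsq v + e / 2 by rewrite ltrDl.
move/cvgr_le : c1 => /(_ _ lt2) c1.
near=> s.
have vs : m_ s = 0 -> nsq v = 0 by near: s.
have es : gamma_ s * (njumps t)%:R + (m_ s ^+ 2)^-1 * nsq v <=
    gamma * (njumps t)%:R + (m ^+ 2)^-1 * nsq v + e / 2.
  by near: s.
case: (ts s) => [tz|[n n0 tn]].
  exists f; first exact: ballxx.
  rewrite tz; apply: (le_trans (functional0_le _ (gamma0 s) (m0 s) d vs)).
  by rewrite lee_fin; lra.
have Nn : (N <= n)%N.
  have : t_ s < N%:R^-1 by near: s.
  by rewrite tn ltf_pV2 ?posrE ?ltr0n// ltr_nat => /ltnW.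
have [h1 h2] := hN n Nn.
have [y yE] := L2_class (Lsn n n0).
exists y.
  apply/ball_L2U; rewrite -(@ltr_pXn2r _ 2)// ?nnegrE ?nrm_ge0 ?(ltW e0)// nrm_sq.
  rewrite nsqBC (_ : nsq _ = nsq (fun x => sample n u x - u x))//.
  apply: eq_nsq.
  - by apply: L2_mfun; apply: L2B => //; exact: L2U_L2.
  - by apply: L2_mfun; apply: L2B => //; exact: Lsn.
  by apply: filterS2 yE fE => x -> ->.
rewrite tn (functional_discrete _ (gamma0 s) (m0 s) n0 yE) lee_fin.
have -> : nsq (fun x => y x - g x) = nsq (fun x => sample n u x - g x).
  apply: eq_nsq.
  - exact: L2_mfun (L2B (L2U_L2 y) Lg).
  - exact: L2_mfun (L2B (Lsn n n0) Lg).
  by apply: filterS yE => x ->.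
have := sample_energy (gamma0 s) (m0 s) n0 st Lv vs.
have := defect_ge0 g n; rewrite /u in h2 *; lra.
Unshelve. all: by end_near. Qed.

(** Near every point either phi vanishes or t is constant, so t * phi' is the
    derivative of t * phi, which vanishes at both ends. *)
Lemma ip_step_derive_eq0 t phi : stepU t -> mfunR t -> supp_in 0 1 phi ->
  (forall x, jset t x -> \forall y \near x, phi y = 0) -> ip t (derive1 phi) = 0.
Proof.
move=> st mt Sphi ph; have sphi := Sphi.1.
pose h x := t x * phi x.
have loc (x : R) : (\forall y \near x, phi y = 0) \/ (\forall y \near x, t y = t x).
  have [x01|x01] := boolP (0 < x < 1); last first.
    by left; apply: (supp_in_near0 Sphi); move: x01; rewrite negb_and -!leNgt.
  case: (pselect ({for x, continuous t})) => cx; first by right; exact: stepU_locally.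
  by left; apply: ph.
have dh (x : R) : is_derive x (1 : R) h (t x * derive1 phi x).
  have [p0|t0] := loc x.
    rewrite near0_derive// mulr0; apply: (@near_eq_is_derive R R R (cst 0)).
    by apply: filterS p0 => y py; rewrite /h py mulr0.
  apply: (@near_eq_is_derive R R R (fun y => t x * phi y)).
    by apply: filterS t0 => y ty; rewrite /h ty.
  rewrite derive1E.
  have dphi : derivable phi x 1 by exact: smooth_derivable.
  exact: (is_deriveZ (t x) (derivableP dphi)).
have h' : derive1 h = fun x => t x * derive1 phi x.
  by apply/funext => x; rewrite derive1E; have [] := dh x.
have ch : continuous (derive1 h).
  rewrite h' => x; have cp : {for x, continuous (derive1 phi)}.
    exact: (smooth_continuous (smooth_derive sphi)).
  have [p0|t0] := loc x.
    rewrite /continuous_at near0_derive// mulr0; apply: cvg_near_cst.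
    by apply: filterS (near_join p0) => y py; rewrite near0_derive// mulr0.
  rewrite /prop_for /continuous_at.
  apply: cvg_trans (_ : (fun y => t x * derive1 phi y) @ x --> t x * derive1 phi x).
    by apply: near_eq_cvg; apply: filterS t0 => y ->.
  exact: cvgMl_tmp.
transitivity (I (derive1 h)); first by rewrite h'.
rewrite -J01; last exact/L2_Int/L2_continuous.
have Hd (x : R) : derivable h x (1 : R) by have [] := dh x.
rewrite (J_FTC Hd ch (lexx 0) ler01 (lexx 1)) /h.
have -> : phi 1 = 0 by apply: (supp_in_eq0 Sphi); rewrite lexx orbT.
have -> : phi 0 = 0 by apply: (supp_in_eq0 Sphi); rewrite lexx.
by rewrite !mulr0 subrr.
Qed.

End limits.

(** * Lower bound for vanishing meshes *)

Section lower_bound.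
Variables (R : realType) (g : L2U R).
Implicit Types (f : L2U R) (t v h u : R -> R) (n k : nat) (c : nat -> R).
Notation grid := (@grid R).

Lemma pot_lt gamma m n (d : R) : 0 < gamma -> 0 <= m ->
  pot gamma m n d < gamma -> n%:R * d ^+ 2 = m ^+ 2 * pot gamma m n d.
Proof.
move=> g0; rewrite /pot g0 le_eqVlt => /predU1P[<-|m0].
  rewrite ltxx; have [->|dN] := eqVneq d 0; first by rewrite expr0n/= !mulr0.
  by rewrite mulr1 ltxx.
rewrite m0 gt_min ltxx orbF => h.
rewrite min_l ?(ltW h)//; field; exact: lt0r_neq0.
Qed.

Definition defect_at (t : R) := at_scale (defect g) 0 t.

Definition sample_sq (phi : R -> R) (t : R) := at_scale (fun n => nsq (sample n phi)) (nsq phi) t.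

(** The energy bound in dual form, with or without mesh.  K collects the jumps, or
    the nodes where the potential is saturated; each costs gamma.  What remains of
    the energy is quadratic, and Young's inequality after integration (summation)
    by parts turns it into a bound linear in f. *)
Lemma duality_bound gamma m (t : R) f a : 0 < gamma -> 0 <= m -> scales t ->
  (functional g (gamma, m, t) f < a%:E)%E ->
  exists K : seq R,
  [/\ forall p, p \in K -> 0 <= p <= 1,
    0 <= a - (nsq (fun x => f x - g x) - defect_at t) - gamma * (size K)%:R &
    forall phi, supp_in 0 1 phi -> (forall p, p \in K -> \forall y \near p, phi y = 0) ->
      2 * ip f (derive1 phi) <=
      m ^+ 2 * (a - (nsq (fun x => f x - g x) - defect_at t) - gamma * (size K)%:R)
      + sample_sq phi t].
Proof.
move=> g0 m0 st Fa; have Lf := L2U_L2 f.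
rewrite /defect_at /sample_sq /at_scale.
case: st => [tz|[n n0 tn]].
  rewrite tz eqxx subr0 in Fa *.
  have [T [v [d v0]]] := functional0_inv g0 m0 (lt_trans Fa (ltry _)).
  rewrite (functional0_eq _ g0 m0 d v0) lte_fin in Fa.
  have [sT mT Lv fE] := d; have [K sK KE] := njumps_seq sT.
  have nv0 := nsq_ge0 v.
  have mv0 : 0 <= (m ^+ 2)^-1 * nsq v by rewrite mulr_ge0// invr_ge0 sqr_ge0.
  have vM : nsq v <= m ^+ 2 * (a - nsq (fun x => f x - g x) - gamma * (size K)%:R).
    have [mz|mN] := eqVneq m 0; first by rewrite v0// mz expr0n mul0r.
    have mp : 0 < m ^+ 2 by rewrite exprn_even_gt0.
    rewrite -ler_pdivrMl// sK; lra.
  exists K; split.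
  - by move=> p /KE[/andP[p0 p1] _]; rewrite !ltW.
  - by rewrite sK; lra.
  move=> phi Sphi ph.
  have Lphi := smooth_L2 Sphi.1; have Lphi' := smooth_L2 (smooth_derive Sphi.1).
  have LT : L2 T.
    apply: (@eq_L2 _ (fun x => f x - prim v x)) => //; last exact: L2B (prim_L2 Lv).
    by apply: filterS fE => x ->; rewrite addrK.
  have -> : ip f (derive1 phi) = - ip v phi.
    transitivity (ip (fun x => T x + prim v x) (derive1 phi)).
      apply: eq_ip fE (eqae_refl _); do ?exact: L2_mfun.
      by apply: L2_mfun; apply: L2D => //; exact: prim_L2.
    rewrite ipDl//; last exact: prim_L2.
    rewrite prim_by_parts// ip_step_derive_eq0 ?add0r// => x jx; apply: ph; exact/KE.
  have := ip_young (L2N Lv) Lphi.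
  have -> : ip (fun x => - v x) phi = - ip v phi.
    by rewrite -[RHS]mulN1r -ipZl//; congr ip; apply/funext => x; rewrite mulN1r.
  have -> : nsq (fun x => - v x) = nsq v.
    by congr I; apply/funext => x; rewrite mulrNN.
  by move: vM; lra.
have tN0 : (t == 0) = false by rewrite tn invr_eq0 pnatr_eq0 -[_ == _]negbK -lt0n n0.
rewrite tN0 tn invrK natrK in Fa *.
have [c fc] := functional_discrete_inv n0 (lt_trans Fa (ltry _)).
rewrite (functional_discrete _ (ltW g0) m0 n0 fc) lte_fin in Fa.
pose D k := c k.+1 - c k.
(* saturated increments play the part of jumps *)
pose big_ k := gamma <= pot gamma m n (D k).
pose K := [seq grid n k.+1 | k <- iota 0 n.-1 & big_ k].
pose S := \sum_(k < n.-1 | ~~ big_ k) pot gamma m n (D k).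
have sK : (size K)%:R = \sum_(k < n.-1 | big_ k) (1 : R).
  rewrite /K size_map size_filter -sum1_count natr_sum.
  have -> : iota 0 n.-1 = index_iota 0 n.-1 by rewrite /index_iota subn0.
  by rewrite big_mkord.
have split_sum : \sum_(k < n.-1) pot gamma m n (D k) = gamma * (size K)%:R + S.
  rewrite (bigID (fun k : 'I_n.-1 => big_ k))/=; congr (_ + _).
  rewrite sK mulr_sumr; apply: eq_bigr => k bk; rewrite mulr1.
  by apply/eqP; rewrite eq_le; apply/andP; split; [apply: pot_le; exact: ltW|exact: bk].
have S0 : 0 <= S by apply: sumr_ge0 => k _; exact: pot_ge0.
have Fa' : gamma * (size K)%:R + S + (nsq (fun x => f x - g x) - defect g n) < a.
  by rewrite -split_sum.
exists K; split.
- move=> p /mapP[k]; rewrite mem_filter mem_iota add0n => /andP[_ /andP[_ kn]] ->.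
  by rewrite grid_ge0 grid_le1// ltnW// -ltn_predRL.
- by move: Fa' S0; lra.
move=> phi Sphi ph.
have -> : ip f (derive1 phi) = ip (stepn n c) (derive1 phi).
  apply: eq_ip fc (eqae_refl _); do ?exact: L2_mfun.
  - exact: stepn_mfun.
  - exact: L2_mfun (smooth_L2 (smooth_derive Sphi.1)).
  - exact: L2_mfun (smooth_L2 (smooth_derive Sphi.1)).
rewrite ip_stepn_derive// (bigID (fun k : 'I_n.-1 => big_ k))/= big1 ?add0r; last first.
  move=> k bk; have : grid n k.+1 \in K.
    by apply: map_f; rewrite mem_filter bk mem_iota add0n /=.
  by move=> /ph /nbhs_singleton ->; rewrite mulr0.
have nn0 : 0 < n%:R :> R by rewrite ltr0n.
have h1 : 2 * - \sum_(k < n.-1 | ~~ big_ k) (c k.+1 - c k) * phi (grid n k.+1) <=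
    m ^+ 2 * S + n%:R^-1 * \sum_(k < n.-1 | ~~ big_ k) phi (grid n k.+1) ^+ 2.
  rewrite -sumrN !mulr_sumr -big_split/=; apply: ler_sum => k bk.
  rewrite -pot_lt// ?ltNge// -/(D k).
  set x := D k; set y := phi _.
  have := sqr_ge0 (n%:R * x + y).
  rewrite -(pmulr_rge0 _ (_ : 0 < n%:R^-1)) ?invr_gt0// => h.
  rewrite -subr_ge0; apply: le_trans h _; rewrite le_eqVlt; apply/orP; left; apply/eqP.
  by field; exact: lt0r_neq0.
have h2 : n%:R^-1 * \sum_(k < n.-1 | ~~ big_ k) phi (grid n k.+1) ^+ 2 <= nsq (sample n phi).
  rewrite nsq_stepn//; apply: ler_wpM2l; first by rewrite invr_ge0 ltW.
  apply: (@le_trans _ _ (\sum_(k < n.-1) phi (grid n k.+1) ^+ 2)).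
    rewrite [leRHS](bigID (fun k : 'I_n.-1 => ~~ big_ k))/= lerDl.
    by apply: sumr_ge0 => k _; exact: sqr_ge0.
  case: (n) n0 => // n' _; rewrite big_ord_recl /= lerDr.
  exact: sqr_ge0.
have h3 : m ^+ 2 * S <= m ^+ 2 * (a - (nsq (fun x => f x - g x) - defect g n) - gamma * (size K)%:R).
  by apply: ler_wpM2l; [exact: sqr_ge0|move: Fa'; lra].
by rewrite (le_trans h1)// lerD.
Qed.

(** The dual bound of [duality_bound] survives along U with the limits of the
    points of K as new exceptional set, and [decomp_of_duality_bound] converts it
    back into a bound of the energy. *)
Lemma liminf_vanishing_mesh (U : set_system nat) (gamma_ m_ t_ : nat -> R) (gamma m : R)
    (f_ : nat -> L2U R) f a : UltraFilter U ->
  (forall s, 0 <= m_ s) -> (forall s, scales (t_ s)) -> 0 < gamma -> 0 <= m ->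
  gamma_ @ U --> gamma -> m_ @ U --> m -> t_ @ U --> 0 -> f_ @ U --> f ->
  U [set s | (functional g (gamma_ s, m_ s, t_ s) (f_ s) < a%:E)%E] ->
  (functional g (gamma, m, 0%R) f <= a%:E)%E.
Proof.
move=> UU m0 st g0 mm0 gc mc tc fc Fa.
have Lf := L2U_L2 f; have Lg := L2U_L2 g.
have fc2 : (fun s => nsq (fun x => f_ s x - f x)) @ U --> 0 by exact: cvg_L2U.
pose nf s := nsq (fun x => f_ s x - g x) - defect_at (t_ s).
have nfc : nf @ U --> nsq (fun x => f x - g x).
  have c1 : (fun s => nsq (fun x => f_ s x - g x)) @ U --> nsq (fun x => f x - g x).
    by apply: nsq_sub_cvg fc2 => // s; exact: L2U_L2.
  have c2 : (fun s => defect_at (t_ s)) @ U --> 0.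
    by apply: at_scale_cvg => //; exact: defect_cvg.
  by rewrite -[X in _ --> X]subr0; exact: cvgB c1 c2.
pose good s (K : seq R) := [/\ forall p, p \in K -> 0 <= p <= 1,
    0 <= a - nf s - gamma_ s * (size K)%:R &
    forall phi, supp_in 0 1 phi -> (forall p, p \in K -> \forall y \near p, phi y = 0) ->
      2 * ip (f_ s) (derive1 phi) <=
      m_ s ^+ 2 * (a - nf s - gamma_ s * (size K)%:R) + sample_sq phi (t_ s)].
pose K s : seq R := if pselect (exists K, good s K) is left e then projT1 (cid e) else [::].
have Kgood : U [set s | good s (K s)].
  have g2 : \forall s \near U, 0 < gamma_ s by move/cvgr_gt : gc => /(_ _ g0).
  apply: filterS2 g2 Fa => s gs Fs.
  have e : exists K, good s K by exact: duality_bound.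
  by rewrite /= /K; case: pselect => // e'; case: (cid e').
have K01 s p : p \in K s -> 0 <= p <= 1.
  by rewrite /K; case: pselect => // e; case: (cid e) => /= K' [h _ _]; exact: h.
have g2 : \forall s \near U, gamma / 2 < gamma_ s.
  by move/cvgr_gt : gc; apply; rewrite ltr_pdivrMr// ltr_pMr// ltr1n.
pose B : R := `|a| + `|nsq (fun x => f x - g x)| + 1.
have nfB : \forall s \near U, nsq (fun x => f x - g x) - 1 < nf s.
  by move/cvgr_gt : nfc; apply; rewrite ltrBlDr ltrDl.
(* as gamma > 0, the level a bounds the number of points of K s *)
have [J UJ] : exists J, U [set s | size (K s) = J].
  apply: (@ultra_bounded_cst _ U _ (Num.truncn (B / (gamma / 2)))) => //.
  apply: filterS3 Kgood g2 nfB => s [_ h _] gs ns /=.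
  have g20 : 0 < gamma / 2 by rewrite divr_gt0.
  rewrite truncn_ge_nat; last by rewrite divr_ge0// ?(ltW g20)// !addr_ge0.
  rewrite ler_pdivlMr//.
  have h1 : (size (K s))%:R * (gamma / 2) <= (size (K s))%:R * gamma_ s.
    by apply: ler_wpM2l => //; exact: ltW.
  rewrite (le_trans h1)// /B; move: h; rewrite mulrC.
  have := ler_norm a; have := ler_norm (nsq (fun x => f x - g x)).
  have := nsq_ge0 (fun x => f x - g x); lra.
have pc i : exists2 p : R, 0 <= p <= 1 & (fun s => nth 0 (K s) i) @ U --> p.
  apply: ultra_cvg => s; have [iK|iK] := ltnP i (size (K s)).
    by apply: (K01 s); exact: mem_nth.
  by rewrite nth_default// lexx ler01.
pose p i := projT1 (cid2 (pc i)).
have pP i : (fun s => nth 0 (K s) i) @ U --> p i by rewrite /p; case: cid2.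
pose P := mkseq p J.
pose M := m ^+ 2 * (a - nsq (fun x => f x - g x) - gamma * J%:R).
have bc : (fun s => a - nf s - gamma_ s * J%:R) @ U -->
    a - nsq (fun x => f x - g x) - gamma * J%:R.
  apply: cvgB; last exact: cvgMr_tmp.
  by apply: cvgB => //; exact: cvg_cst.
have b0 : 0 <= a - nsq (fun x => f x - g x) - gamma * J%:R.
  apply: (cvgr_to_ge bc); apply: filterS2 Kgood UJ => s [_ + _] sJ.
  by rewrite sJ.
(* the dual bound passes to the limit along U *)
have hphi phi : supp_in 0 1 phi ->
    (forall q, q \in P -> \forall y \near q, phi y = 0) ->
    2 * ip f (derive1 phi) - nsq phi <= M.
  move=> Sphi ph; have Lphi' := smooth_L2 (smooth_derive Sphi.1).
  have c1 : (fun s => 2 * ip (f_ s) (derive1 phi)) @ U --> 2 * ip f (derive1 phi).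
    by apply: cvgMl_tmp; apply: ip_cvg => // s; exact: L2U_L2.
  have c2 : (fun s => m_ s ^+ 2 * (a - nf s - gamma_ s * J%:R) + sample_sq phi (t_ s)) @ U
      --> M + nsq phi.
    apply: cvgD; first by apply: cvgM => //; exact: (cvgM mc mc).
    apply: at_scale_cvg => //.
    rewrite -(cvg_shiftS (fun n => nsq (sample n phi))).
    apply: (@nsq_cvg _ _ _ _ (fun n => sample n.+1 phi)).
    - by move=> n; exact: stepn_L2.
    - exact: smooth_L2 Sphi.1.
    rewrite (cvg_shiftS (fun n => nsq (fun x => sample n phi x - phi x))).
    exact: sample_cvg_continuous (smooth_continuous Sphi.1).
  rewrite lerBlDr; apply: (ler_cvg_to c1 c2).
  have near_i : forall i, (i < J)%N -> U [set s | \forall y \near nth 0 (K s) i, phi y = 0].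
    move=> i iJ; have : \forall y \near p i, phi y = 0.
      by apply: ph; apply/mapP; exists i => //; rewrite mem_iota.
    by move=> /near_join /(pP i).
  have near_all : U [set s | forall i, (i < J)%N -> \forall y \near nth 0 (K s) i, phi y = 0].
    elim: (J) near_i => [_|j IH h]; first by apply: filterE => s i.
    have h1 : forall i, (i < j)%N -> U [set s | \forall y \near nth 0 (K s) i, phi y = 0].
      by move=> i ij; apply: h; rewrite ltnS ltnW.
    apply: filterS2 (IH h1) (h j (ltnSn j)) => s a1 a2 i.
    by rewrite ltnS leq_eqVlt => /predU1P[->|/a1].
  apply: filterS3 Kgood UJ near_all => s [_ _ h] sJ na; rewrite -sJ; apply: h => //.
  by move=> q /(nthP 0)[i iK <-]; apply: na; rewrite -sJ.
have [T [v [d jT vM]]] := decomp_of_duality_bound Lf hphi.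
have v0 : m = 0 -> nsq v = 0.
  move=> mz; apply/eqP; rewrite eq_le nsq_ge0 andbT; move: vM.
  by rewrite /M mz expr0n mul0r.
rewrite (functional0_eq _ g0 mm0 d v0) lee_fin.
have jJ : gamma * (njumps T)%:R <= gamma * J%:R.
  apply: ler_wpM2l; first exact: ltW.
  by rewrite ler_nat; move: jT; rewrite size_mkseq.
have vb : (m ^+ 2)^-1 * nsq v <= a - nsq (fun x => f x - g x) - gamma * J%:R.
  have [mz|mN] := eqVneq m 0; first by rewrite v0// mulr0.
  by rewrite ler_pdivrMl// exprn_even_gt0.
by move: jJ vb; lra.
Qed.

End lower_bound.

(** * Parameters with a fixed mesh *)

Section fixed_mesh.
Variables (R : realType) (g : L2U R).
Implicit Types (f : L2U R) (n k : nat) (c : nat -> R).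

(** The limit can be wrong only if m = 0 and the d_ s are nonzero with limit 0, as the
    quotient d_ s / m_ s is then arbitrary; the last premise excludes this. *)
Lemma pot_cvg T (F : set_system T) {FF : Filter F} (gamma_ m_ d_ : T -> R) (gamma m d : R) n :
  (0 < n)%N -> (forall s, 0 <= gamma_ s) -> (forall s, 0 <= m_ s) -> 0 <= gamma -> 0 <= m ->
  gamma_ @ F --> gamma -> m_ @ F --> m -> d_ @ F --> d ->
  pot gamma m n d != 0 \/ (forall s, d_ s = d) ->
  (fun s => pot (gamma_ s) (m_ s) n (d_ s)) @ F --> pot gamma m n d.
Proof.
move=> n0 gs0 ms0 g0 m0 gc mc dc hd.
have nn0 : 0 < n%:R :> R by rewrite ltr0n.
move: g0; rewrite le_eqVlt => /predU1P[gz|gp].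
  rewrite /(pot gamma) -gz ltxx; rewrite -gz in gc.
  apply: (@squeeze_cvgr _ _ _ _ (cst 0) gamma_) => //; last exact: cvg_cst.
  by apply: nearW => s; rewrite pot_ge0 pot_le.
have gnear : \forall s \near F, 0 < gamma_ s by move/cvgr_gt : gc => /(_ _ gp).
move: m0; rewrite le_eqVlt => /predU1P[mz|mp].
  have [dz|dN] := eqVneq d 0.
    case: hd => [|ds]; first by rewrite /pot dz -mz ltxx eqxx mulr0 gp eqxx.
    rewrite (_ : pot gamma m n d = 0); last by rewrite /pot -mz ltxx dz eqxx mulr0 gp.
    apply: cvg_near_cst; apply: nearW => s; rewrite ds dz /pot expr0n/= mulr0 eqxx mulr0.
    by case: ifPn => // gs; case: ifPn => // ms; rewrite min_l// ltW.
  have -> : pot gamma m n d = gamma by rewrite /pot -mz ltxx gp dN mulr1.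
  apply: (cvg_trans _ gc); apply: near_eq_cvg.
  have c1 : (fun s => gamma_ s * m_ s ^+ 2) @ F --> 0.
    have := cvgM gc (cvgM mc mc); rewrite -mz !mulr0; exact.
  have c2 : (fun s => n%:R * d_ s ^+ 2) @ F --> n%:R * d ^+ 2.
    by apply: cvgMl_tmp; exact: (cvgM dc dc).
  have c3 : (fun s => n%:R * d_ s ^+ 2 - gamma_ s * m_ s ^+ 2) @ F --> n%:R * d ^+ 2.
    by rewrite -[X in _ --> X]subr0; exact: cvgB.
  have p3 : 0 < n%:R * d ^+ 2 by rewrite mulr_gt0// exprn_even_gt0.
  move/cvgr_gt : c3 => /(_ _ p3) h; apply: filterS2 h gnear => s hs gs.
  rewrite /pot gs; case: ifPn => ms.
    rewrite min_r// mulrAC ler_pdivlMr ?exprn_gt0//; lra.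
  have mz' : m_ s = 0 by apply/eqP; rewrite eq_le ms0 andbT leNgt.
  have dsN : d_ s != 0.
    by apply: contraL hs => /eqP ->; rewrite mz' !expr0n/= !mulr0 subrr ltxx.
  by rewrite dsN mulr1.
have mnear : \forall s \near F, 0 < m_ s by move/cvgr_gt : mc => /(_ _ mp).
rewrite {2}/pot gp mp Num.Theory.minr_absE.
have c0 : (fun s => n%:R / m_ s ^+ 2 * d_ s ^+ 2) @ F --> n%:R / m ^+ 2 * d ^+ 2.
  apply: cvgM; last exact: (cvgM dc dc).
  apply: cvgMl_tmp; apply: cvgV; first by rewrite sqrf_eq0 gt_eqF.
  exact: (cvgM mc mc).
apply: cvg_trans (_ : (fun s => (n%:R / m_ s ^+ 2 * d_ s ^+ 2 + gamma_ s
   - `|n%:R / m_ s ^+ 2 * d_ s ^+ 2 - gamma_ s|) / 2) @ F --> _).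
  by apply: near_eq_cvg; apply: filterS2 gnear mnear => s gs ms; rewrite /pot gs ms minr_absE.
apply: cvgMr_tmp; apply: cvgB; first exact: cvgD.
by apply: cvg_norm; exact: cvgB.
Qed.

(** The potential is nonnegative, so nothing is to be proved where [pot_cvg] fails. *)
Lemma pot_lsc T (F : set_system T) {FF : Filter F} (gamma_ m_ d_ : T -> R) (gamma m d e : R) n :
  (0 < n)%N -> (forall s, 0 <= gamma_ s) -> (forall s, 0 <= m_ s) -> 0 <= gamma -> 0 <= m ->
  gamma_ @ F --> gamma -> m_ @ F --> m -> d_ @ F --> d -> 0 < e ->
  \forall s \near F, pot gamma m n d - e <= pot (gamma_ s) (m_ s) n (d_ s).
Proof.
move=> n0 gs0 ms0 g0 m0 gc mc dc e0; have [pz|pN] := eqVneq (pot gamma m n d) 0.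
  apply: nearW => s; rewrite pz sub0r; apply: le_trans (pot_ge0 _ _ _ _).
  by rewrite oppr_le0 ltW.
have c : (fun s => pot (gamma_ s) (m_ s) n (d_ s)) @ F --> pot gamma m n d.
  by apply: pot_cvg => //; left.
by move/cvgr_ge : c; apply; rewrite ltrBlDr ltrDl.
Qed.

Lemma mean_eqae f n c k : (0 < n)%N -> (k < n)%N -> eqae f (stepn n c) -> mean f n k = c k.
Proof.
move=> n0 kn fc; rewrite /mean.
have -> : Jn n k f = Jn n k (stepn n c).
  apply: eq_J => //; [exact: L2_mfun (L2U_L2 f)|exact: stepn_mfun|].
  by apply: filterS fc => x ->.
by rewrite Jn_stepn// mulrC divfK// pnatr_eq0 -lt0n.
Qed.

Lemma Jn_ip f n k : (0 < n)%N -> (k < n)%N -> Jn n k f = ip f (stepn n (fun j => (j == k)%:R)).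
Proof.
move=> n0 kn; have Lf := L2U_L2 f; rewrite ipC ip_stepn// (bigD1 (Ordinal kn))//= eqxx mul1r.
by rewrite big1 ?addr0// => j; rewrite -val_eqE/= => /negbTE ->; rewrite mul0r.
Qed.

(** The average over a cell is a scalar product with a fixed function. *)
Lemma mean_cvg T (F : set_system T) {FF : Filter F} (f_ : T -> L2U R) f n k :
  (0 < n)%N -> (k < n)%N -> f_ @ F --> f ->
  (fun s => mean (f_ s) n k) @ F --> mean f n k.
Proof.
move=> n0 kn fc; apply: cvgMl_tmp.
rewrite Jn_ip//; under eq_fun do rewrite Jn_ip//.
apply: ip_cvg; first by move=> s; exact: L2U_L2.
- exact: L2U_L2.
- exact: stepn_L2.
- exact: cvg_L2U.
Qed.

(** The defect of f is at most its squared distance to f_ s, hence 0. *)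
Lemma stepn_closed T (F : set_system T) {FF : ProperFilter F} (f_ : T -> L2U R) f n (c_ : T -> nat -> R) :
  (0 < n)%N -> f_ @ F --> f -> (\forall s \near F, eqae (f_ s) (stepn n (c_ s))) ->
  eqae f (stepn n (mean f n)).
Proof.
move=> n0 fc h; have Lf := L2U_L2 f.
have d0 : defect f n <= 0.
  have c1 : (fun s => nsq (fun x => f_ s x - f x)) @ F --> 0 by exact: cvg_L2U.
  apply: (cvgr_to_ge c1); apply: filterS h => s hs.
  rewrite (@eq_nsq _ _ (fun x => stepn n (c_ s) x - f x)); first exact: defect_le.
  - exact: L2_mfun (L2B (L2U_L2 (f_ s)) Lf).
  - exact: L2_mfun (L2B (stepn_L2 _ n0) Lf).
  by apply: filterS hs => x ->.
have dz : defect f n = 0 by apply/eqP; rewrite eq_le d0 defect_ge0.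
have := nsq_eq0 (L2B (stepn_L2 (mean f n) n0) Lf) dz.
by apply: filterS => x /eqP; rewrite subr_eq0 => /eqP ->.
Qed.

Lemma liminf_fixed_mesh (U : set_system nat) (gamma_ m_ : nat -> R) (gamma m : R)
    (f_ : nat -> L2U R) f a n : UltraFilter U -> (0 < n)%N ->
  (forall s, 0 <= gamma_ s) -> (forall s, 0 <= m_ s) -> 0 <= gamma -> 0 <= m ->
  gamma_ @ U --> gamma -> m_ @ U --> m -> f_ @ U --> f ->
  U [set s | (functional g (gamma_ s, m_ s, (n%:R^-1)%R) (f_ s) < a%:E)%E] ->
  (functional g (gamma, m, (n%:R^-1)%R) f <= a%:E)%E.
Proof.
move=> UU n0 gs0 ms0 g0 m0 gc mc fc Fa.
have fcl s : (functional g (gamma_ s, m_ s, (n%:R^-1)%R) (f_ s) < a%:E)%E ->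
    eqae (f_ s) (stepn n (mean (f_ s) n)).
  move=> /lt_trans/(_ (ltry _))/(functional_discrete_inv n0)[c fcs].
  apply: (eqae_trans fcs); apply/eqae_sym.
  apply: filterS (ae_01 R) => x x01; rewrite /stepn; apply: eq_bigr => k _.
  by rewrite (mean_eqae n0 _ fcs).
have fE : eqae f (stepn n (mean f n)).
  by apply: (stepn_closed (c_ := fun s => mean (f_ s) n) n0 fc); exact: filterS Fa.
rewrite (functional_discrete g g0 m0 n0 fE) lee_fin.
have nc : (fun s => nsq (fun x => f_ s x - g x)) @ U --> nsq (fun x => f x - g x).
  apply: nsq_sub_cvg; do ?[by move=> s; exact: L2U_L2|exact: L2U_L2].
  exact: cvg_L2U.
apply/ler_addgt0Pr => e e0.
pose e' := e / n%:R / 2.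
have nn0 : 0 < n%:R :> R by rewrite ltr0n.
have e'0 : 0 < e' by rewrite !divr_gt0.
have h : \forall s \near U, forall k : 'I_n.-1,
    pot gamma m n (mean f n k.+1 - mean f n k) - e' <=
    pot (gamma_ s) (m_ s) n (mean (f_ s) n k.+1 - mean (f_ s) n k).
  apply: filter_forall => k; have kn : (k.+1 < n)%N by rewrite -ltn_predRL.
  apply: pot_lsc => //; apply: cvgB; first exact: mean_cvg.
  by apply: mean_cvg => //; exact: ltnW.
have h2 : \forall s \near U, nsq (fun x => f x - g x) - e / 2 <= nsq (fun x => f_ s x - g x).
  by move/cvgr_ge : nc; apply; rewrite ltrBlDr ltrDl divr_gt0.
have [s [[h1s h2s] h3s]] := filter_ex (filterI (filterI h h2) Fa).
have h3 : (functional g (gamma_ s, m_ s, (n%:R^-1)%R) (f_ s) < a%:E)%E := h3s.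
rewrite (functional_discrete g (gs0 s) (ms0 s) n0 (fcl s h3s)) lte_fin in h3.
have h4 : \sum_(k < n.-1) pot gamma m n (mean f n k.+1 - mean f n k) <=
  \sum_(k < n.-1) pot (gamma_ s) (m_ s) n (mean (f_ s) n k.+1 - mean (f_ s) n k) + e / 2.
  apply: (@le_trans _ _ (\sum_(k < n.-1)
    (pot (gamma_ s) (m_ s) n (mean (f_ s) n k.+1 - mean (f_ s) n k) + e'))).
    by apply: ler_sum => k _; rewrite -lerBlDr.
  rewrite big_split/= lerD2l sumr_const card_ord -(mulr_natr e').
  have -> : e / 2 = e' * n%:R by rewrite /e'; field; exact: lt0r_neq0.
  by apply: ler_wpM2l; [exact: ltW|rewrite ler_nat leq_pred].
lra.
Qed.

(** The constant sequence recovers f: its increments do not depend on s, which is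
    the unconditional case of [pot_cvg]. *)
Lemma limsup_fixed_mesh (gamma_ m_ : nat -> R) (gamma m : R) f n : (0 < n)%N ->
  (forall s, 0 <= gamma_ s) -> (forall s, 0 <= m_ s) -> 0 <= gamma -> 0 <= m ->
  gamma_ @ \oo --> gamma -> m_ @ \oo --> m ->
  (functional g (gamma, m, (n%:R^-1)%R) f < +oo)%E ->
  forall e, 0 < e -> \forall s \near \oo,
    (functional g (gamma_ s, m_ s, (n%:R^-1)%R) f <=
     functional g (gamma, m, (n%:R^-1)%R) f + e%:E)%E.
Proof.
move=> n0 gs0 ms0 g0 m0 gc mc /(functional_discrete_inv n0)[c fc] e e0.
have h : (fun s => \sum_(k < n.-1) pot (gamma_ s) (m_ s) n (c k.+1 - c k)) @ \oo -->
    \sum_(k < n.-1) pot gamma m n (c k.+1 - c k).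
  apply: cvg_big => [|k _]; first exact: add_continuous.
  apply: pot_cvg => //; first exact: cvg_cst.
  by right.
have l : \sum_(k < n.-1) pot gamma m n (c k.+1 - c k) <
  \sum_(k < n.-1) pot gamma m n (c k.+1 - c k) + e by rewrite ltrDl.
move/cvgr_le : h => /(_ _ l); apply: filterS => s hs.
rewrite (functional_discrete g (gs0 s) (ms0 s) n0 fc) (functional_discrete g g0 m0 n0 fc).
by rewrite -EFinD lee_fin; lra.
Qed.

End fixed_mesh.

(** * Gamma-convergence of the whole family *)

Section conclusion.
Variables (R : realType) (g : L2U R).
Implicit Types (f : L2U R) (n k : nat) (c : nat -> R).

Lemma scales_isolated T (F : set_system T) {FF : Filter F} (t_ : T -> R) n : (0 < n)%N ->
  (forall s, scales (t_ s)) -> t_ @ F --> (n%:R^-1 : R) -> \forall s \near F, t_ s = n%:R^-1.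
Proof.
move=> n0 st tc; have nV : 0 < n%:R^-1 :> R by rewrite invr_gt0 ltr0n.
have tp : \forall s \near F, 0 < t_ s by move/cvgr_gt : tc => /(_ _ nV).
(* the inverses are integers that converge to n *)
have tV : (fun s => (t_ s)^-1) @ F --> (n%:R : R).
  by rewrite -[n%:R]invrK; apply: cvgV => //; rewrite gt_eqF.
move/cvgrPdist_lt : tV => /(_ 1 ltr01); apply: filterS2 tp => s tp.
case: (st s) => [ts|[k k0 ->]]; first by rewrite ts ltxx in tp.
rewrite invrK distrC ltr_norml => /andP[h1 h2]; congr (_%:R^-1); apply/eqP.
by rewrite eqn_leq -(ltnS k) -(ltnS n) -!(ltr_nat R) -!natr1; apply/andP; split; lra.
Qed.

(** All energies are nonnegative. *)
Lemma fidelity_le gamma m t f a : 0 <= gamma -> 0 <= m -> scales t ->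
  (functional g (gamma, m, t) f < a%:E)%E ->
  nsq (fun x => f x - g x) - defect_at g t <= a.
Proof.
move=> g0 m0 [->|[n n0 ->]] Fa.
  rewrite /defect_at /at_scale eqxx subr0.
  move: g0; rewrite le_eqVlt => /predU1P[gz|gp].
    by move: Fa; rewrite -gz functional0_g0 lte_fin => /ltW.
  have [t0 [v [d v0]]] := functional0_inv gp m0 (lt_trans Fa (ltry _)).
  rewrite (functional0_eq _ gp m0 d v0) lte_fin in Fa.
  have h1 : 0 <= gamma * (njumps t0)%:R by rewrite mulr_ge0 ?(ltW gp).
  have h2 : 0 <= (m ^+ 2)^-1 * nsq v by rewrite mulr_ge0 ?nsq_ge0// invr_ge0 sqr_ge0.
  lra.
have [c fc] := functional_discrete_inv n0 (lt_trans Fa (ltry _)).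
rewrite (functional_discrete _ g0 m0 n0 fc) lte_fin in Fa.
rewrite /defect_at /at_scale invr_eq0 pnatr_eq0 eqn0Ngt n0/= invrK natrK.
have : 0 <= \sum_(k < n.-1) pot gamma m n (c k.+1 - c k).
  by apply: sumr_ge0 => k _; exact: pot_ge0.
lra.
Qed.

Section parameter_sequences.
Variables (gamma_ m_ t_ : nat -> R) (gamma m : R).
Hypotheses (gs0 : forall s, 0 <= gamma_ s) (ms0 : forall s, 0 <= m_ s)
  (ts : forall s, scales (t_ s)) (g0 : 0 <= gamma) (m0 : 0 <= m).

Lemma ultra_liminf t (U : set_system nat) (f_ : nat -> L2U R) f a : UltraFilter U ->
  scales t -> gamma_ @ U --> gamma -> m_ @ U --> m -> t_ @ U --> t -> f_ @ U --> f ->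
  U [set s | (functional g (gamma_ s, m_ s, t_ s) (f_ s) < a%:E)%E] ->
  (functional g (gamma, m, t) f <= a%:E)%E.
Proof.
move=> UU [->|[n n0 ->]] gc mc tc fc Fa.
  move: g0; rewrite le_eqVlt => /predU1P[gz|gp]; last exact: (liminf_vanishing_mesh UU ms0 ts gp m0 gc mc tc fc Fa).
  rewrite -gz functional0_g0 lee_fin.
  have c1 : (fun s => nsq (fun x => f_ s x - g x)) @ U --> nsq (fun x => f x - g x).
    apply: nsq_sub_cvg; do ?[by move=> s; exact: L2U_L2|exact: L2U_L2].
    exact: cvg_L2U.
  have c2 : (fun s => defect_at g (t_ s)) @ U --> 0.
    by apply: at_scale_cvg => //; exact: defect_cvg.
  have c3 : (fun s => nsq (fun x => f_ s x - g x) - defect_at g (t_ s)) @ U -->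
      nsq (fun x => f x - g x).
    by rewrite -[X in _ --> X]subr0; exact: cvgB c1 c2.
  apply: (cvgr_to_le c3).
  by apply: filterS Fa => s; exact: fidelity_le.
apply: (liminf_fixed_mesh UU n0 gs0 ms0 g0 m0 gc mc fc).
by apply: filterS2 (scales_isolated n0 ts tc) Fa => s /= ->.
Qed.

(** Functions constant on the cells of some mesh are dense, and with v = 0 they
    satisfy the premises of [recovery] for every m; their jumps cost nothing in
    the limit. *)
Lemma recovery_gamma0 f e : gamma_ @ \oo --> 0 -> m_ @ \oo --> m -> t_ @ \oo --> 0 -> 0 < e ->
  \forall s \near \oo, exists2 y : L2U R, ball f e y &
    (functional g (gamma_ s, m_ s, t_ s) y <= (nsq (fun x => (f : R -> R) x - g x) + e)%R%:E)%E.
Proof.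
move=> gc mc tc e0; have Lf := L2U_L2 f; have Lg := L2U_L2 g.
have e2 : 0 < e / 2 by rewrite divr_gt0.
have [phi_ Sphi phic] := test_dense Lf.
have Lphi k : L2 (phi_ k) by exact: smooth_L2 (Sphi k).1.
have c1 : (fun k => nsq (fun x => phi_ k x - g x)) @ \oo --> nsq (fun x => f x - g x).
  exact: nsq_sub_cvg.
have [k [k1 k2]] : exists k, nsq (fun x => phi_ k x - f x) < (e / 2) ^+ 2 /\
    nsq (fun x => phi_ k x - g x) < nsq (fun x => f x - g x) + e / 2.
  have h1 : \forall k \near \oo, nsq (fun x => phi_ k x - f x) < (e / 2) ^+ 2.
    by move/cvgr_lt : phic; apply; rewrite exprn_gt0.
  have h2 : \forall k \near \oo, nsq (fun x => phi_ k x - g x) < nsq (fun x => f x - g x) + e / 2.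
    by move/cvgr_lt : c1; apply; rewrite ltrDl.
  by have [k] := filter_ex (filterI h1 h2); exists k.
have Ls n : L2 (sample n.+1 (phi_ k)) by exact: stepn_L2.
have c2 : (fun n => nsq (fun x => sample n.+1 (phi_ k) x - phi_ k x)) @ \oo --> 0.
  rewrite (cvg_shiftS (fun n => nsq (fun x => sample n (phi_ k) x - phi_ k x))).
  exact: sample_cvg_continuous (smooth_continuous (Sphi k).1).
have [n [n1 n2]] : exists n, nsq (fun x => sample n.+1 (phi_ k) x - f x) < (e / 2) ^+ 2 /\
    nsq (fun x => sample n.+1 (phi_ k) x - g x) < nsq (fun x => f x - g x) + e / 2.
  have h1 : \forall n \near \oo, nsq (fun x => sample n.+1 (phi_ k) x - f x) < (e / 2) ^+ 2.
    exact: cvgr_lt (nsq_sub_cvg Ls (Lphi k) Lf c2) _ k1.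
  have h2 : \forall n \near \oo, nsq (fun x => sample n.+1 (phi_ k) x - g x) <
      nsq (fun x => f x - g x) + e / 2.
    exact: cvgr_lt (nsq_sub_cvg Ls (Lphi k) Lg c2) _ k2.
  by have [n] := filter_ex (filterI h1 h2); exists n.
have [y yE] := L2_class (Ls n).
have d : decomp y (sample n.+1 (phi_ k)) (cst 0).
  have [sT _] := @stepn_stepUn R n.+1 (fun j => phi_ k (@grid R n.+1 j)) isT.
  split; [exact: sT|exact: stepn_mfun|exact: L2_cst|].
  by apply: filterS yE => x ->; rewrite (_ : prim _ x = 0) ?addr0//; exact: J_eq0.
have fy : ball f (e / 2) y.
  apply/ball_L2U; rewrite -(@ltr_pXn2r _ 2)// ?nnegrE ?nrm_ge0 ?(ltW e2)// nrm_sq.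
  rewrite nsqBC (_ : nsq _ = nsq (fun x => sample n.+1 (phi_ k) x - f x))//.
  apply: eq_nsq; [exact: L2_mfun (L2B (L2U_L2 y) Lf)|exact: L2_mfun (L2B (Ls n) Lf)|].
  by apply: filterS yE => x ->.
have yg : nsq (fun x => y x - g x) = nsq (fun x => sample n.+1 (phi_ k) x - g x).
  apply: eq_nsq; [exact: L2_mfun (L2B (L2U_L2 y) Lg)|exact: L2_mfun (L2B (Ls n) Lg)|].
  by apply: filterS yE => x ->.
have := recovery g gs0 ms0 ts m0 gc mc tc d (fun=> nsq_cst0 R) e2.
apply: filterS => s [z yz Fz]; exists z.
  by rewrite (splitr e); exact: ball_triangle fy yz.
apply: (le_trans Fz); rewrite lee_fin yg nsq_cst0 mul0r mulr0; lra.
Qed.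

Lemma recovery_all t f : scales t ->
  gamma_ @ \oo --> gamma -> m_ @ \oo --> m -> t_ @ \oo --> t ->
  (functional g (gamma, m, t) f < +oo)%E ->
  exists2 b : R, functional g (gamma, m, t) f = b%:E &
  forall e, 0 < e -> \forall s \near \oo, exists2 y : L2U R, ball f e y &
    (functional g (gamma_ s, m_ s, t_ s) y <= (b + e)%:E)%E.
Proof.
move=> [->|[n n0 ->]] gc mc tc Ff.
  move: g0; rewrite le_eqVlt => /predU1P[gz|gp].
    rewrite -gz in gc *; exists (nsq (fun x => f x - g x)); first exact: functional0_g0.
    by move=> e; exact: recovery_gamma0.
  have [t0 [v [d v0]]] := functional0_inv gp m0 Ff.
  exists (gamma * (njumps t0)%:R + (m ^+ 2)^-1 * nsq v + nsq (fun x => f x - g x)).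
    exact: functional0_eq.
  by move=> e; exact: recovery.
have [c fc] := functional_discrete_inv n0 Ff.
have fE := functional_discrete g g0 m0 n0 fc.
eexists; first exact: fE.
move=> e e0; have h := limsup_fixed_mesh n0 gs0 ms0 g0 m0 gc mc Ff e0.
apply: filterS2 (scales_isolated n0 ts tc) h.
by move=> s -> h; exists f; [exact: ballxx|rewrite EFinD -fE].
Qed.

End parameter_sequences.
End conclusion.

Theorem theorem6 (R : realType) (g : L2U R)
    (q_ : nat -> R * R * R) (q : R * R * R)
    (hq_ : forall s, parameters (q_ s)) (hq : parameters q)
    (cvq : q_ @ \oo --> q) :
  gamma_cvg (fun s => functional g (q_ s)) (functional g q).
Proof.
pose gamma_ s := (q_ s).1.1; pose m_ s := (q_ s).1.2; pose t_ s := (q_ s).2.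
have qE : q_ = fun s => (gamma_ s, m_ s, t_ s).
  by apply/funext => s; rewrite /gamma_ /m_ /t_; case: (q_ s) => [[]].
have gs0 s : 0 <= gamma_ s by have [] := hq_ s.
have ms0 s : 0 <= m_ s by have [] := hq_ s.
have ts s : scales (t_ s) by have [] := hq_ s.
case: q hq cvq => [[gamma m] t] [/= g0 m0 st] cvq.
have tc : t_ @ \oo --> t by exact: (cvg_comp _ _ cvq (@cvg_snd _ _ _ _ _)).
have c1 : (fun s => (q_ s).1) @ \oo --> (gamma, m) by exact: (cvg_comp _ _ cvq (@cvg_fst _ _ _ _ _)).
have gc : gamma_ @ \oo --> gamma by exact: (cvg_comp _ _ c1 (@cvg_fst _ _ _ _ _)).
have mc : m_ @ \oo --> m by exact: (cvg_comp _ _ c1 (@cvg_snd _ _ _ _ _)).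
rewrite /gamma_cvg; split.
  apply: (@gamma_liminf R (L2U R) (fun s => functional g (q_ s))) => U f f_ a UU oU fc Fa.
  rewrite qE in Fa.
  by apply: (ultra_liminf gs0 ms0 ts g0 m0 UU st _ _ _ fc Fa) => A cA;
    apply: oU; [exact: gc|exact: mc|exact: tc].
suff key (f : L2U R) : exists2 f_ : nat -> L2U R, f_ @ \oo --> f &
  (limn_esup (fun s => functional g (q_ s) (f_ s)) <= functional g (gamma, m, t) f)%E by exact: key.
have [Fi|] := eqVneq (functional g (gamma, m, t) f) +oo%E.
  by exists (cst f); [exact: cvg_cst|rewrite Fi leey].
rewrite -ltey => Ff.
have [b -> bP] := recovery_all gs0 ms0 ts g0 m0 st gc mc tc Ff.
apply: (@gamma_limsup R (L2U R) (fun s => functional g (q_ s))) => e e0.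
by rewrite qE; exact: bP.
Qed.
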